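(* ($\Sigma$-compactness theorem.) Let $(X,\mathcal{H},\lambda)$ be a homogenizer with $X$ metrizable, $\Omega\subset X$ a nonempty open set (with the restriction of $\lambda$), $A$ a homogenization algebra on $(X,\mathcal{H},\lambda)$, and $1<p<+\infty$. Let $S$ be a fundamental sequence and $(u_\varepsilon)_{\varepsilon\in S}$ a bounded sequence in $L^p(\Omega)$. Then there is a subsequence $S'$ of $S$ such that $(u_\varepsilon)_{\varepsilon\in S'}$ weakly $\Sigma$-converges in $L^p(\Omega)$ to some $u_0\in L^p(\Omega\times\Delta(A))$.
   Context: An $\mathbb{R}$-group is an abelian group $E$ (operation written multiplicatively) whose underlying set is a subset of $\mathbb{R}$ containing all positive integers, such that: (RG1) with the natural order of $\mathbb{R}$, $E$ is a totally ordered group; (RG2) with the topology induced from $\mathbb{R}$, $E$ is a locally compact group; (RG3) there is a nonconstant continuous homomorphism $h:E\to\mathbb{R}_+^*$ such that for every $\alpha\in E$ the set $\{\varepsilon\in E:\varepsilon\ge\alpha\}$ is integrable for $h\cdot m$, $m$ a Haar measure on $E$. $e$ is the identity of $E$, $\varepsilon^{-1}$ the group inverse, $\theta=\inf E\in\mathbb{R}\cup\{\pm\infty\}$; inequalities refer to the order of $\mathbb{R}$. An action of $E$ on $X$ is a family $(H_\varepsilon)_{\varepsilon\in E}$ of bijections of $X$ with $H_\varepsilon\circ H_{\varepsilon'}=H_{\varepsilon\varepsilon'}$, $H_e=\mathrm{id}_X$; continuous if $(\varepsilon,x)\mapsto H_\varepsilon(x)$ is continuous on $E\times X$; absorptive if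 some $\omega\in X$ satisfies: for every neighbourhood $V$ of $\omega$ and every $x\in X$ there are a neighbourhood $U$ of $x$ and $\alpha\in E$ with $H_{\varepsilon^{-1}}(U)\subset V$ for all $\varepsilon\le\alpha$; this $\omega$ is unique, the center. A positive Radon measure $\lambda$ is $\mathcal{H}$-homogeneous if for each $\varepsilon$ there is $c(\varepsilon)>0$ with $\int\varphi(H_\varepsilon(x))d\lambda(x)=c(\varepsilon)\int\varphi\,d\lambda$ for all $\varphi\in\mathcal{K}(X)$; nontrivial if $\lambda\ne0$, $\lambda\ne\delta_\omega$. A homogenizer is a triple $(X,\mathcal{H},\lambda)$ with $X$ a noncompact locally compact space in which each point has a countable neighbourhood base, $\mathcal{H}$ a continuous absorptive action of an $\mathbb{R}$-group $E$ on $X$, $\lambda$ a nontrivial $\mathcal{H}$-homogeneous positive Radon measure; $X$ is equipped with $\lambda$. $\mathcal{B}(X)$ is the space of bounded continuous complex functions on $X$ with the sup norm. $\Pi^\infty(X,\mathcal{H},\lambda)$ is the space of $u\in\mathcal{B}(X)$ for which there is a constant $\tilde u$ with $u\circ H_\varepsilon\to\tilde u$ weak-$*$ in $L^\infty(X)$ as $\varepsilon\to\theta$; $M(u)=\tilde u$. A homogenization algebra on $(X,\mathcal{H},\lambda)$ is a closed subalgebra $A$ of $\mathcal{B}(X)$ which is separable for the sup norm, contains the constants, is closed under complex conjugation, and satisfies $A\subset\Pi^\infty(X,\mathcal{H},\lambda)$. $\Delta(A)$ is its spectrum (nonzero multiplicative linear forms, with the weak-$*$ topology; a compact metrizable space),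 $\mathcal{G}:A\to\mathcal{C}(\Delta(A))$, $\mathcal{G}(u)(s)=s(u)$, the Gelfand transformation, and $\beta$ the unique Radon (probability) measure on $\Delta(A)$ with $M(u)=\int_{\Delta(A)}\mathcal{G}(u)\,d\beta$ for all $u\in A$; $\Delta(A)$ carries $\beta$. For $\psi\in L^{p'}(\Omega;A)$ ($1/p'=1-1/p$), $\psi^\varepsilon(x)=\psi(x,H_\varepsilon(x))$, where $\psi(x,y)$ is the value at $y$ of $\psi(x)\in A$ (this lies in $L^{p'}(\Omega)$), and $\widehat\psi(x,s)=\mathcal{G}(\psi(x))(s)$. A fundamental sequence is a sequence $S=(\varepsilon_n)_{n\in\mathbb{N}}$ in $E$ with $\varepsilon_n\le e$ and $\varepsilon_n\to\theta$. A sequence $(u_\varepsilon)_{\varepsilon\in S}$ in $L^p(\Omega)$ weakly $\Sigma$-converges in $L^p(\Omega)$ to $u_0\in L^p(\Omega\times\Delta(A))$ if, as $S\ni\varepsilon\to\theta$, $\int_\Omega u_\varepsilon\psi^\varepsilon\,d\lambda\to\iint_{\Omega\times\Delta(A)}u_0(x,s)\widehat\psi(x,s)\,d\lambda(x)\,d\beta(s)$ for all $\psi\in L^{p'}(\Omega;A)$. *)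

(* Defs.v *)
From HB Require Import structures.
From mathcomp Require Import all_boot all_order all_algebra.
From mathcomp Require Import all_classical all_reals all_analysis.
From mathcomp Require Export complex.
Import Order.TTheory GRing.Theory Num.Theory.
Import numFieldNormedType.Exports.

Set Implicit Arguments.
Unset Strict Implicit.
Unset Printing Implicit Defensive.

Local Open Scope classical_set_scope.
Local Open Scope ring_scope.

(* R[i] is inhabited (needed for measurable structures on function types). *)
HB.instance Definition _ (R : realType) := isPointed.Build R[i] (0%R : R[i]).

Notation borel X := (g_sigma_algebraType (@open X)).

Section Defs.
Context {R : realType}.
Local Notation C := R[i].

Definition cabs (z : C) : R := Num.sqrt (complex.Re z ^+ 2 + complex.Im z ^+ 2).
Definition cofR (r : R) : C := Complex r 0.

Definition ccontinuous {T : topologicalType} (f : T -> C) :=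
  continuous (fun x => complex.Re (f x)) /\ continuous (fun x => complex.Im (f x)).

Definition cmeasurable {d} {T : measurableType d} (D : set T) (f : T -> C) :=
  measurable_fun D (fun x => complex.Re (f x)) /\ measurable_fun D (fun x => complex.Im (f x)).

Definition cint {d} {T : measurableType d} (mu : {measure set T -> \bar R})
  (D : set T) (f : T -> C) : C :=
  Complex (Rintegral mu D (fun x => complex.Re (f x))) (Rintegral mu D (fun x => complex.Im (f x))).

Definition ccvg (z : nat -> C) (l : C) :=
  (fun n => complex.Re (z n)) @ \oo --> complex.Re l /\ (fun n => complex.Im (z n)) @ \oo --> complex.Im l.

Definition cLp {d} {T : measurableType d} (mu : {measure set T -> \bar R})
  (D : set T) (p : R) (f : T -> C) :=
  cmeasurable D f /\ (\int[mu]_(x in D) ((cabs (f x)) `^ p)%:E < +oo)%E.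

Definition abelian_group_on (E : set R) (mul : R -> R -> R) (e : R) (inv : R -> R) :=
  [/\ E e, (forall x y, E x -> E y -> E (mul x y)), (forall x, E x -> E (inv x)) &
    [/\ (forall x y z, E x -> E y -> E z -> mul x (mul y z) = mul (mul x y) z),
      (forall x y, E x -> E y -> mul x y = mul y x),
      (forall x, E x -> mul e x = x) &
      (forall x, E x -> mul (inv x) x = e)]].

Definition ordered_group_on (E : set R) (mul : R -> R -> R) :=
  forall x y z, E x -> E y -> E z -> x <= y -> mul x z <= mul y z.

Definition lc_group_on (E : set R) (mul : R -> R -> R) (inv : R -> R) :=
  [/\ {within E `*` E, continuous (fun q : R * R => mul q.1 q.2)},
      {within E, continuous inv} &
      (forall x, E x -> exists K : set R, [/\ compact K, K `<=` E &
          exists U : set R, [/\ open U, U x & U `&` E `<=` K]])].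

(* Haar measure of the locally compact group E, viewed as a Borel measure on R
   carried by E; Radon = finite on compact subsets (E is second countable). *)
Definition haar_on (E : set R) (mul : R -> R -> R) (m : {measure set R -> \bar R}) :=
  [/\ measurable E, m (~` E) = 0%E, (0 < m E)%E,
      (forall K : set R, compact K -> K `<=` E -> (m K < +oo)%E) &
      (forall x B, E x -> measurable B -> B `<=` E -> m (mul x @` B) = m B)].

Definition RG3 (E : set R) (mul : R -> R -> R) :=
  exists h : R -> R, [/\ {within E, continuous h},
    (forall x, E x -> 0 < h x),
    (forall x y, E x -> E y -> h (mul x y) = h x * h y),
    (exists x y, [/\ E x, E y & h x != h y]) &
    exists m : {measure set R -> \bar R}, haar_on E mul m /\
      forall a, E a -> m.-integrable [set x | E x /\ a <= x] (fun x => (h x)%:E)].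

Definition R_group (E : set R) (mul : R -> R -> R) (e : R) (inv : R -> R) :=
  [/\ (forall n : nat, E n.+1%:R), abelian_group_on E mul e inv,
      ordered_group_on E mul, lc_group_on E mul inv & RG3 E mul].

Definition theta (E : set R) : \bar R := ereal_inf (EFin @` E).

Definition fundamental_seq (E : set R) (e : R) (eps : nat -> R) :=
  (forall n, E (eps n) /\ eps n <= e) /\ (fun n => (eps n)%:E) @ \oo --> theta E.

Section Homogenizer.
Context {X : pseudoPMetricType R}.

Definition action_on (E : set R) (mul : R -> R -> R) (e : R) (H : R -> X -> X) :=
  [/\ (forall eps, E eps -> bijective (H eps)),
      (forall eps eps', E eps -> E eps' -> H eps \o H eps' = H (mul eps eps')) &
      H e = id].

Definition continuous_action (E : set R) (H : R -> X -> X) :=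
  {within E `*` [set: X], continuous (fun q : R * X => H q.1 q.2)}.

Definition is_center (E : set R) (inv : R -> R) (H : R -> X -> X) (w : X) :=
  forall V : set X, nbhs w V -> forall x : X, exists U : set X, nbhs x U /\
    exists a, E a /\ forall eps, E eps -> eps <= a -> H (inv eps) @` U `<=` V.

(* positive Radon measure on X, as a Borel measure (Riesz correspondence):
   finite on compacts, outer regular, inner regular on open sets *)
Definition radon (lam : {measure set (borel X) -> \bar R}) :=
  [/\ (forall K : set X, compact K -> (lam K < +oo)%E),
      (forall B : set (borel X), measurable B ->
         lam B = ereal_inf [set lam U | U in [set U : set X | open U /\ B `<=` U]]) &
      (forall U : set X, open U ->
         lam U = ereal_sup [set lam K | K in [set K : set X | compact K /\ K `<=` U]])].

Definition cK (phi : X -> C) :=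
  ccontinuous phi /\ compact (closure [set x | phi x != 0]).

Definition homogeneous (E : set R) (H : R -> X -> X) (lam : {measure set (borel X) -> \bar R}) :=
  forall eps, E eps -> exists c : R, 0 < c /\
    forall phi : X -> C, cK phi ->
      cint lam setT (fun x => phi (H eps x)) = cofR c * cint lam setT phi.

Definition homogenizer (E : set R) (mul : R -> R -> R) (e : R) (inv : R -> R)
  (H : R -> X -> X) (w : X) (lam : {measure set (borel X) -> \bar R}) :=
  [/\ (forall x : X, exists K : set X, nbhs x K /\ compact K)
      /\ ~ compact [set: X],
      action_on E mul e H, continuous_action E H, is_center E inv H w &
      [/\ radon lam, homogeneous E H lam,
          lam setT != 0%E &
          exists B : set (borel X), measurable B /\
             lam B != (\1_B w)%:E ]].

Definition bounded_cont (u : X -> C) :=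
  ccontinuous u /\ exists M : R, forall x, cabs (u x) <= M.

Definition supnorm (u : X -> C) : R := sup [set cabs (u x) | x in [set: X]].

(* u in Pi^oo with mean value ut: u o H_eps -> ut weakly-* in L^oo(X) as eps -> theta *)
Definition Pi_inf_mean (E : set R) (H : R -> X -> X)
  (lam : {measure set (borel X) -> \bar R}) (u : X -> C) (ut : C) :=
  forall f : X -> C, cLp lam setT 1 f ->
    forall eta : R, 0 < eta -> exists V : set (\bar R), nbhs (theta E) V /\
      forall eps, E eps -> V eps%:E ->
        cabs (cint lam setT (fun x => u (H eps x) * f x) - ut * cint lam setT f) < eta.

Definition homog_algebra (E : set R) (H : R -> X -> X)
  (lam : {measure set (borel X) -> \bar R}) (A : set (X -> C)) :=
  [/\ (forall u, A u -> bounded_cont u) /\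
      (forall c : C, A (fun=> c)),
      (forall u v, A u -> A v -> A (fun x => u x + v x)),
      (forall (c : C) u, A u -> A (fun x => c * u x)),
      (forall u v, A u -> A v -> A (fun x => u x * v x)) &
      [/\ (forall u, A u -> A (fun x => (u x)^*%C)),
          (forall u, bounded_cont u ->
             (forall eta : R, 0 < eta -> exists v, A v /\ supnorm (fun x => u x - v x) < eta) ->
             A u),
          (exists d : nat -> X -> C, (forall n, A (d n)) /\
             forall u, A u -> forall eta : R, 0 < eta ->
               exists n, supnorm (fun x => u x - d n x) < eta) &
          (forall u, A u -> exists ut : C, Pi_inf_mean E H lam u ut)]].

(* Delta(A): nonzero multiplicative linear forms on A; represented as maps
   (X -> C) -> C vanishing outside A (so that each character has exactly one
   representative). *)
Definition spectrum (A : set (X -> C)) (s : (X -> C) -> C) :=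
  [/\ (forall u v, A u -> A v -> s (fun x => u x + v x) = s u + s v),
      (forall (c : C) u, A u -> s (fun x => c * u x) = c * s u),
      (forall u v, A u -> A v -> s (fun x => u x * v x) = s u * s v),
      (exists u, A u /\ s u != 0) &
      (forall u, ~ A u -> s u = 0)].

Definition wstar_open (A : set (X -> C)) (U : set ((X -> C) -> C)) :=
  U `<=` spectrum A /\
  forall s0, U s0 -> exists (k : nat) (us : 'I_k -> X -> C) (eta : R), [/\ 0 < eta,
    (forall i, A (us i)) &
    [set s | spectrum A s /\ forall i, cabs (s (us i) - s0 (us i)) < eta] `<=` U].

(* Borel sets of Delta(A) (the complement of Delta(A) in the ambient type is
   also measurable). *)
Local Notation Delta_type A := (g_sigma_algebraType (wstar_open A)).

Definition gelfand_measure (E : set R) (H : R -> X -> X)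
  (lam : {measure set (borel X) -> \bar R}) (A : set (X -> C))
  (beta : {measure set (Delta_type A) -> \bar R}) :=
  beta (~` spectrum A) = 0%E /\
  forall u, A u -> forall ut : C, Pi_inf_mean E H lam u ut ->
    ut = cint beta (spectrum A) (fun s => s u).

(* psi in L^q(Om; A) (Bochner): strongly measurable (pointwise limit on Om, in
   sup norm, of A-valued measurable simple functions) with
   int_Om ||psi(x)||^q < oo *)
Definition LpA (lam : {measure set (borel X) -> \bar R}) (Om : set X)
  (A : set (X -> C)) (q : R) (psi : X -> X -> C) :=
  [/\ (forall x, Om x -> A (psi x)),
      (exists sn : nat -> X -> (X -> C),
         [/\ (forall n, finite_set (range (sn n))),
             (forall n x, A (sn n x)),
             (forall n v, measurable ((sn n @^-1` [set v]) : set (borel X))) &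
             (forall x, Om x ->
                (fun n => supnorm (fun y => sn n x y - psi x y)) @ \oo --> 0)]) &
      (\int[lam]_(x in Om) ((supnorm (psi x)) `^ q)%:E < +oo)%E].

Definition Lp_prod (lam : {measure set (borel X) -> \bar R}) (Om : set X)
  (A : set (X -> C)) (beta : {measure set (Delta_type A) -> \bar R}) (p : R)
  (u0 : X -> ((X -> C) -> C) -> C) :=
  cmeasurable ((Om : set (borel X)) `*` (spectrum A : set (Delta_type A)))
    (fun q : borel X * Delta_type A => u0 q.1 q.2) /\
  (\int[lam]_(x in Om) \int[beta]_(s in spectrum A) ((cabs (u0 x s)) `^ p)%:E < +oo)%E.

End Homogenizer.
End Defs.

Notation Delta_type A := (g_sigma_algebraType (wstar_open A)).

Arguments gelfand_measure {R X} E H lam A beta.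
Arguments Lp_prod {R X} lam Om A beta p u0.

(* Main.v *)
(** Let [1/p + 1/q = 1]. Young's inequality bounds the pairing of [u_n] with [psi^(eps_n)] by the
    [p]-th power integral of [u_n] and the [q]-th power integral of [psi^(eps_n)]. The latter
    converges to the one of [hat psi] on [Om x Delta(A)] when [psi] is simple: this is the mean
    value property of [|v|^q] for real [v] in [A], which follows from the one of polynomials in
    [v] by Weierstrass approximation. Along an ultrafilter finer than [n -> oo] the pairings
    therefore converge, on simple [psi], to a linear form in [hat psi] which is bounded for the
    [L^q] norm; it is represented by some [u0] in [L^p], found by minimizing
    [|g|_q^q / q - L g] and using the uniform convexity of [|.|^q].

    [X] is the union of the compact sets [H_(eps_n) K], where [K] is a compact neighbourhood of
    the center, so [lam] is sigma-finite and the sets of finite measure, like [A], have a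
    countable dense family. One subsequence thus realizes the ultralimit for countably many
    [1_V (x) D], and by density for all [psi] in [L^q(Om; A)]. Real and imaginary parts of
    [u_n] are treated one after the other. *)
Require Import Defs.
From HB Require Import structures.
From mathcomp Require Import all_boot all_order all_algebra.
From mathcomp Require Import all_classical all_reals all_analysis measurable_realfun.
From mathcomp Require Import complex.
From mathcomp Require Import ring lra.
Import Order.TTheory GRing.Theory Num.Theory.
Import numFieldNormedType.Exports.
Set Implicit Arguments.
Unset Strict Implicit.
Unset Printing Implicit Defensive.
Local Open Scope classical_set_scope.
Local Open Scope ring_scope.

(** The ultrafilter is there because the limit form must exist, and be linear, on all simple maps
    before any subsequence is known; the subsequence has to follow it on countably many maps only.
    The form is defined on maps [psi], not on their transforms: that it depends only on [hat psi]
    comes out of the representation. Estimates rest on Young's inequality with a free scale instead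
    of Hoelder's inequality and norms. The limit [g] of a minimizing sequence lies in the test space
    [L^q]; the representing function is [dmap q g], where [dmap q] is the derivative of [|.|^q / q],
    and it lies in [L^p] because [p * (q - 1) = q]. The mean value of powers is what forces the
    splitting into real and imaginary parts: polynomials in a real [v] stay in the real algebra and
    commute with the characters, which are real there. Characters are given as bare multiplicative
    forms; their norm bound, and then their reality, are derived from the closedness of [A] in the
    sup norm. *)

(** * Convexity of the power function *)

Section PowerInequalities.
Context {R : realType}.
Implicit Types (q r a b t x : R).

Definition pabs q a := `|a| `^ q.

(** This is [sgn a * |a| ^ (q - 1)], the derivative of [pabs q / q] when [1 < q]. Positive and
    negative parts reduce its continuity to that of [pabs (q - 1)]. *)
Definition dmap q a := Num.max a 0 `^ (q - 1) - Num.max (- a) 0 `^ (q - 1).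

Lemma pabs_ge0 q a : 0 <= pabs q a. Proof. exact: powR_ge0. Qed.

Lemma pabs0 q : 0 < q -> pabs q 0 = 0.
Proof. by move=> q0; rewrite /pabs normr0 powR0// gt_eqF. Qed.

Lemma pabsN q a : pabs q (- a) = pabs q a. Proof. by rewrite /pabs normrN. Qed.

Lemma pabsM q a b : pabs q (a * b) = pabs q a * pabs q b.
Proof. by rewrite /pabs normrM powRM. Qed.

Lemma le_pabs q a b : 0 <= q -> `|a| <= `|b| -> pabs q a <= pabs q b.
Proof. by move=> q0 ab; rewrite /pabs ge0_ler_powR ?nnegrE. Qed.

Lemma pabs_eq0 q a : 0 < q -> (pabs q a == 0) = (a == 0).
Proof. by move=> q0; rewrite /pabs powR_eq0 normr_eq0 (gt_eqF q0) andbT. Qed.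

Lemma pabsD q a b : 0 <= q -> pabs q (a + b) <= 2 `^ q * (pabs q a + pabs q b).
Proof.
move=> q0; wlog ab : a b / `|b| <= `|a|.
  move=> H; have [/H//|/ltW/H] := leP `|b| `|a|.
  by rewrite addrC [_ + pabs q a]addrC.
rewrite (@le_trans _ _ (pabs q (2 * a)))//.
  by rewrite le_pabs// (le_trans (ler_normD _ _))// normrM normr_nat mulr_natl mulr2n lerD2l.
by rewrite pabsM /pabs normr_nat ler_pM2l ?powR_gt0// lerDl powR_ge0.
Qed.

Lemma continuous_pabs q : 0 < q -> continuous (pabs q).
Proof.
move=> q0 a; have [->|a0] := eqVneq a 0.
  apply/cvgrPdist_lt => e e0; rewrite pabs0//.
  have d0 : 0 < e `^ q^-1 by rewrite powR_gt0.
  near=> x; rewrite sub0r normrN (ger0_norm (pabs_ge0 _ _)) /pabs.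
  rewrite -[e]powRr1 ?ltW// -(mulVf (lt0r_neq0 q0)) powRrM.
  have xd : `|x| < e `^ q^-1 by near: x; exists (e `^ q^-1) => //= y /=; rewrite sub0r normrN.
  by rewrite gt0_ltr_powR ?nnegrE ?powR_ge0.
apply: (@continuous_comp _ _ _ (fun x => `|x|) (fun x => x `^ q)).
  exact: norm_continuous.
apply: differentiable_continuous; apply/derivable1_diffP.
by apply: derivable_powR; rewrite in_itv/= andbT normr_gt0.
Unshelve. all: by end_near. Qed.

Lemma continuous_dmap q : 1 < q -> continuous (dmap q).
Proof.
move=> q1 a; have q0 : 0 < q - 1 by rewrite subr_gt0.
have E (f : R -> R) : {for a, continuous f} -> {for a, continuous (fun x => Num.max (f x) 0 `^ (q - 1))}.
  move=> cf; have -> : (fun x => Num.max (f x) 0 `^ (q - 1)) = pabs (q - 1) \o (fun x => Num.max (f x) 0).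
    by apply/funext => x /=; rewrite /pabs ger0_norm// le_max lexx orbT.
  apply: continuous_comp; last exact: continuous_pabs.
  apply: (@continuous_max _ _ f (cst 0)) => //; exact: cvg_cst.
apply: (@continuousB _ _ _ (fun x => Num.max x 0 `^ (q - 1)) (fun x => Num.max (- x) 0 `^ (q - 1)));
  apply: E; [exact: cvg_id|exact: opp_continuous].
Qed.

Lemma ge0_dmap q a : 1 < q -> 0 <= a -> dmap q a = a `^ (q - 1).
Proof.
move=> q1 a0; rewrite /dmap max_l// max_r ?oppr_le0//.
by rewrite powR0 ?subr0// subr_eq0 gt_eqF.
Qed.

Lemma dmapN q a : dmap q (- a) = - dmap q a.
Proof. by rewrite /dmap opprK opprB. Qed.

Lemma le0_dmap q a : 1 < q -> a <= 0 -> dmap q a = - (- a) `^ (q - 1).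
Proof. by move=> q1 a0; rewrite -[a in LHS]opprK dmapN ge0_dmap// oppr_ge0. Qed.

Lemma norm_dmap q a : 1 < q -> `|dmap q a| = pabs (q - 1) a.
Proof.
move=> q1; rewrite /pabs; case: (leP 0 a) => [a0|/ltW a0].
  by rewrite ge0_dmap// !ger0_norm// powR_ge0.
by rewrite le0_dmap// normrN ger0_norm ?powR_ge0// ler0_norm.
Qed.

Lemma dmap_lt q : 1 < q -> {homo dmap q : a b / a < b}.
Proof.
move=> q1 a b ab; have q0 : 0 < q - 1 by rewrite subr_gt0.
have [a0|a0] := leP 0 a.
  have b0 : 0 <= b by rewrite (le_trans a0)// ltW.
  by rewrite !ge0_dmap// gt0_ltr_powR ?nnegrE.
have [b0|b0] := leP 0 b.
  rewrite [ltLHS]le0_dmap 1?ltW// ge0_dmap//.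
  by rewrite (@lt_le_trans _ _ 0) ?powR_ge0// oppr_lt0 powR_gt0// oppr_gt0.
by rewrite !le0_dmap 1?ltW// ltrN2 gt0_ltr_powR ?nnegrE ?oppr_ge0 1?ltW// ltrN2.
Qed.

Lemma mul_dmap q a : 1 < q -> a * dmap q a = pabs q a.
Proof.
move=> q1; have q0 : 0 < q by rewrite (lt_trans _ q1).
rewrite /pabs; have [a0|/ltW a0] := leP 0 a; first by rewrite ge0_dmap// mulr_powRB1// ger0_norm.
by rewrite ler0_norm// le0_dmap// mulrN -mulNr mulr_powRB1// oppr_ge0.
Qed.

Lemma pabs_dmap p q a : 1 < q -> p * (q - 1) = q -> pabs p (dmap q a) = pabs q a.
Proof. by move=> q1 pq; rewrite /pabs norm_dmap// /pabs -powRrM mulrC pq. Qed.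

(* The tangent line of the convex function [pabs q] at [a] lies below its graph;
   this is Young's inequality for [dmap q a] and [b]. *)
Lemma pabs_tangent q a b : 1 < q ->
  q * (dmap q a * (a - b)) >= pabs q a - pabs q b.
Proof.
move=> q1; have q0 : 0 < q by rewrite (lt_trans _ q1).
have q10 : 0 < q - 1 by rewrite subr_gt0.
have p0 : 0 < q / (q - 1) by rewrite divr_gt0.
have := @conjugate_powR _ (pabs (q - 1) a) `|b| (q / (q - 1)) q.
rewrite pabs_ge0 normr_ge0 => /(_ isT isT p0 q0).
have -> : (q / (q - 1))^-1 + q^-1 = 1.
  by field; rewrite !lt0r_neq0.
move=> /(_ erefl); rewrite -{1}norm_dmap// -normrM {1}/pabs -powRrM.
have -> : (q - 1) * (q / (q - 1)) = q by field; rewrite !lt0r_neq0.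
rewrite -/(pabs q a) -/(pabs q b) => H.
have {H} := le_trans (ler_norm _) H.
rewrite -(ler_pM2l q0) [leRHS](_ : _ = pabs q a * (q - 1) + pabs q b); last first.
  by field; rewrite !lt0r_neq0.
rewrite [dmap q a * (a - b)]mulrBr -(mul_dmap a q1) => H.
by lra.
Qed.

Lemma pabs_lipschitz q a b : 1 < q ->
  `|pabs q a - pabs q b| <= q * Num.max `|a| `|b| `^ (q - 1) * `|a - b|.
Proof.
move=> q1; have q0 : 0 < q by rewrite (lt_trans _ q1).
have H x y : pabs q x - pabs q y <= q * Num.max `|x| `|y| `^ (q - 1) * `|x - y|.
  apply: (le_trans (pabs_tangent x y q1)); rewrite -mulrA ler_pM2l//.
  apply: (le_trans (ler_norm _)); rewrite normrM ler_wpM2r//.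
  rewrite norm_dmap// ge0_ler_powR ?nnegrE ?le_max ?normr_ge0 ?lexx//.
  by rewrite subr_ge0 ltW.
by rewrite ler_norml lerNl opprB H andbT maxC [`|a - b|]distrC H.
Qed.

(** The defect of midpoint convexity: for two near-minimizers its integral is small, and uniform
    convexity then makes them close. *)
Definition pgap q a b := (pabs q a + pabs q b) / 2 - pabs q ((a + b) / 2).

Lemma pgapC q a b : pgap q a b = pgap q b a.
Proof. by rewrite /pgap [pabs q a + _]addrC [a + b]addrC. Qed.

Lemma pgapM q c a b : pgap q (c * a) (c * b) = pabs q c * pgap q a b.
Proof. by rewrite /pgap -mulrDr -mulrA !pabsM -mulrDr -mulrA -mulrBr. Qed.

(** Tangents at the midpoint [m] alone give a weak inequality. Adding those at the quarter points
    [c] and [d], the slopes at [m] cancel and a multiple of [(dmap q c - dmap q d) * (a - b)]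
    remains, which is positive because [dmap q] is strictly increasing. *)
Lemma pgap_gt0 q a b : 1 < q -> a != b -> 0 < pgap q a b.
Proof.
move=> q1 ab; have q0 : 0 < q by rewrite (lt_trans _ q1).
pose m := (a + b) / 2; pose c := (a + m) / 2; pose d := (b + m) / 2.
have := pabs_tangent c a q1; have := pabs_tangent m c q1.
have := pabs_tangent d b q1; have := pabs_tangent m d q1.
have Em1 : m - c = - (a - b) / 4 by rewrite /c /m; field.
have Em2 : m - d = (a - b) / 4 by rewrite /d /m; field.
have Em3 : c - a = - (a - b) / 4 by rewrite /c /m; field.
have Em4 : d - b = (a - b) / 4 by rewrite /d /m; field.
rewrite Em1 Em2 Em3 Em4 => H1 H2 H3 H4.
have : 0 < q * ((dmap q c - dmap q d) * ((a - b) / 4)).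
  rewrite pmulr_rgt0//; have [abl|abl|] := ltgtP a b; last by move/eqP; rewrite (negbTE ab).
    rewrite nmulr_rgt0; first by lra.
    by rewrite subr_lt0; apply: dmap_lt => //; rewrite /c /d; lra.
  rewrite pmulr_rgt0; first by lra.
  by rewrite subr_gt0; apply: dmap_lt => //; rewrite /c /d; lra.
rewrite /pgap -/m.
lra.
Qed.

Lemma pgap_ge0 q a b : 1 < q -> 0 <= pgap q a b.
Proof.
move=> q1; have [->|ab] := eqVneq a b; last by rewrite ltW// pgap_gt0.
have E x : (x + x) / 2 = x :> R by lra.
by rewrite /pgap !E subrr.
Qed.

(* Uniform convexity of L^q, for all [1 < q] at once: by homogeneity one may take
   [a = 1], and strict convexity gives a positive minimum of the gap on the compact
   set of those [b] which are not close to [1]. *)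
Lemma pabs_uniform_convexity q e : 1 < q -> 0 < e ->
  exists2 C : R, 0 <= C &
  forall a b, pabs q (a - b) <= e * (pabs q a + pabs q b) + C * pgap q a b.
Proof.
move=> q1 e0; have q0 : 0 < q by rewrite (lt_trans _ q1).
(* For [t] within [d] of 1 the term in [e] alone absorbs [pabs q (1 - t)]. On [[-1, 1 - d]] the left
   side is at most [2 ^ q], whence the value of [C]. *)
pose d := Num.min 1 (e `^ q^-1).
have d0 : 0 < d by rewrite /d lt_min ltr01 powR_gt0.
have d1 : d <= 1 by rewrite /d ge_min lexx.
have de : d `^ q <= e.
  rewrite (@le_trans _ _ ((e `^ q^-1) `^ q))//.
    by rewrite ge0_ler_powR ?nnegrE ?powR_ge0 ?ge_min ?lexx ?orbT// ltW.
  by rewrite -powRrM mulVf ?lt0r_neq0// powRr1// ltW.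
have cgap : continuous (pgap q 1).
  move=> t; apply: (@continuousB _ _ _ (fun t => (pabs q 1 + pabs q t) / 2)
    (fun t => pabs q ((1 + t) / 2))); last first.
    apply: (@continuous_comp _ _ _ (fun t => (1 + t) / 2) (pabs q)); last exact: continuous_pabs.
    by apply: cvgMr_tmp; apply: cvgD; [exact: cvg_cst|exact: cvg_id].
  apply: cvgMr_tmp; apply: cvgD; first exact: cvg_cst.
  exact: continuous_pabs.
have le1 : - 1 <= 1 - d by lra.
have [t0 /[!in_itv]/= t0d mint] := EVT_min le1 (continuous_subspaceT cgap).
have m0 : 0 < pgap q 1 t0.
  rewrite pgap_gt0//; apply/eqP => t01; move: t0d; rewrite -t01 => /andP[_]; lra.
pose C := 2 `^ q / pgap q 1 t0.
have C0 : 0 <= C by rewrite divr_ge0 ?powR_ge0// ltW.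
exists C => // a b; wlog ab : a b / `|b| <= `|a|.
  move=> H; have [/H//|/ltW/H] := leP `|b| `|a|.
  by rewrite pgapC [_ + pabs q a]addrC -[a - b]opprB pabsN.
have [a0|a0] := eqVneq a 0.
  move: ab; rewrite a0 normr0 normr_le0 => /eqP ->.
  by rewrite subrr pabs0// addr0 mulr0 add0r mulr_ge0// pgap_ge0.
pose t := b / a; have -> : b = a * t by rewrite /t mulrC divfK.
have t1 : `|t| <= 1 by rewrite /t normrM normfV ler_pdivrMr ?mul1r// normr_gt0.
clearbody t; move: t1; rewrite ler_norml => /andP[t1 t2].
have -> : a - a * t = a * (1 - t) by rewrite mulrBr mulr1.
have -> : pgap q a (a * t) = pabs q a * pgap q 1 t by rewrite -pgapM mulr1.
rewrite !pabsM [leRHS](_ : _ = pabs q a * (e * (1 + pabs q t) + C * pgap q 1 t)); last by ring.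
rewrite ler_wpM2l ?pabs_ge0//.
have [td|td] := leP t (1 - d).
  rewrite (@le_trans _ _ (2 `^ q))//.
    by apply: ge0_ler_powR; rewrite ?nnegrE//; [exact: ltW|rewrite ger0_norm; lra].
  apply: ler_wpDl; first by rewrite mulr_ge0 ?addr_ge0 ?pabs_ge0// ltW.
  rewrite /C mulrAC ler_pdivlMr// ler_wpM2l ?powR_ge0// mint// in_itv/=.
  by apply/andP; split.
rewrite (@le_trans _ _ e)//.
  apply: (le_trans _ de); apply: ge0_ler_powR; rewrite ?nnegrE//.
  - exact: ltW.
  - exact: ltW.
  - rewrite ger0_norm; lra.
apply: ler_wpDr; first by rewrite mulr_ge0 ?pgap_ge0.
by rewrite ler_peMr ?(ltW e0)// lerDl pabs_ge0.
Qed.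

End PowerInequalities.

(** * The spaces L^q and the Riesz representation *)

Lemma homo_ltn_ge (phi : nat -> nat) n : {homo phi : m n / (m < n)%N} -> (n <= phi n)%N.
Proof.
by move=> h; elim: n => // n IH; apply: leq_ltn_trans IH (h _ _ _).
Qed.

Lemma homo_ltn_cvg (phi : nat -> nat) : {homo phi : m n / (m < n)%N} -> phi @ \oo --> \oo.
Proof.
move=> h; apply/cvgnyPge => A; exists A => // n /= An.
exact: leq_trans An (homo_ltn_ge n h).
Qed.

Lemma cvg_subseq (S : topologicalType) (phi : nat -> nat) (v : nat -> S) (l : S) :
  {homo phi : m n / (m < n)%N} -> v @ \oo --> l -> (fun n => v (phi n)) @ \oo --> l.
Proof. by move=> /homo_ltn_cvg phic vl; apply: cvg_comp phic vl. Qed.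

Section RealLp.
Context {d : measure_display} {T : measurableType d} {R : realType}.
Variable mu : {measure set T -> \bar R}.
Implicit Types (f g : T -> R) (p q : R).

Definition rint f := mu.-integrable setT (EFin \o f).

Definition Lpow q f := measurable_fun setT f /\ rint (fun x => pabs q (f x)).

Lemma rint_measurable f : rint f -> measurable_fun setT f.
Proof. by move=> /integrableP[/measurable_EFinP]. Qed.

Lemma le_rint f g : measurable_fun setT f -> (forall x, `|f x| <= g x) ->
  rint g -> rint f.
Proof.
move=> mf fg; apply: le_integrable => //; first exact/measurable_EFinP.
by move=> x _ /=; rewrite lee_fin (le_trans (fg x))// ler_norm.
Qed.

Lemma rintD f g : rint f -> rint g -> rint (fun x => f x + g x).
Proof. by move=> rf rg; have := integrableD measurableT rf rg. Qed.

Lemma rintZ k f : rint f -> rint (fun x => k * f x).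
Proof. by move=> rf; have := integrableZl measurableT k rf. Qed.

Lemma rintB f g : rint f -> rint g -> rint (fun x => f x - g x).
Proof. by move=> rf rg; have := integrableB measurableT rf rg. Qed.

Lemma measurable_pabs q : measurable_fun setT (@pabs R q).
Proof.
apply: (measurableT_comp (measurable_powR q)); exact: normr_measurable.
Qed.

Lemma measurable_pabs_comp q f : measurable_fun setT f ->
  measurable_fun setT (pabs q \o f).
Proof. by move=> mf; apply: measurableT_comp => //; exact: measurable_pabs. Qed.

Lemma LpowD q f g : 0 <= q -> Lpow q f -> Lpow q g -> Lpow q (fun x => f x + g x).
Proof.
move=> q0 [mf intf] [mg intg].
have mfg : measurable_fun setT (fun x => f x + g x) by exact: measurable_funD.
split=> //; apply: (@le_rint _ (fun x => 2 `^ q * (pabs q (f x) + pabs q (g x)))).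
- exact: measurable_pabs_comp.
- by move=> x /=; rewrite ger0_norm ?pabs_ge0// pabsD.
- by apply: rintZ; apply: rintD.
Qed.

Lemma LpowZ q k f : Lpow q f -> Lpow q (fun x => k * f x).
Proof.
move=> [mf intf]; split; first exact: measurable_funM.
rewrite (_ : (fun x => _) = (fun x => pabs q k * pabs q (f x))); first exact: rintZ.
by apply/funext => x /=; rewrite pabsM.
Qed.

Lemma LpowB q f g : 0 <= q -> Lpow q f -> Lpow q g -> Lpow q (fun x => f x - g x).
Proof.
move=> q0 lf lg; under eq_fun do rewrite -[- g _]mulN1r.
by apply: LpowD => //; exact: LpowZ.
Qed.

Lemma le_Lpow q f g : 0 <= q -> measurable_fun setT f -> (forall x, `|f x| <= g x) ->
  Lpow q g -> Lpow q f.
Proof.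
move=> q0 mf fg [_ intg]; split => //; apply: (le_rint _ _ intg).
  exact: measurable_pabs_comp.
move=> x /=; rewrite ger0_norm ?pabs_ge0//; apply: le_pabs => //.
by rewrite (le_trans (fg x))// ler_norm.
Qed.

Lemma Lpow_norm q f : Lpow q f -> Lpow q (fun x => `|f x|).
Proof.
move=> [mf intf]; split; first exact: measurableT_comp.
by apply: eq_integrable intf => // x _ /=; rewrite /pabs normr_id.
Qed.

Lemma RintD f g : rint f -> rint g ->
  \int[mu]_x (f x + g x) = \int[mu]_x f x + \int[mu]_x g x.
Proof. exact: RintegralD. Qed.

Lemma RintB f g : rint f -> rint g ->
  \int[mu]_x (f x - g x) = \int[mu]_x f x - \int[mu]_x g x.
Proof. exact: RintegralB. Qed.

Lemma RintZ k f : rint f -> \int[mu]_x (k * f x) = k * \int[mu]_x f x.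
Proof. exact: RintegralZl. Qed.

Lemma le_Rint f g : rint f -> rint g -> (forall x, f x <= g x) ->
  \int[mu]_x f x <= \int[mu]_x g x.
Proof. by move=> rf rg fg; apply: le_Rintegral. Qed.

Lemma Rint_EFin f : rint f -> (\int[mu]_x (f x)%:E = (\int[mu]_x f x)%:E)%E.
Proof.
by move=> rf; rewrite fineK//; apply: integrable_fin_num.
Qed.

Section Young.
Variables p q : R.
Hypotheses (p0 : 0 < p) (q0 : 0 < q) (pq : p^-1 + q^-1 = 1).

(** The scale [t] can make either coefficient small at the expense of the other; this takes the
    place of Hoelder's inequality. *)
Lemma young_pabs (t a b : R) : 0 < t ->
  `|a * b| <= t `^ p / p * pabs p a + t `^ (- q) / q * pabs q b.
Proof.
move=> t0; have ti : 0 < t^-1 by rewrite invr_gt0.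
have := @conjugate_powR _ (t * `|a|) (t^-1 * `|b|) p q.
rewrite !mulr_ge0 ?(ltW t0) ?(ltW ti)// => /(_ isT isT p0 q0 pq).
rewrite mulrACA divff ?gt_eqF// mul1r -normrM !powRM ?(ltW t0) ?(ltW ti)//.
rewrite -[t^-1]powR_inv1 ?(ltW t0)// -powRrM mulN1r.
by rewrite mulrAC [X in _ <= _ + X -> _]mulrAC.
Qed.

Lemma rint_pair f g : Lpow p f -> Lpow q g -> rint (fun x => f x * g x).
Proof.
move=> [mf intf] [mg intg].
apply: (@le_rint _ (fun x => 1 `^ p / p * pabs p (f x) + 1 `^ (- q) / q * pabs q (g x))).
- exact: measurable_funM.
- by move=> x; exact: young_pabs.
- by apply: rintD; apply: rintZ.
Qed.

Lemma young_Rint t f g : 0 < t -> Lpow p f -> Lpow q g ->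
  `|\int[mu]_x (f x * g x)| <=
  t `^ p / p * \int[mu]_x pabs p (f x) + t `^ (- q) / q * \int[mu]_x pabs q (g x).
Proof.
move=> t0 lf lg; have [[mf intf] [mg intg]] := (lf, lg).
apply: (le_trans (le_normr_Rintegral measurableT (rint_pair lf lg))).
rewrite -!RintZ// -RintD; [|exact: rintZ..].
apply: le_Rint => [||x]; last exact: young_pabs.
  exact: (integrable_norm (rint_pair lf lg)).
by apply: rintD; apply: rintZ.
Qed.

End Young.


Lemma fast_subsequence (P : nat -> nat -> Prop) :
  (forall k, exists N, forall n, (N <= n)%N -> P k n) ->
  exists2 phi : nat -> nat, {homo phi : m n / (m < n)%N} & forall k, P k (phi k).
Proof.
move=> /choice[N NP].
pose phi := fix F k := if k is j.+1 then maxn (F j).+1 (N j.+1) else N 0%N.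
exists phi.
  by apply: homo_ltn => [|k]; [exact: ltn_trans|rewrite /= leq_maxl].
by case=> [|k]; apply: NP => //=; rewrite leq_maxr.
Qed.

(* The dominating function comes from [Z := \sum_k `|2 ^ (k + 1) * d_k| ^ q], where
   [d_k] are the increments of the subsequence: if [Z x] is finite then
   [`|d_k x| <= Z x ^ (1 / q) / 2 ^ (k + 1)]. *)
Lemma Lpow_cauchy_subsequence q (f : nat -> T -> R) : 0 < q ->
  (forall n, Lpow q (f n)) ->
  (forall e, 0 < e -> exists N, forall m n, (N <= m)%N -> (N <= n)%N ->
     \int[mu]_x pabs q (f m x - f n x) <= e) ->
  exists phi : nat -> nat, {homo phi : m n / (m < n)%N} /\
  exists G g : T -> R, [/\ Lpow q G, measurable_fun setT g,
    {ae mu, forall x, forall n, `|f (phi n) x| <= G x} &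
    {ae mu, forall x, (fun n => f (phi n) x) @ \oo --> g x}].
Proof.
move=> q0 lf cf.
pose w k : R := (2 ^ k.+1)%:R.
have w0 k : 0 < w k by rewrite ltr0n expn_gt0.
(* With this rate the integral of [|w k * h k| ^ q] is at most [1 / w k = 2 ^ - (k + 1)], so that
   the series [Z] has integral at most 1. *)
pose e k := (pabs q (w k))^-1 * (w k)^-1.
have e0 k : 0 < e k.
  by rewrite mulr_gt0// invr_gt0// lt_neqAle pabs_ge0 eq_sym pabs_eq0// gt_eqF.
have [|phi phi_lt phiP] := @fast_subsequence (fun k n => forall m, (n <= m)%N ->
   \int[mu]_x pabs q (f m x - f n x) <= e k).
  move=> k; have [N NP] := cf _ (e0 k); exists N => n Nn m nm; apply: NP => //.
  exact: leq_trans nm.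
have phi_le k : (phi k <= phi k.+1)%N by rewrite ltnW// phi_lt.
pose h k x := f (phi k.+1) x - f (phi k) x.
have lh k : Lpow q (h k) by apply: LpowB; [exact: ltW|exact: lf|exact: lf].
have lwh k : Lpow q (fun x => w k * h k x) by exact: LpowZ.
pose Z x := (\sum_(0 <= k <oo) (pabs q (w k * h k x))%:E)%E.
have mZk k : measurable_fun setT (fun x => (pabs q (w k * h k x))%:E).
  by apply/measurable_EFinP/measurable_pabs_comp; case: (lwh k).
have mZ : measurable_fun setT Z.
  by apply: ge0_emeasurable_sum => // k x _ _; rewrite lee_fin pabs_ge0.
have Z0 x : (0 <= Z x)%E.
  by apply: nneseries_ge0 => k _ _; rewrite lee_fin pabs_ge0.
have iZ : mu.-integrable setT Z.
  apply/integrableP; split => //.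
  rewrite (@eq_integral _ _ _ _ _ Z); last by move=> x _; rewrite gee0_abs.
  rewrite integral_nneseries//; last by move=> k x _; rewrite lee_fin pabs_ge0.
  apply: (@le_lt_trans _ _ 1%E); last by rewrite ltry.
  apply: le_trans (epsilon_trick0 xpredT ler01).
  apply: lee_nneseries => [k _ _|k _].
    by apply: integral_ge0 => x _; rewrite lee_fin pabs_ge0.
  rewrite Rint_EFin; last by case: (lwh k).
  under eq_Rintegral do rewrite pabsM.
  rewrite RintZ; last by case: (lh k).
  rewrite lee_fin -/(w k) mul1r.
  have := phiP k _ (phi_le k); rewrite /e -/(h k).
  by rewrite ler_pdivlMl// lt_neqAle pabs_ge0 eq_sym pabs_eq0// gt_eqF.
have aeZ := integrable_ae measurableT iZ.
pose z x := fine (Z x).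
have hz x k : Z x \is a fin_num -> `|h k x| <= z x `^ q^-1 / w k.
  move=> fZ; rewrite ler_pdivlMr// mulrC.
  have -> : w k * `|h k x| = (pabs q (w k * h k x)) `^ q^-1.
    by rewrite /pabs -powRrM mulfV ?gt_eqF// powRr1// normrM gtr0_norm.
  rewrite ge0_ler_powR ?nnegrE ?invr_ge0 ?pabs_ge0 ?(ltW q0) ?fine_ge0//.
  rewrite -lee_fin /z fineK//.
  have := @nneseries_lim_ge R (fun k => (pabs q (w k * h k x))%:E) xpredT 0 k.+1.
  move=> H; apply: le_trans (H _) => [|n _ _]; last by rewrite lee_fin pabs_ge0.
  rewrite big_nat_recr//= leeDr// sumEFin lee_fin sumr_ge0// => i _.
  exact: pabs_ge0.
have ftel n x : f (phi n) x = f (phi 0%N) x + \sum_(0 <= k < n) h k x.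
  by rewrite telescope_sumr// addrC subrK.
have wsum n : \sum_(0 <= k < n) (w k)^-1 <= 1.
  suff -> : \sum_(0 <= k < n) (w k)^-1 = 1 - (2 ^ n)%:R^-1 :> R.
    by rewrite lerBlDr lerDl invr_ge0.
  elim: n => [|n IH]; first by rewrite big_nil invr1 subrr.
  rewrite big_nat_recr//= IH /w expnS natrM.
  have : (2 ^ n)%:R != 0 :> R by rewrite pnatr_eq0 expn_eq0.
  by move=> ?; field.
pose G x := `|f (phi 0%N) x| + z x `^ q^-1.
exists phi; split => //.
have mz : measurable_fun setT z by exact: measurableT_comp.
have [N [mN N0 ZN]] := aeZ.
have fZ x : ~ N x -> Z x \is a fin_num.
  by move=> Nx; apply: contrapT => /= ZNx; apply/Nx/ZN => /= /(_ I).
have fcvg x : ~ N x -> cvgn (fun n => f (phi n) x).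
  move=> Nx.
  have -> : (fun n => f (phi n) x) = (fun n => f (phi 0%N) x + series (h ^~ x) n).
    by apply/funext => n; rewrite ftel.
  apply: is_cvgD; first exact: is_cvg_cst.
  apply: normed_cvg; apply: (@series_le_cvg _ _ (geometric (z x `^ q^-1 / 2) 2^-1)).
  - by move=> n /=.
  - by move=> n /=; rewrite mulr_ge0// ?divr_ge0 ?powR_ge0// exprn_ge0.
  - move=> n /=; apply: (le_trans (hz x n (fZ x Nx))).
    by rewrite /w natrX exprS invfM mulrA exprVn.
  - by apply: is_cvg_geometric_series; rewrite ger0_norm// invf_lt1// ltr1n.
(* Zeroing on the null set [N] makes the sequence converge everywhere, so [g] is measurable as a
   pointwise limit. *)
pose fN n := f (phi n) \_ (~` N).
pose g x := lim (fN ^~ x @ \oo).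
have fNg x : fN ^~ x @ \oo --> g x.
  suff : cvgn (fN ^~ x) by [].
  have [Nx|Nx] := pselect (N x).
    rewrite (_ : fN ^~ x = fun=> 0); first exact: is_cvg_cst.
    by apply/funext => n; rewrite /fN patchE memNset//=; exact.
  rewrite (_ : fN ^~ x = fun n => f (phi n) x); first exact: fcvg.
  by apply/funext => n; rewrite /fN patchE mem_set.
exists G, g; split.
- apply: LpowD; [exact: ltW|exact: Lpow_norm|].
  split.
    exact: (measurableT_comp (measurable_powR _) mz).
  apply: (@le_rint _ z).
  + apply: measurable_pabs_comp.
    exact: (measurableT_comp (measurable_powR _) mz).
  + move=> x /=; rewrite ger0_norm ?pabs_ge0// /pabs ger0_norm ?powR_ge0//.
    by rewrite -powRrM mulVf ?gt_eqF// powRr1// fine_ge0.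
  + apply/integrableP; split; first exact/measurable_EFinP.
    case/integrableP : iZ => _; apply: le_lt_trans.
    apply: ge0_le_integral => //.
    * exact/measurableT_comp/measurable_EFinP.
    * exact: measurableT_comp.
    * move=> x _; rewrite !gee0_abs ?lee_fin ?fine_ge0//.
      by rewrite /z /=; case: (Z x) (Z0 x) => //= r _; rewrite leey.
- apply: (@measurable_fun_cvg _ _ _ _ fN) => // n.
  apply/(measurable_restrictT _ (measurableC mN)).
  by apply: measurable_funTS; case: (lf (phi n)).
- exists N; split => // x /= Gx; apply: contrapT => Nx; apply: Gx => n.
  rewrite ftel; apply: (le_trans (ler_normD _ _)); rewrite lerD2l.
  apply: (le_trans (ler_norm_sum _ _ _)).
  rewrite (@le_trans _ _ (\sum_(0 <= k < n) (z x `^ q^-1 * (w k)^-1)))//.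
    by apply: ler_sum => k _; exact/hz/fZ.
  by rewrite -mulr_sumr ler_piMr ?powR_ge0// wsum.
- exists N; split => // x /= Gx; apply: contrapT => Nx; apply: Gx.
  rewrite (_ : (fun n => f (phi n) x) = fN ^~ x); first exact: fNg.
  by apply/funext => n; rewrite /fN patchE mem_set.
Qed.


Lemma Rint_dominated (f : nat -> T -> R) (l g : T -> R) :
  (forall n, measurable_fun setT (f n)) -> measurable_fun setT l ->
  {ae mu, forall x, (fun n => f n x) @ \oo --> l x} ->
  rint g -> {ae mu, forall x, forall n, `|f n x| <= g x} ->
  rint l /\ (fun n => \int[mu]_x f n x) @ \oo --> \int[mu]_x l x.
Proof.
move=> mf ml fl ig fg.
have aefl : {ae mu, forall x, setT x -> (fun n => (f n x)%:E) @ \oo --> (l x)%:E}.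
  by apply: filterS fl => x flx _; apply: cvg_EFin => //; exact: nearW.
have aefg : {ae mu, forall x n, setT x -> (`|(f n x)%:E| <= (g x)%:E)%E}.
  by apply: filterS fg => x fgx n _; rewrite lee_fin.
have mEf n : measurable_fun setT (EFin \o f n) by exact/measurable_EFinP.
have mEl : measurable_fun setT (EFin \o l) by exact/measurable_EFinP.
have [il _ cil] := dominated_convergence measurableT mEf mEl aefl ig aefg.
split=> //; apply: fine_cvg; rewrite fineK; first exact: cil.
exact: integrable_fin_num.
Qed.

Lemma measurable_dmap q : 1 < q -> measurable_fun setT (@dmap R q).
Proof. by move=> q1; apply: continuous_measurable_fun; exact: continuous_dmap. Qed.

Lemma Lpow_dmap p q f : 1 < q -> p * (q - 1) = q -> Lpow q f -> Lpow p (dmap q \o f).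
Proof.
move=> q1 pq [mf intf]; split; first exact: measurableT_comp (measurable_dmap q1) mf.
by apply: eq_integrable intf => // x _ /=; rewrite pabs_dmap.
Qed.

Section Riesz.
(** [F] is a form on the maps themselves, as the limits of pairings are. [P] is a subset because the
    simple maps are considered inside the space of all maps. *)
Variables (q K : R) (W : lmodType R) (P : set W) (hat : W -> T -> R) (F : W -> R).
Hypothesis q1 : 1 < q.
Hypotheses (P0 : P 0) (PD : forall v w, P v -> P w -> P (v + w))
  (PZ : forall c v, P v -> P (c *: v)).
Hypotheses (hatL : forall v, P v -> Lpow q (hat v))
  (hatD : forall v w x, P v -> P w -> hat (v + w) x = hat v x + hat w x)
  (hatZ : forall c v x, P v -> hat (c *: v) x = c * hat v x).
Hypotheses (FD : forall v w, P v -> P w -> F (v + w) = F v + F w)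
  (FZ : forall c v, P v -> F (c *: v) = c * F v)
  (F_le : forall v, P v -> F v <= K + (2 * q)^-1 * \int[mu]_x pabs q (hat v x)).

Let N v := \int[mu]_x pabs q (hat v x).
Let J v := q^-1 * N v - F v.
Let I := inf (J @` P).
Let t n : R := n.+1%:R^-1.

Let q0 : 0 < q. Proof. by rewrite (lt_trans _ q1). Qed.

Let N0 v : 0 <= N v.
Proof. by apply: Rintegral_ge0 => x _; exact: pabs_ge0. Qed.

Let t0 n : 0 < t n. Proof. by rewrite invr_gt0. Qed.

Let t1 n : t n <= 1. Proof. by rewrite invf_le1// ler1n. Qed.

Let le_t m n : (m <= n)%N -> t n <= t m.
Proof. by move=> mn; rewrite lef_pV2 ?posrE// ler_nat. Qed.

Let t_cvg : t @ \oo --> 0. Proof. exact: cvg_harmonic. Qed.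

(** The coefficient [(2 * q)^-1] in [F_le] is half of the one of [N] in [J]; the other half survives
    and also bounds [N] along minimizing sequences. *)
Let J_ge v : P v -> (2 * q)^-1 * N v - K <= J v.
Proof.
move=> Pv; have := F_le Pv; rewrite -/(N v) /J invfM => H.
have : 0 <= q^-1 * N v by rewrite mulr_ge0// invr_ge0 ltW.
by move: H; rewrite -mulrA; set a := q^-1 * N v; lra.
Qed.

Let has_inf_J : has_inf (J @` P).
Proof.
split; first by exists (J 0), 0.
exists (- K) => _ [v Pv <-]; apply: le_trans (J_ge Pv).
by rewrite lerDr mulr_ge0// invr_ge0 mulr_ge0// ltW.
Qed.

Let I_le v : P v -> I <= J v.
Proof. by move=> Pv; apply: ge_inf; [case: has_inf_J|exists v]. Qed.

(** The excess is [t n ^+ 2] rather than [t n]: a variation of size [t n] is later divided by [t n],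
    and what remains must still tend to 0. *)
Lemma minimizing_sequence : exists v : nat -> W, forall n, P (v n) /\ J (v n) < I + t n ^+ 2.
Proof.
have H n : {v | P v /\ J v < I + t n ^+ 2}.
  apply: cid; have [|_ [v Pv <-] Jv] := @inf_adherent _ _ (t n ^+ 2) _ has_inf_J.
    by rewrite exprn_gt0.
  by exists v.
by exists (fun n => sval (H n)) => n; exact: (svalP (H n)).
Qed.

(** The midpoint of [v] and [w] competes for the infimum [I], and [F], being linear, cancels in the
    midpoint defect of [J]. *)
Lemma pgap_minimizing_le m n v w : P v -> P w -> (n <= m)%N ->
  J v < I + t m ^+ 2 -> J w < I + t n ^+ 2 ->
  \int[mu]_x pgap q (hat v x) (hat w x) <= q * t n.
Proof.
move=> Pv Pw nm Jv Jw.
have [_ iv] := hatL Pv; have [_ iw] := hatL Pw.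
pose h := 2^-1 *: (v + w).
have Ph : P h by apply: PZ; apply: PD.
have [_ ih] := hatL Ph.
have hE x : hat h x = (hat v x + hat w x) / 2.
  by rewrite hatZ; [rewrite hatD// mulrC|exact: PD].
have -> : \int[mu]_x pgap q (hat v x) (hat w x) = 2^-1 * (N v + N w) - N h.
  rewrite /N -(RintD iv iw) -(RintZ _ (rintD iv iw)).
  rewrite -(RintB (rintZ _ (rintD iv iw)) ih).
  by apply: eq_Rintegral => x _; rewrite /pgap hE mulrC.
have Fh : F h = 2^-1 * (F v + F w) by rewrite FZ; [rewrite FD|exact: PD].
have := I_le Ph; rewrite /J Fh => Jh.
rewrite -ler_pdivrMl// mulrBr mulrCA mulrDr.
have tt k : t k ^+ 2 <= t k by rewrite expr2 ler_piMl// ltW.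
have := tt m; have := tt n; have := le_t nm.
move: Jv Jw Jh; rewrite /J.
move: (N v) (N w) (N h) (F v) (F w) (t m) (t n) I q^-1 => a b c e f g k i r.
by lra.
Qed.

(* The bound on [F] is the Young form [F <= K + |.|_q^q / (2 q)] of continuity, so that [J] is
   bounded below; a minimizing sequence is Cauchy in [L^q] by uniform convexity, and the
   Euler-Lagrange equation of its limit [g] is the representation. *)
Lemma Lpow_riesz : exists g, Lpow q g /\
  forall v, P v -> F v = \int[mu]_x (dmap q (g x) * hat v x).
Proof.
have [v vP] := minimizing_sequence.
pose B := 2 * q * (I + 1 + K).
have NB n : N (v n) <= B.
  have [Pv Jv] := vP n; have := J_ge Pv.
  have : t n ^+ 2 <= 1 by rewrite exprn_ile1// ltW.
  rewrite /B -ler_pdivrMl ?mulr_gt0//.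
  by move: Jv; move: (_ * N _) (J _) (t n ^+ 2) I => a b c i; lra.
have B0 : 0 <= B by exact: le_trans (NB 0%N).
clearbody B.
have cauchy e : 0 < e -> exists n0, forall m n, (n0 <= m)%N -> (n0 <= n)%N ->
     \int[mu]_x pabs q (hat (v m) x - hat (v n) x) <= e.
  move=> e0.
  (* [eta] and [de] are sized so that the two terms of the convexity inequality cost at most [e / 2]
     each; [B + 1] and [C * q + 1] keep the denominators positive. *)
  pose eta := e / (4 * (B + 1)).
  have B1 : 0 < 4 * (B + 1) by lra.
  have eta0 : 0 < eta by rewrite divr_gt0.
  have [C C0 HC] := pabs_uniform_convexity q1 eta0.
  pose de := e / (2 * (C * q + 1)).
  have Cq0 : 0 < 2 * (C * q + 1) by rewrite mulr_gt0// ltr_wpDl// mulr_ge0// ltW.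
  have de0 : 0 < de by rewrite divr_gt0.
  have Ede : (C * q + 1) * de = e / 2.
    by rewrite /de; field; rewrite gt_eqF// ltr_wpDl// mulr_ge0// ltW.
  have /cvgrPdist_lt/(_ _ de0)[n0 _ Hn0] := t_cvg.
  have tn0 : t n0 < de.
    by have := Hn0 n0 (leqnn _); rewrite /= sub0r normrN gtr0_norm.
  have H m n : (n0 <= n)%N -> (n <= m)%N ->
      \int[mu]_x pabs q (hat (v m) x - hat (v n) x) <= e.
    move=> n0n nm; have [Pm Jm] := vP m; have [Pn Jn] := vP n.
    have [_ im] := hatL Pm; have [_ in_] := hatL Pn.
    have idiff : rint (fun x => pabs q (hat (v m) x - hat (v n) x)).
      by have [] := LpowB (ltW q0) (hatL Pm) (hatL Pn).
    have igap : rint (fun x => pgap q (hat (v m) x) (hat (v n) x)).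
      have Pmid : P (2^-1 *: (v m + v n)) by apply: PZ; exact: PD.
      have [_ imid] := hatL Pmid.
      have := rintB (rintZ 2^-1 (rintD im in_)) imid.
      apply: eq_integrable => // x _ /=.
      by rewrite /pgap hatZ; [rewrite hatD// ![2^-1 * _]mulrC|exact: PD].
    apply: (@le_trans _ _ (\int[mu]_x (eta * (pabs q (hat (v m) x) + pabs q (hat (v n) x))
      + C * pgap q (hat (v m) x) (hat (v n) x)))).
      apply: le_Rint => //.
        by apply: rintD; apply: rintZ => //; exact: rintD.
    rewrite RintD; [|by apply: rintZ; exact: rintD|exact: rintZ].
    rewrite (RintZ _ (rintD im in_)) (RintD im in_) (RintZ _ igap) -/(N (v m)) -/(N (v n)).
    have gle := pgap_minimizing_le Pm Pn nm Jm Jn.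
    have l1 : eta * (N (v m) + N (v n)) <= e / 2.
      rewrite (@le_trans _ _ (eta * (2 * (B + 1))))//.
        rewrite ler_pM2l//; move: (NB m) (NB n).
        by move: (N (v m)) (N (v n)) => a b; lra.
      have -> : eta * (2 * (B + 1)) = e / 2.
        by rewrite /eta; field; rewrite gt_eqF// ltr_wpDl.
      by [].
    have l2 : C * \int[mu]_x pgap q (hat (v m) x) (hat (v n) x) <= e / 2.
      rewrite (@le_trans _ _ (C * (q * de)))//.
        rewrite ler_wpM2l// (le_trans gle)// ler_pM2l// (le_trans (le_t n0n))//.
        exact: ltW.
      by rewrite mulrA -Ede ler_wpM2r ?(ltW de0)// lerDl.
    rewrite (le_trans (lerD l1 l2))// -splitr//.
  exists n0 => m n n0m n0n; have [mn|/ltnW nm] := leqP n m; first exact: H.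
  rewrite (_ : (fun _ => _) = fun x => pabs q (hat (v n) x - hat (v m) x)); first exact: H.
  by apply/funext => x; rewrite -pabsN opprB.
have [phi [phi_lt [G [g [LG mg fG fg]]]]] :=
  Lpow_cauchy_subsequence q0 (fun n => hatL (proj1 (vP n))) cauchy.
have Lg : Lpow q g.
  split=> //; have [mG iG] := LG.
  have [|||||//] := @Rint_dominated (fun n x => pabs q (hat (v (phi n)) x))
      (fun x => pabs q (g x)) (fun x => pabs q (G x)).
  - move=> n; apply: measurable_pabs_comp.
    by have [] := hatL (proj1 (vP (phi n))).
  - exact: measurable_pabs_comp.
  - apply: filterS fg => x; apply: continuous_cvg; exact: continuous_pabs.
  - by [].
  - apply: filterS fG => x fGx n; rewrite ger0_norm ?pabs_ge0//.
    by rewrite le_pabs ?(ltW q0)// (le_trans (fGx n))// ler_norm.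
exists g; split => //.
have Lk (f : W) : P f -> forall k, Lpow q k -> rint (fun x => dmap q (k x) * hat f x).
  move=> Pf k Lk; apply: (@rint_pair (q / (q - 1)) q) => //.
  - by rewrite divr_gt0// subr_gt0.
  - by field; rewrite !lt0r_neq0// subr_gt0.
  - by apply: Lpow_dmap => //; rewrite divfK// subr_eq0 gt_eqF.
  - exact: hatL.
(* Instead of differentiating [J], the tangent inequality is taken at the varied point [h n], which
   gives [F f <= s n + a n]. Only one inequality passes to the limit; the other one is this one for
   [- f]. *)
have F_le_g (f : W) : P f -> F f <= \int[mu]_x (dmap q (g x) * hat f x).
  move=> Pf; have [mf intf] := hatL Pf; have {}Lk := Lk f Pf.
  pose s n := t (phi n).
  pose h n x := hat (v (phi n)) x + s n * hat f x.
  pose a n := \int[mu]_x (dmap q (h n x) * hat f x).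
  have Lh n : Lpow q (h n).
    by apply: LpowD; [exact: ltW|exact/hatL/(proj1 (vP _))|apply: LpowZ; exact: hatL].
  have Fa n : F f <= s n + a n.
    have [Pv Jv] := vP (phi n); have [_ iv] := hatL Pv.
    have Pw : P (v (phi n) + s n *: f) by apply: PD => //; exact: PZ.
    have hE : hat (v (phi n) + s n *: f) = h n.
      by apply/funext => x; rewrite hatD ?hatZ//; exact: PZ.
    have := I_le Pw; rewrite /J FD// ?FZ//; last exact: PZ.
    move: Jv; rewrite /J /N hE -/(s n).
    have : \int[mu]_x pabs q (h n x) - \int[mu]_x pabs q (hat (v (phi n)) x) <=
        q * (s n * a n).
      have [_ ih] := Lh n.
      have ilk := Lk _ (Lh n).
      rewrite -(RintB ih iv) /a -(RintZ _ ilk) -(RintZ _ (rintZ _ ilk)).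
      apply: le_Rint; [exact: rintB|by apply: rintZ; apply: rintZ|].
      move=> x; apply: (le_trans (pabs_tangent _ _ q1)).
      have -> : h n x - hat (v (phi n)) x = s n * hat f x by rewrite /h addrAC subrr add0r.
      by rewrite [dmap _ _ * _]mulrCA.
    rewrite -ler_pdivrMl// mulrBr.
    move=> H1 H2 H3; rewrite -(ler_pM2l (t0 (phi n))) -/(s n) mulrDr -expr2.
    move: H1 H2 H3; move: (q^-1 * _) (q^-1 * _) (F _) (F _) (s n) I => b c e k r i; lra.
  have s_cvg : s @ \oo --> 0.
    exact: cvg_subseq phi_lt t_cvg.
  have a_cvg : a @ \oo --> \int[mu]_x (dmap q (g x) * hat f x).
    (* Since [s n <= 1], [|h n|] is at most [|G| + |hat f|] almost everywhere. *)
    apply: (proj2 (@Rint_dominated _ _ (fun x => dmap q (`|G x| + `|hat f x|) * `|hat f x|) _ _ _ _ _)).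
    - by move=> n; apply: rint_measurable; exact: Lk.
    - by apply: rint_measurable; exact: Lk.
    - apply: filterS fg => x fgx; apply: cvgMl.
      apply: continuous_cvg; first exact: continuous_dmap.
      rewrite -[g x]addr0; apply: cvgD => //.
      by rewrite -(mul0r (hat f x)); apply: cvgMl.
    - have := integrable_norm (Lk _ (LpowD (ltW q0) (Lpow_norm LG) (Lpow_norm (hatL Pf)))).
      apply: eq_integrable => // x _ /=.
      rewrite normrM ger0_norm// ge0_dmap// ?powR_ge0// addr_ge0//.
    - apply: filterS fG => x fGx n; rewrite normrM ler_wpM2r//.
      rewrite norm_dmap// /pabs ge0_dmap// ?addr_ge0//.
      have q10 : 0 <= q - 1 by rewrite subr_ge0 ltW.
      rewrite (ge0_ler_powR q10) ?nnegrE ?addr_ge0//.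
      rewrite (le_trans (ler_normD _ _))// lerD//.
        by rewrite (le_trans (fGx n))// ler_norm.
      have sn0 : 0 <= s n by rewrite ltW ?t0.
      by rewrite normrM ler_piMl// (ger0_norm sn0) /s t1.
  have sa : (fun n => s n + a n) @ \oo --> \int[mu]_x (dmap q (g x) * hat f x).
    by rewrite -[X in _ --> X]add0r; apply: cvgD.
  rewrite -(cvg_lim _ sa)//; apply: limr_ge; first by apply/cvg_ex; eexists; exact: sa.
  exact: nearW.
move=> f Pf; apply/eqP; rewrite eq_le F_le_g//=.
have := F_le_g _ (PZ (-1) Pf); rewrite FZ// mulN1r lerNl; apply: le_trans.
have ig := Lk f Pf _ Lg.
under [X in - X]eq_Rintegral do rewrite hatZ// mulrCA.
by rewrite RintZ// mulN1r opprK.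
Qed.

End Riesz.

End RealLp.

(** * Compactness for real-valued sequences *)

Lemma bounded_ultralimit (R : realType) (U : set_system nat) (a : nat -> R) (M : R) :
  UltraFilter U -> (forall n, `|a n| <= M) -> exists l : R, a @ U --> l.
Proof.
move=> UU aM; have PF : ProperFilter (a @ U) by exact: fmap_proper_filter.
have /(_ _ PF)[|l [_ clu]] := @segment_compact R (- M) M.
  by rewrite /= /fmap /=; apply: filterE => n /=; rewrite in_itv/= -ler_norml.
exists l => V lV; have [//|UnV] := in_ultra_setVsetC (a @^-1` V) UU.
by have [y []] := clu (~` V) V UnV lV.
Qed.

(** The indices at which the first [m + 1] sequences are within [1 / (m + 1)] of their limits form a
    set of [U], which meets every tail because [U] contains the tails. Increasing choices in these
    sets give the diagonal extraction. *)
Lemma ultralimit_subseq (R : realType) (U : set_system nat) (a : nat -> nat -> R) (l : nat -> R) :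
  ProperFilter U -> \oo `<=` U -> (forall k, a k @ U --> l k) ->
  exists phi : nat -> nat, {homo phi : m n / (m < n)%N} /\
    forall k, (fun n => a k (phi n)) @ \oo --> l k.
Proof.
move=> PU ooU al.
pose Q m n := forall k, (k <= m)%N -> `|l k - a k n| < m.+1%:R^-1.
have UQ m : U (Q m).
  have H j : U [set n | forall k, (k < j)%N -> `|l k - a k n| < m.+1%:R^-1].
    elim: j => [|j IH]; first exact: filterE.
    have /cvgrPdist_lt/(_ m.+1%:R^-1) := al j; rewrite invr_gt0 => /(_ (ltr0Sn _ _)) aj.
    apply: filterS (filterI IH aj) => n [H1 H2] k; rewrite ltnS leq_eqVlt.
    by case/predU1P => [->|/H1].
  by apply: filterS (H m.+1) => n + k km; apply; rewrite ltnS.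
have H m N : exists n, (N < n)%N /\ Q m n.
  have UN : U [set n | (N < n)%N] by apply: ooU; exists N.+1.
  by have [n [Nn Qn]] := filter_ex (filterI UN (UQ m)); exists n.
pose nx m N := projT1 (cid (H m N)).
have nxP m N : (N < nx m N)%N /\ Q m (nx m N) by rewrite /nx; case: cid.
pose phi := fix F m := if m is j.+1 then nx j.+1 (F j) else nx 0%N 0%N.
have Qphi m : Q m (phi m) by case: m => [|m]; exact: (proj2 (nxP _ _)).
exists phi; split; first by apply: homo_ltn => [|k]; [exact: ltn_trans|exact: (proj1 (nxP _ _))].
move=> k; apply/cvgrPdist_lt => e e0.
have /cvgrPdist_lt/(_ _ e0)[N _ HN] := @cvg_harmonic R.
exists (maxn k N) => // n /=; rewrite geq_max => /andP[kn Nn].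
apply: lt_trans (Qphi n k kn) _.
by have := HN n Nn; rewrite /harmonic /= sub0r normrN gtr0_norm// invr_gt0.
Qed.

Lemma cvg_sumR (R : realType) (I : Type) (r : seq I) (f : I -> nat -> R) (l : I -> R) :
  (forall j, f j @ \oo --> l j) ->
  (fun n => \sum_(j <- r) f j n) @ \oo --> \sum_(j <- r) l j.
Proof.
move=> fl; elim: r => [|j r IH].
  by under eq_fun do rewrite big_nil; rewrite big_nil; exact: cvg_cst.
by under eq_fun do rewrite big_cons; rewrite big_cons; apply: cvgD.
Qed.

(** * Functions given piecewise on a finite partition *)

Section Glue.
Context {d : measure_display} {T : measurableType d} {R : realType}.
Variable mu : {measure set T -> \bar R}.
Context {I : finType}.
Variables (i : T -> I) (g : I -> T -> R).
Hypothesis mi : forall j, measurable (i @^-1` [set j]).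

Let glueE : (fun t => g (i t) t) = (fun t => \sum_(j : I) \1_(i @^-1` [set j]) t * g j t).
Proof.
apply/funext => t; rewrite (bigD1 (i t))//= indicE mem_set// mul1r big1 ?addr0// => j ji.
by rewrite indicE memNset ?mul0r//= => /esym/eqP; apply/negP.
Qed.

Lemma measurable_glue : (forall j, measurable_fun setT (g j)) ->
  measurable_fun setT (fun t => g (i t) t).
Proof.
move=> mg; rewrite glueE; apply: measurable_sum => j.
by apply: measurable_funM => //; exact: measurable_indic.
Qed.

Lemma rint_glue : (forall j, rint mu (fun t => \1_(i @^-1` [set j]) t * g j t)) ->
  rint mu (fun t => g (i t) t) /\
  \int[mu]_t g (i t) t = \sum_(j : I) \int[mu]_t (\1_(i @^-1` [set j]) t * g j t).
Proof.
move=> ig; rewrite glueE.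
elim: (index_enum I) => [|j s [IHr IHe]].
  under eq_fun do rewrite big_nil; rewrite big_nil; split; first exact: integrable0.
  by rewrite /Rintegral integral0.
rewrite big_cons; under eq_fun do rewrite big_cons.
by split; [exact: rintD|rewrite RintD// IHe].
Qed.

End Glue.

(** * Integrals over the product with a probability space *)

Section IndicIntegral.
Context {d1 d2 : measure_display} {X : measurableType d1} {S : measurableType d2} {R : realType}.
Variables (lam : {sigma_finite_measure set X -> \bar R}) (beta : {sigma_finite_measure set S -> \bar R}).
Hypothesis beta1 : beta setT = 1%E.
Notation mu := (lam \x beta)%E.

Lemma bounded_rint (d : measure_display) (T : measurableType d) (nu : {measure set T -> \bar R})
  (k : T -> R) (M : R) : (nu setT < +oo)%E -> measurable_fun setT k -> (forall t, `|k t| <= M) ->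
  rint nu k.
Proof.
move=> nu1 mk kM; apply: (@le_rint _ _ _ _ _ (cst M)) => //.
apply: measurable_bounded_integrable => //.
by exists `|M|; split=> // x Mx t _ /=; rewrite ltW.
Qed.

Lemma rint_indic (d : measure_display) (T : measurableType d) (nu : {measure set T -> \bar R})
  (B : set T) : measurable B -> (nu B < +oo)%E -> rint nu (\1_B).
Proof.
move=> mB nuB; apply/integrableP; split; first exact/measurable_EFinP/measurable_indic.
rewrite (eq_integral (fun x => (\1_B x)%:E)); first by rewrite integral_indic// setIT.
by move=> t _; rewrite gee0_abs// lee_fin.
Qed.

Lemma rint_indicM (d : measure_display) (T : measurableType d) (nu : {measure set T -> \bar R})
  (B : set T) (k : T -> R) (M : R) : measurable B -> (nu B < +oo)%E ->
  measurable_fun setT k -> (forall t, `|k t| <= M) -> rint nu (fun t => \1_B t * k t).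
Proof.
move=> mB nuB mk kM; apply: (@le_rint _ _ _ _ _ (fun t => M * \1_B t)).
- by apply: measurable_funM => //; exact: measurable_indic.
- by move=> t; rewrite normrM mulrC [`|\1_B t|]ger0_norm// ler_wpM2r.
- by apply: rintZ; exact: rint_indic.
Qed.

Lemma prob_rint (k : S -> R) (M : R) : measurable_fun setT k -> (forall t, `|k t| <= M) ->
  rint beta k.
Proof. by move=> mk kM; apply: (bounded_rint _ mk kM); rewrite [ltLHS]beta1 ltry. Qed.

(** Fibers are integrable only almost everywhere, so [fine] and the outer integral are exchanged off
    a null set. *)
Lemma Rint_prod (f : X * S -> R) : rint mu f ->
  \int[mu]_z f z = \int[lam]_x \int[beta]_s f (x, s).
Proof.
move=> rf; rewrite /Rintegral -(integral12_prod_meas1 rf); congr fine.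
apply: ae_eq_integral => //.
- exact: measurable_int (integrable_fubini_F rf).
- apply/measurable_EFinP/measurableT_comp => //.
  exact: measurable_int (integrable_fubini_F rf).
- apply: filterS (ae_integrable1 rf) => x ix _; rewrite /fubini_F fineK//.
  exact: integrable_fin_num.
Qed.

Lemma Rint_indic_prod (B : set X) (k : S -> R) (M : R) : measurable B -> (lam B < +oo)%E ->
  measurable_fun setT k -> (forall t, `|k t| <= M) ->
  rint mu (fun z => \1_B z.1 * k z.2) /\
  \int[mu]_z (\1_B z.1 * k z.2) = fine (lam B) * \int[beta]_s k s.
Proof.
move=> mB lamB mk kM.
have E : (fun z : X * S => \1_B z.1 * k z.2) = (fun z => \1_(B `*` setT) z * k z.2).
  apply/funext => z; congr (_ * _); rewrite !indicE; congr (_%:R)%R.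
  by congr nat_of_bool; apply/idP/idP; rewrite !inE //=; case.
have r : rint mu (fun z => \1_B z.1 * k z.2).
  rewrite E; apply: (@rint_indicM _ _ _ _ _ M) => //.
  - exact: measurableX.
  - rewrite [ltLHS](product_measure1E lam beta mB measurableT).
    by rewrite [X in (_ * X)%E]beta1 mule1.
  - exact: measurableT_comp.
split=> //; rewrite Rint_prod//=.
have rk := prob_rint mk kM.
under eq_Rintegral do rewrite RintZ//.
rewrite RintegralZr//; last exact: rint_indic.
by rewrite /Rintegral integral_indic// setIT.
Qed.

(** This carries an error bound depending on [x] alone over to the product. *)
Lemma rint_fst (f : X -> R) : rint lam f ->
  rint mu (fun z => f z.1) /\ \int[mu]_z f z.1 = \int[lam]_x f x.
Proof.
move=> rf; have mf := rint_measurable rf.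
have mf1 : measurable_fun setT (fun z : X * S => f z.1) by exact: measurableT_comp.
have r1 : rint mu (fun z => f z.1).
  apply/integrable12ltyP; first exact/measurable_EFinP.
  case/integrableP : rf => _; apply: le_lt_trans; rewrite le_eqVlt; apply/orP; left; apply/eqP.
  apply: eq_integral => x _.
  rewrite (_ : (fun y => _) = cst (`|(EFin \o f) x|)%E)// integral_cst//.
  by rewrite [X in (_ * X)%E]beta1 mule1.
split=> //; rewrite Rint_prod//; apply: eq_Rintegral => x _.
by rewrite [LHS](Rintegral_cst beta measurableT (f x)) [X in fine X]beta1 mulr1.
Qed.

End IndicIntegral.

(** Continuity of the pairing, uniform in [f]: the scale [t] brings the first Young term down to
    [e / 2], and [delta] is whatever then does the same for the second. *)
Lemma young_small (d : measure_display) (T : measurableType d) (R : realType)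
    (nu : {measure set T -> \bar R}) (p q c e : R) :
  0 < p -> 0 < q -> p^-1 + q^-1 = 1 -> 0 <= c -> 0 < e ->
  exists2 delta : R, 0 < delta & forall f g, Lpow nu p f -> \int[nu]_x pabs p (f x) <= c ->
    Lpow nu q g -> \int[nu]_x pabs q (g x) <= delta -> `|\int[nu]_x (f x * g x)| <= e.
Proof.
move=> p0 q0 pq c0 e0.
have c1 : 0 < 2 * (c + 1) by rewrite mulr_gt0// ltr_wpDl.
pose a := e * p / (2 * (c + 1)).
have a0 : 0 < a by rewrite divr_gt0// mulr_gt0.
pose t := a `^ p^-1.
have t0 : 0 < t by rewrite powR_gt0.
have tp : t `^ p = a by rewrite -powRrM mulVf ?gt_eqF// powRr1// ltW.
exists (e / 2 * q * t `^ q); first by rewrite !mulr_gt0 ?powR_gt0.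
move=> f g Lf fc Lg gd.
apply: (le_trans (young_Rint p0 q0 pq t0 Lf Lg)); rewrite [leRHS]splitr lerD//.
  rewrite tp (@le_trans _ _ (a / p * (c + 1)))//.
    by rewrite ler_wpM2l//; [rewrite divr_ge0// ltW|rewrite (le_trans fc)// lerDl].
  have -> : a / p * (c + 1) = e / 2.
    by rewrite /a; field; rewrite !gt_eqF// ltr_wpDl.
  by [].
rewrite (@le_trans _ _ (t `^ (- q) / q * (e / 2 * q * t `^ q)))//.
  by rewrite ler_wpM2l// divr_ge0 ?powR_ge0// ltW.
have tq : t `^ q != 0 by rewrite gt_eqF// powR_gt0.
have -> : t `^ (- q) / q * (e / 2 * q * t `^ q) = e / 2.
  by rewrite powRN; field; rewrite tq gt_eqF.
by [].
Qed.

(** * Extraction of a subsequence for an abstract algebra with mean values *)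

Section Core.
Context {d1 d2 : measure_display} {X : measurableType d1} {S : measurableType d2} {R : realType}.
Variables (lam : {sigma_finite_measure set X -> \bar R}) (beta : {sigma_finite_measure set S -> \bar R}).
Hypothesis beta1 : beta setT = 1%E.
Variables (p q : R).
Hypotheses (p0 : 0 < p) (q1 : 1 < q) (pq : p^-1 + q^-1 = 1).
(** [AR] stands for the real elements of the algebra and [hat] for their transforms. Products of
    elements, through Weierstrass approximation, enter only by way of [h_mean]. *)
Variables (AR : set (X -> R)) (hat : (X -> R) -> S -> R).
Hypotheses (AR0 : AR (fun=> 0)) (ARD : forall v w, AR v -> AR w -> AR (fun x => v x + w x))
  (ARZ : forall c v, AR v -> AR (fun x => c * v x))
  (AR_measurable : forall v, AR v -> measurable_fun setT v)
  (AR_bounded : forall v, AR v -> exists M : R, forall x, `|v x| <= M).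
Hypotheses
  (hatD : forall v w s, AR v -> AR w -> hat (fun x => v x + w x) s = hat v s + hat w s)
  (hatZ : forall c v s, AR v -> hat (fun x => c * v x) s = c * hat v s)
  (hat_measurable : forall v, AR v -> measurable_fun setT (hat v))
  (hat_le : forall v (M : R) s, AR v -> (forall x, `|v x| <= M) -> `|hat v s| <= M).
Variable h : nat -> X -> X.
Hypotheses (h_measurable : forall n, measurable_fun setT (h n))
  (h_mean : forall v B, AR v -> measurable B -> (lam B < +oo)%E ->
    (fun n => \int[lam]_x (\1_B x * pabs q (v (h n x)))) @ \oo -->
    fine (lam B) * \int[beta]_s pabs q (hat v s)).

Notation mu := (lam \x beta)%E.

(* Fibers of infinite measure are allowed where the value vanishes. *)
Definition simple_map (psi : X -> X -> R) :=
  exists (I : finType) (i : X -> I) (v : I -> X -> R),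
  [/\ forall j, AR (v j), forall j, measurable (i @^-1` [set j]),
      forall j, (lam (i @^-1` [set j]) < +oo)%E \/ v j = (fun=> 0) &
      psi = fun x => v (i x)].

Definition hatx (psi : X -> X -> R) (z : X * S) := hat (psi z.1) z.2.

Let q0 : 0 < q. Proof. by rewrite (lt_trans _ q1). Qed.

Lemma simple_map0 : simple_map (fun _ _ => 0).
Proof.
exists unit, (fun=> tt), (fun=> fun=> 0); split => //; last by right.
move=> -[]; rewrite (_ : _ @^-1` _ = setT)//.
by apply/seteqP; split.
Qed.

Lemma simple_mapD psi psi' : simple_map psi -> simple_map psi' ->
  simple_map (fun x y => psi x y + psi' x y).
Proof.
move=> [I [i [v [Av mi fi ->]]]] [I' [i' [v' [Av' mi' fi' ->]]]].
pose k x := (i x, i' x).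
have kE j : k @^-1` [set j] = i @^-1` [set j.1] `&` i' @^-1` [set j.2].
  by apply/seteqP; split=> x /=; case: j => a b; rewrite /k /=; [case=> -> ->|case=> -> ->].
exists (I * I')%type, k, (fun j y => v j.1 y + v' j.2 y); split => //.
- by move=> j; exact: ARD.
- by move=> j; rewrite kE; exact: measurableI.
- move=> j; have [fj|vj] := fi j.1.
    left; rewrite kE; apply: le_lt_trans fj.
    by apply: le_measure; rewrite ?inE//; exact: measurableI.
  have [fj|vj'] := fi' j.2.
    left; rewrite kE; apply: le_lt_trans fj.
    by apply: le_measure; rewrite ?inE//; exact: measurableI.
  by right; apply/funext => y; rewrite vj vj' addr0.
Qed.

Lemma simple_mapZ c psi : simple_map psi -> simple_map (fun x y => c * psi x y).
Proof.
move=> [I [i [v [Av mi fi ->]]]]; exists I, i, (fun j y => c * v j y); split => //.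
  by move=> j; exact: ARZ.
move=> j; have [fj|vj] := fi j; first by left.
by right; apply/funext => y; rewrite vj mulr0.
Qed.

Lemma simple_map_AR psi x : simple_map psi -> AR (psi x).
Proof. by move=> [I [i [v [Av mi fi ->]]]]; exact: Av. Qed.

(** On each fiber the map is one fixed element of [AR], to which [h_mean] applies; fibers of
    infinite measure contribute 0. *)
Lemma simple_map_integrals psi : simple_map psi ->
  [/\ Lpow mu q (hatx psi), forall n, Lpow lam q (fun x => psi x (h n x)) &
  (fun n => \int[lam]_x pabs q (psi x (h n x))) @ \oo -->
  \int[mu]_z pabs q (hatx psi z)].
Proof.
move=> [I [i [v [Av mi fi ->]]]].
pose B j := i @^-1` [set j].
have mi1 j : measurable ((fun z : X * S => i z.1) @^-1` [set j]).
  rewrite (_ : _ @^-1` _ = B j `*` setT); first by apply: measurableX => //; exact: mi.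
  by apply/seteqP; split => z /=; rewrite /B /=; [move=> ->|case].
have iE j : \1_((fun z : X * S => i z.1) @^-1` [set j]) = (fun z => \1_(B j) z.1) :> (_ -> R).
  by apply/funext => z; rewrite !indicE.
have hat0 j s : v j = (fun=> 0) -> hat (v j) s = 0.
  move=> vj; apply/eqP; rewrite -normr_le0; apply: hat_le => //.
  by move=> x; rewrite vj normr0.
have mvh j n : measurable_fun setT (fun x => v j (h n x)).
  by apply: measurableT_comp => //; exact: AR_measurable.
have piece1 j n : rint lam (fun x => \1_(B j) x * pabs q (v j (h n x))).
  have [fj|vj] := fi j.
    have [M vM] := AR_bounded (Av j).
    apply: (@rint_indicM _ _ _ _ _ _ (pabs q M)) => //.
      exact: mi.
      exact: (measurable_pabs_comp _ (mvh j n)).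
    move=> x; rewrite ger0_norm ?pabs_ge0// le_pabs ?(ltW q0)//.
    by rewrite (le_trans (vM _))// ler_norm.
  under eq_fun do rewrite vj pabs0// mulr0.
  exact: integrable0.
have piece2 j : rint mu (fun z => \1_(B j) z.1 * pabs q (hat (v j) z.2)) /\
  (fun n => \int[lam]_x (\1_(B j) x * pabs q (v j (h n x)))) @ \oo -->
  \int[mu]_z (\1_(B j) z.1 * pabs q (hat (v j) z.2)).
  have [fj|vj] := fi j.
    have [M vM] := AR_bounded (Av j).
    have [|//||t|r ->] := @Rint_indic_prod _ _ _ _ _ lam _ beta1 (B j) (fun s => pabs q (hat (v j) s)) (pabs q M).
    - exact: mi.
    - exact: (measurable_pabs_comp _ (hat_measurable (Av j))).
    - rewrite ger0_norm ?pabs_ge0// le_pabs ?(ltW q0)//.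
      by rewrite (le_trans (hat_le _ (Av j) vM))// ler_norm.
    - by split => //; apply: h_mean => //; exact: mi.
  have -> : (fun z : X * S => \1_(B j) z.1 * pabs q (hat (v j) z.2)) = fun=> 0.
    by apply/funext => z; rewrite hat0// pabs0// mulr0.
  split; first exact: integrable0.
  rewrite (_ : (fun n => _) = fun=> \int[mu]_z 0); first exact: cvg_cst.
  apply/funext => n; rewrite /Rintegral integral0.
  by under eq_integral do rewrite vj pabs0// mulr0; rewrite integral0.
have piece2' j : rint mu (fun z => \1_((fun z : X * S => i z.1) @^-1` [set j]) z * pabs q (hat (v j) z.2)).
  by rewrite iE; exact: (proj1 (piece2 j)).
have [r2 e2] := @rint_glue _ _ _ mu _ (fun z => i z.1) (fun j z => pabs q (hat (v j) z.2)) piece2'.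
have gl n := @rint_glue _ _ _ lam _ i (fun j x => pabs q (v j (h n x))) (piece1 ^~ n).
split.
- split=> //; apply: (@measurable_glue _ _ _ _ (fun z => i z.1) (fun j z => hat (v j) z.2) mi1) => j.
  by apply: measurableT_comp => //; exact: hat_measurable.
- move=> n; split; last by have [] := gl n.
  exact: (@measurable_glue _ _ _ _ i (fun j x => v j (h n x)) mi).
- rewrite [X in _ --> X]e2; under eq_fun do rewrite (proj2 (gl _)).
  apply: cvg_sumR => j; rewrite iE; exact: (proj2 (piece2 j)).
Qed.

Lemma convergent_bounded (a : nat -> R) (l : R) : a @ \oo --> l -> exists M, forall n, `|a n| <= M.
Proof.
move=> al; have [M [_ HM]] : bounded_fun a.
  by apply: cvg_seq_bounded; apply/cvg_ex; exists l.
by exists (M + 1) => n; apply: (HM (M + 1)); rewrite ?ltrDl.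
Qed.

Variables (u : nat -> X -> R) (c : R).
Hypotheses (uL : forall n, Lpow lam p (u n))
  (u_le : forall n, \int[lam]_x pabs p (u n x) <= c).

Definition pairing n (psi : X -> X -> R) := \int[lam]_x (u n x * psi x (h n x)).

Lemma pairing_le n psi t : 0 < t -> Lpow lam q (fun x => psi x (h n x)) ->
  `|pairing n psi| <= t `^ p / p * c + t `^ (- q) / q * \int[lam]_x pabs q (psi x (h n x)).
Proof.
move=> t0 lpsi; apply: (le_trans (young_Rint p0 q0 pq t0 (uL n) lpsi)).
by rewrite lerD2r// ler_wpM2l// divr_ge0 ?powR_ge0// ltW.
Qed.

Lemma simple_pairingD n psi psi' : simple_map psi -> simple_map psi' ->
  pairing n (fun x y => psi x y + psi' x y) = pairing n psi + pairing n psi'.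
Proof.
move=> s s'; have [_ /(_ n) l _] := simple_map_integrals s.
have [_ /(_ n) l' _] := simple_map_integrals s'.
rewrite /pairing -RintD; [|exact: (rint_pair p0 q0 pq (uL n))..].
by apply: eq_Rintegral => x _; rewrite mulrDr.
Qed.

Lemma simple_pairingZ n k psi : simple_map psi ->
  pairing n (fun x y => k * psi x y) = k * pairing n psi.
Proof.
move=> s; have [_ /(_ n) l _] := simple_map_integrals s.
rewrite /pairing -RintZ; last exact: (rint_pair p0 q0 pq (uL n)).
by apply: eq_Rintegral => x _; rewrite mulrCA.
Qed.

Lemma simple_ultralimit : exists u0 : X * S -> R, Lpow mu p u0 /\
  exists U : set_system nat, [/\ ProperFilter U, \oo `<=` U &
  forall psi, simple_map psi ->
    (fun n => pairing n psi) @ U --> \int[mu]_z (u0 z * hatx psi z)].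
Proof.
have [U [UU ooU]] := @ultraFilterLemma nat \oo _.
pose F psi := lim ((fun n => pairing n psi) @ U).
have cF psi : simple_map psi -> (fun n => pairing n psi) @ U --> F psi.
  move=> s; have [_ l cN] := simple_map_integrals s.
  have [M NM] := convergent_bounded cN.
  have [] := @bounded_ultralimit _ U (fun n => pairing n psi)
    (1 `^ p / p * c + 1 `^ (- q) / q * M) UU.
    move=> n; apply: (le_trans (pairing_le ltr01 (l n))).
    rewrite lerD2l ler_wpM2l ?divr_ge0 ?powR_ge0 ?(ltW q0)//.
    exact: le_trans (ler_norm _) (NM n).
  by move=> a ca; apply/cvg_ex; exists a.
have FU psi a : (fun n => pairing n psi) @ U --> a -> F psi = a.
  by move=> ca; apply: cvg_lim.
(* This scale turns the Young coefficient [t ^ (- q) / q] into the [(2 * q)^-1] asked for by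
   [Lpow_riesz]. *)
pose t : R := 2 `^ q^-1.
have t0 : 0 < t by rewrite powR_gt0.
have tq : t `^ (- q) = 2^-1 by rewrite -powRrM mulrN mulVf ?gt_eqF// powR_inv1.
have [|||||||||g [Lg Fg]] := @Lpow_riesz _ _ _ mu q (t `^ p / p * c) (X -> X -> R)
  simple_map hatx F q1.
- exact: simple_map0.
- exact: simple_mapD.
- exact: simple_mapZ.
- by move=> psi /simple_map_integrals[].
- by move=> psi psi' z s s'; rewrite /hatx hatD//; exact: simple_map_AR.
- by move=> k psi z s; rewrite /hatx hatZ//; exact: simple_map_AR.
- move=> psi psi' s s'; apply: FU; under eq_fun do rewrite simple_pairingD//.
  exact: cvgD (cF _ s) (cF _ s').
- move=> k psi s; apply: FU; under eq_fun do rewrite simple_pairingZ//.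
  exact: (cvgM (cvg_cst k) (cF _ s)).
- move=> psi s; have [_ l cN] := simple_map_integrals s.
  rewrite invfM -tq.
  have cU : (fun n => t `^ p / p * c + t `^ (- q) / q * \int[lam]_x pabs q (psi x (h n x))) @ U -->
      t `^ p / p * c + t `^ (- q) / q * \int[mu]_z pabs q (hatx psi z).
    apply: cvgD; first exact: cvg_cst.
    by apply: cvgM; [exact: cvg_cst|apply: cvg_trans cN; exact: cvg_app].
  apply: ler_cvg_to (cF _ s) cU _; apply: filterE => n.
  exact: le_trans (ler_norm _) (pairing_le t0 (l n)).
exists (fun z => dmap q (g z)); split.
  apply: Lpow_dmap => //.
  have -> : p = (1 - q^-1)^-1 by rewrite -pq addrK invrK.
  by field; rewrite lt0r_neq0//= subr_eq0 gt_eqF.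
exists U; split => // [|psi s]; first exact: ultra_proper.
by rewrite -Fg//; exact: cF.
Qed.

Definition Lmap (psi : X -> X -> R) :=
  [/\ forall x, AR (psi x), forall n, Lpow lam q (fun x => psi x (h n x)) &
      Lpow mu q (hatx psi)].

Lemma simple_Lmap psi : simple_map psi -> Lmap psi.
Proof.
by move=> s; have [? ? _] := simple_map_integrals s; split => // x; exact: simple_map_AR.
Qed.

Let c0 : 0 <= c.
Proof. by apply: le_trans (u_le 0%N); apply: Rintegral_ge0 => x _; exact: pabs_ge0. Qed.

Variables (D : nat -> X -> R) (V : nat -> set X).
Hypotheses (D_AR : forall k, AR (D k))
  (D_dense : forall v (e : R), AR v -> 0 < e -> exists k, forall y, `|v y - D k y| <= e)
  (V_measurable : forall j, measurable (V j)) (V_fin : forall j, (lam (V j) < +oo)%E)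
  (V_dense : forall B (e : R), measurable B -> (lam B < +oo)%E -> 0 < e ->
     exists j, (lam ((B `\` V j) `|` (V j `\` B)) <= e%:E)%E).

Section Limit.
Variable u0 : X * S -> R.
Hypothesis u0L : Lpow mu p u0.

Definition limit_pairing psi := \int[mu]_z (u0 z * hatx psi z).

(** One [delta] serves all [n] because the [u n] are bounded in [L^p]. The error [G] depends on [x]
    only: it dominates a sup norm in [y], hence by [hat_le] also the transforms on the limit
    side. *)
Lemma pairing_small e : 0 < e -> exists2 delta : R, 0 < delta &
  forall psi chi G, Lmap psi -> Lmap chi -> Lpow lam q G ->
    (forall x y, `|psi x y - chi x y| <= G x) -> \int[lam]_x pabs q (G x) <= delta ->
    (forall n, `|pairing n psi - pairing n chi| <= e) /\
    `|limit_pairing psi - limit_pairing chi| <= e.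
Proof.
move=> e0.
have [d1' d10 H1] := @young_small _ _ _ lam _ _ c e p0 q0 pq c0 e0.
have u0_ge0 : 0 <= \int[mu]_z pabs p (u0 z) by apply: Rintegral_ge0 => z _; exact: pabs_ge0.
have [d2' d20 H2] := @young_small _ _ _ mu _ _ _ e p0 q0 pq u0_ge0 e0.
exists (Num.min d1' d2'); first by rewrite lt_min d10.
move=> psi chi G [Ap lp Lp] [Ac lc Lc] LG pcG; rewrite le_min => /andP[Gd1 Gd2].
have [mG iG] := LG.
have pabsG a x : `|a| <= G x -> pabs q a <= pabs q (G x).
  by move=> aG; rewrite le_pabs ?(ltW q0)// (le_trans aG)// ler_norm.
split.
  move=> n; rewrite /pairing -RintB; [|exact: (rint_pair p0 q0 pq (uL n))..].
  under eq_Rintegral do rewrite -mulrBr.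
  have Ld := LpowB (ltW q0) (lp n) (lc n); have [_ id] := Ld.
  apply: (H1 _ _ (uL n) (u_le n) Ld); apply: le_trans Gd1; apply: (le_Rint id iG) => x.
  exact: pabsG.
rewrite /limit_pairing -RintB; [|exact: (rint_pair p0 q0 pq u0L)..].
under eq_Rintegral do rewrite -mulrBr.
have Ld := LpowB (ltW q0) Lp Lc; have [_ id] := Ld.
have [iG1 eG1] := rint_fst beta1 iG.
apply: (H2 _ _ u0L (lexx _) Ld); apply: le_trans Gd2; rewrite -eG1; apply: (le_Rint id iG1) => z.
apply: pabsG; rewrite /hatx.
have -> : hat (psi z.1) z.2 - hat (chi z.1) z.2 = hat (fun y => psi z.1 y + -1 * chi z.1 y) z.2.
  by rewrite hatD// ?hatZ// ?mulN1r//; exact: ARZ.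
apply: hat_le; first by apply: ARD => //; exact: ARZ.
by move=> y; rewrite mulN1r.
Qed.

Variable phi : nat -> nat.

Definition weakly_converges psi := (fun n => pairing (phi n) psi) @ \oo --> limit_pairing psi.

Lemma weakly_converges_dense psi : Lmap psi ->
  (forall delta, 0 < delta -> exists chi G, [/\ Lmap chi, weakly_converges chi,
     Lpow lam q G, forall x y, `|psi x y - chi x y| <= G x &
     \int[lam]_x pabs q (G x) <= delta]) -> weakly_converges psi.
Proof.
move=> Lpsi H; apply/cvgrPdist_le => e e0.
have e30 : 0 < e / 3 by rewrite divr_gt0.
have [delta delta0 Hd] := pairing_small e30.
have [chi [G [Lchi cchi LG pcG Gd]]] := H _ delta0.
have [Hn Hl] := Hd _ _ _ Lpsi Lchi LG pcG Gd.
have /cvgrPdist_le/(_ _ e30) := cchi; apply: filterS => n Hcn.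
have -> : limit_pairing psi - pairing (phi n) psi =
  (limit_pairing psi - limit_pairing chi) + ((limit_pairing chi - pairing (phi n) chi)
    - (pairing (phi n) psi - pairing (phi n) chi)) by ring.
rewrite (le_trans (ler_normD _ _))// (_ : e = e / 3 + (e / 3 + e / 3)); last by field.
by rewrite lerD// (le_trans (ler_normB _ _))// lerD.
Qed.

Definition elem (B : set X) (v : X -> R) (x y : X) := \1_B x * v y.

Lemma simple_elem B v : measurable B -> (lam B < +oo)%E -> AR v -> simple_map (elem B v).
Proof.
move=> mB lB Av; exists bool, (fun x => x \in B), (fun (b : bool) y => (b : nat)%:R * v y); split => //.
- by move=> b; exact: ARZ.
- case; [rewrite (_ : _ @^-1` _ = B)//|rewrite (_ : _ @^-1` _ = ~` B); first exact: measurableC].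
    by apply/seteqP; split => x /=; [exact: set_mem|exact: mem_set].
  apply/seteqP; split => x /=; first by move=> xB Bx; move: xB; rewrite mem_set.
  by move=> xB; rewrite memNset.
- case; [left|by right; apply/funext => y; rewrite mul0r].
  rewrite (_ : _ @^-1` _ = B)//.
  by apply/seteqP; split => x /=; [exact: set_mem|exact: mem_set].
Qed.

Lemma pabs_indic (B : set X) (k : R) x : pabs q (k * \1_B x) = pabs q k * \1_B x.
Proof.
rewrite pabsM; congr (_ * _); rewrite indicE.
by case: (x \in B); [rewrite /pabs normr1 powR1|rewrite pabs0].
Qed.

Lemma weakly_converges_elem : (forall j k, weakly_converges (elem (V j) (D k))) ->
  forall B v, measurable B -> (lam B < +oo)%E -> AR v -> weakly_converges (elem B v).
Proof.
move=> wVD B v mB lB Av; apply: weakly_converges_dense; first exact/simple_Lmap/simple_elem.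
move=> delta delta0; have [M vM] := AR_bounded Av.
pose b := fine (lam B).
have b0 : 0 <= b by exact: fine_ge0.
(* The integral of [|G| ^ q] is at most [2 ^ q] times [|eta| ^ q * lam B + |M'| ^ q * lam E]; [a]
   and [e] give each summand the share [delta / 2]. The cap [eta <= 1] ensures [|D k| <= M']. *)
pose a := delta / 2 / (2 `^ q * (b + 1)).
have a0 : 0 < a by rewrite !divr_gt0// mulr_gt0 ?powR_gt0// ltr_wpDl.
pose eta := Num.min 1 (a `^ q^-1).
have eta0 : 0 < eta by rewrite lt_min ltr01 powR_gt0.
have eta_a : pabs q eta <= a.
  rewrite /pabs gtr0_norm// (@le_trans _ _ ((a `^ q^-1) `^ q))//.
    by rewrite ge0_ler_powR ?nnegrE ?powR_ge0 ?ge_min ?lexx ?orbT// ltW.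
  by rewrite -powRrM mulVf ?lt0r_neq0// powRr1// ltW.
pose M' : R := `|M| + 1.
have M'0 : 0 < M' by rewrite ltr_wpDl.
pose e := delta / 2 / (2 `^ q * pabs q M').
have pM'0 : 0 < pabs q M' by rewrite lt_neqAle pabs_ge0 eq_sym pabs_eq0// gt_eqF.
have e0 : 0 < e by rewrite !divr_gt0// mulr_gt0// powR_gt0.
have [k vk] := D_dense Av eta0.
have [j Vj] := V_dense mB lB e0.
pose E := (B `\` V j) `|` (V j `\` B).
have mE : measurable E by apply: measurableU; exact: measurableD.
have lE : (lam E < +oo)%E by apply: le_lt_trans Vj _; rewrite ltry.
pose G x := eta * \1_B x + M' * \1_E x.
have iB : rint lam \1_B by exact: rint_indic.
have iE : rint lam \1_E by exact: rint_indic.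
have Lind (F : set X) (m : R) : measurable F -> rint lam (\1_F) -> Lpow lam q (fun x => m * \1_F x).
  move=> mF iF; split; first by apply: measurable_funM => //; exact: measurable_indic.
  by under eq_fun do rewrite pabs_indic; exact: rintZ.
have LG : Lpow lam q G by apply: LpowD; [exact: ltW|exact: Lind|exact: Lind].
exists (elem (V j) (D k)), G; split => //.
- by apply/simple_Lmap/simple_elem.
- move=> x y; rewrite /elem /G !indicE.
  have Dk : `|D k y| <= M'.
    rewrite -[D k y](subKr (v y)) (le_trans (ler_normB _ _))// lerD//.
      exact: le_trans (vM y) (ler_norm _).
    by rewrite (le_trans (vk y))// ge_min lexx.
  have [xB|xB] := pselect (B x); have [xV|xV] := pselect (V j x);
    rewrite ?(mem_set xB) ?(memNset xB) ?(mem_set xV) ?(memNset xV) ?mul1r ?mul0r ?mulr1 ?mulr0 ?subr0 ?sub0r ?add0r.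
  + by rewrite (le_trans (vk y))// lerDl mulr_ge0// ltW.
  + rewrite mem_set ?mulr1; last by left.
    rewrite (le_trans (vM y))// (le_trans (ler_norm M))// ler_wpDl ?(ltW eta0)//.
    by rewrite lerDl.
  + rewrite mem_set ?mulr1 ?normrN//; by right.
  + by rewrite normr0 mulr_ge0// ltW.
- have [_ iG] := LG.
  have iS : rint lam (fun x => pabs q eta * \1_B x + pabs q M' * \1_E x).
    by apply: rintD; exact: rintZ.
  apply: (@le_trans _ _ (\int[lam]_x (2 `^ q * (pabs q eta * \1_B x + pabs q M' * \1_E x)))).
    apply: (le_Rint iG (rintZ _ iS)) => x.
    by rewrite -!pabs_indic; apply: pabsD; exact: ltW.
  rewrite (RintZ _ iS) RintD; [|exact: rintZ..].
  rewrite !RintZ//.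
  have -> : \int[lam]_x \1_B x = b by rewrite /Rintegral integral_indic// setIT.
  have IE : \int[lam]_x \1_E x <= e.
    rewrite /Rintegral integral_indic// setIT -lee_fin fineK//.
    by rewrite ge0_fin_numE.
  rewrite [leRHS]splitr mulrDr lerD//.
    rewrite (@le_trans _ _ (2 `^ q * (a * (b + 1))))//.
      rewrite ler_pM2l ?powR_gt0// ler_pM ?pabs_ge0// lerDl//.
    rewrite mulrCA /a divfK// gt_eqF// mulr_gt0 ?powR_gt0// ltr_wpDl//.
  rewrite mulrA -ler_pdivlMl; last by rewrite mulr_gt0// powR_gt0.
  by rewrite mulrC.
Qed.

Lemma weakly_convergesD psi chi : simple_map psi -> simple_map chi ->
  weakly_converges psi -> weakly_converges chi ->
  weakly_converges (fun x y => psi x y + chi x y).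
Proof.
move=> sp sc wp wc; have [Ap _ Lp] := simple_Lmap sp; have [Ac _ Lc] := simple_Lmap sc.
rewrite /weakly_converges.
have -> : limit_pairing (fun x y => psi x y + chi x y) = limit_pairing psi + limit_pairing chi.
  rewrite /limit_pairing -RintD; [|exact: (rint_pair p0 q0 pq u0L)..].
  by apply: eq_Rintegral => z _; rewrite /hatx hatD// mulrDr.
under eq_fun do rewrite simple_pairingD//.
exact: cvgD.
Qed.

Lemma weakly_converges_simple :
  (forall B v, measurable B -> (lam B < +oo)%E -> AR v -> weakly_converges (elem B v)) ->
  forall psi, simple_map psi -> weakly_converges psi.
Proof.
move=> wel psi [I [i [v [Av mi fi ->]]]].
pose B j := i @^-1` [set j].
have w0 : weakly_converges (fun _ _ => 0).
  have -> : (fun _ _ => 0) = elem set0 (fun=> 0) :> (X -> X -> R).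
    by apply/funext => x; apply/funext => y; rewrite /elem mulr0.
  by apply: wel => //; rewrite measure0 ltry.
have sw j : simple_map (elem (B j) (v j)) /\ weakly_converges (elem (B j) (v j)).
  have [fj|vj] := fi j; first by split; [apply: simple_elem|apply: wel] => //; exact: mi.
  have -> : elem (B j) (v j) = fun _ _ => 0.
    by apply/funext => x; apply/funext => y; rewrite /elem vj mulr0.
  by split => //; exact: simple_map0.
have -> : (fun x => v (i x)) = fun x y => \sum_(j : I) elem (B j) (v j) x y.
  apply/funext => x; apply/funext => y; rewrite (bigD1 (i x))//= big1 ?addr0.
    by rewrite /elem indicE mem_set// mul1r.
  move=> j ji; rewrite /elem indicE memNset ?mul0r// => xj.
  by move: ji; rewrite -xj eqxx.
suff : simple_map (fun x y => \sum_(j : I) elem (B j) (v j) x y) /\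
  weakly_converges (fun x y => \sum_(j : I) elem (B j) (v j) x y) by case.
elim: (index_enum I) => [|j s [IHs IHw]].
  by rewrite (_ : (fun _ _ => _) = fun _ _ => 0); [split => //; exact: simple_map0|
    apply/funext => x; apply/funext => y; rewrite big_nil].
rewrite (_ : (fun _ _ => _) = fun x y => elem (B j) (v j) x y + \sum_(j <- s) elem (B j) (v j) x y).
  by have [sj wj] := sw j; split; [exact: simple_mapD|exact: weakly_convergesD].
by apply/funext => x; apply/funext => y; rewrite big_cons.
Qed.

(** The pointwise convergence of [G] passes measurability on to [psi] along [h n] and to [hat psi];
    the convergence of its [q]-th power integrals serves the density argument. *)
Definition simple_approx (psi : X -> X -> R) := exists chi G,
  [/\ forall m, simple_map (chi m), forall m : nat, Lpow lam q (G m),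
      forall m x y, `|psi x y - chi m x y| <= G m x,
      forall x, (fun m => G m x) @ \oo --> 0 &
      (fun m => \int[lam]_x pabs q (G m x)) @ \oo --> 0].

Lemma simple_approx_Lmap psi : (forall x, AR (psi x)) -> simple_approx psi -> Lmap psi.
Proof.
move=> Ap [chi [G [sc LG pcG Gx GI]]].
have close (k : nat -> R) (l : R) x : (forall m, `|l - k m| <= G m x) -> k @ \oo --> l.
  move=> kl; apply/cvgrPdist_le => e e0.
  have /cvgrPdist_le/(_ _ e0) := Gx x; apply: filterS => m; rewrite sub0r normrN => Gm.
  by rewrite (le_trans (kl m))// (le_trans (ler_norm _)).
split => //.
- move=> n; have [_ /(_ n) L0 _] := simple_Lmap (sc 0%N).
  apply: (@le_Lpow _ _ _ _ _ _ (fun x => `|chi 0%N x (h n x)| + G 0%N x)); first exact: ltW.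
  + apply: (@measurable_fun_cvg _ _ _ _ (fun m x => chi m x (h n x))).
      by move=> m; have [_ /(_ n)[]] := simple_Lmap (sc m).
    by move=> x _; apply: close => m; exact: pcG.
  + move=> x; rewrite -[psi x _](subrK (chi 0%N x (h n x))) (le_trans (ler_normD _ _))//.
    by rewrite addrC lerD2l.
  + by apply: LpowD => //; [exact: ltW|exact: Lpow_norm].
- have [_ _ L0] := simple_Lmap (sc 0%N).
  have hc m z : `|hatx psi z - hatx (chi m) z| <= G m z.1.
    have [Ac _ _] := simple_Lmap (sc m).
    rewrite /hatx.
    have -> : hat (psi z.1) z.2 - hat (chi m z.1) z.2 = hat (fun y => psi z.1 y + -1 * chi m z.1 y) z.2.
      by rewrite hatD// ?hatZ// ?mulN1r//; exact: ARZ.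
    apply: hat_le; first by apply: ARD => //; exact: ARZ.
    by move=> y; rewrite mulN1r.
  have [iG _] := rint_fst beta1 (proj2 (LG 0%N)).
  apply: (@le_Lpow _ _ _ _ _ _ (fun z => `|hatx (chi 0%N) z| + G 0%N z.1)); first exact: ltW.
  + apply: (@measurable_fun_cvg _ _ _ _ (fun m z => hatx (chi m) z)).
      by move=> m; have [_ _ []] := simple_Lmap (sc m).
    by move=> z _; apply: (close _ _ z.1) => m; exact: hc.
  + move=> z; rewrite -[hatx psi z](subrK (hatx (chi 0%N) z)) (le_trans (ler_normD _ _))//.
    by rewrite addrC lerD2l.
  + apply: LpowD; [exact: ltW|exact: Lpow_norm|split => //].
    by apply: measurableT_comp => //; case: (LG 0%N).
Qed.

Lemma simple_approx_converges psi : (forall psi, simple_map psi -> weakly_converges psi) ->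
  (forall x, AR (psi x)) -> simple_approx psi -> weakly_converges psi.
Proof.
move=> ws Ap sap; apply: weakly_converges_dense; first exact: simple_approx_Lmap.
have [chi [G [sc LG pcG Gx GI]]] := sap.
move=> delta delta0; have /cvgrPdist_le/(_ _ delta0)[N _ /(_ N (leqnn _)) GN] := GI.
exists (chi N), (G N); split => //; [exact: simple_Lmap|exact: ws|].
by move: GN; rewrite /= sub0r normrN => /(le_trans (ler_norm _)).
Qed.

End Limit.

Theorem real_sigma_compactness : exists phi : nat -> nat, {homo phi : m n / (m < n)%N} /\
  exists u0 : X * S -> R, Lpow mu p u0 /\
  forall psi, (forall x, AR (psi x)) -> simple_approx psi ->
    Lmap psi /\
    (fun n => pairing (phi n) psi) @ \oo --> \int[mu]_z (u0 z * hatx psi z).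
Proof.
have [u0 [u0L [U [PU ooU HU]]]] := simple_ultralimit.
(* A single enumeration of the products of [V j] and [D k]; codes of no pair get the zero map. *)
pose e m := if unpickle m is Some (j, k) then elem (V j) (D k) else fun _ _ => 0.
have se m : simple_map (e m).
  rewrite /e; case: unpickle => [[j k]|]; last exact: simple_map0.
  exact: simple_elem.
have [phi [phi_lt Hphi]] := @ultralimit_subseq _ U (fun m n => pairing n (e m)) _ PU ooU
  (fun m => HU _ (se m)).
exists phi; split => //; exists u0; split => // psi Ap sap.
split; first exact: simple_approx_Lmap.
apply: (simple_approx_converges u0L) => //.
apply: (weakly_converges_simple u0L); apply: (weakly_converges_elem u0L) => j k.
by have := Hphi (pickle (j, k)); rewrite /e pickleK.
Qed.

End Core.

(** * Weierstrass approximation *)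

Section Weierstrass.
Context {R : realType}.
Implicit Types (x t : R) (n k : nat).

Definition bernstein n k x : R := (x ^+ k * (1 - x) ^+ (n - k)) *+ 'C(n, k).

Lemma bernstein_ge0 n k x : 0 <= x <= 1 -> 0 <= bernstein n k x.
Proof.
by move=> /andP[x0 x1]; rewrite mulrn_wge0// mulr_ge0// exprn_ge0// subr_ge0.
Qed.

Lemma bernstein_sum n x : \sum_(k < n.+1) bernstein n k x = 1.
Proof.
rewrite -[RHS](expr1n _ n) -[in RHS](subrK x 1) exprDn.
by apply: eq_bigr => k _; rewrite /bernstein mulrC.
Qed.

(** The absorption identity of binomial coefficients. Each use lowers the degree and yields one more
    factorial moment of the binomial law, which is why the second moment is computed with
    [k * (k - 1)]. *)
Lemma bernstein_recl n k x : k.+1%:R * bernstein n.+1 k.+1 x = n.+1%:R * x * bernstein n k x.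
Proof.
rewrite /bernstein subSS exprS -[in LHS]mulr_natr -[in RHS]mulr_natr.
rewrite [LHS](_ : _ = x * x ^+ k * (1 - x) ^+ (n - k) * (k.+1 * 'C(n.+1, k.+1))%:R); last first.
  by rewrite natrM; ring.
by rewrite -mul_bin_diag natrM; ring.
Qed.

Lemma bernstein_mean n x : \sum_(k < n.+1) k%:R * bernstein n k x = n%:R * x.
Proof.
case: n => [|n]; first by rewrite big_ord_recl big_ord0 !mul0r addr0.
rewrite big_ord_recl mul0r add0r.
under eq_bigr do rewrite lift0 bernstein_recl.
by rewrite -mulr_sumr bernstein_sum mulr1.
Qed.

Lemma bernstein_second n x :
  \sum_(k < n.+1) (k%:R * (k%:R - 1)) * bernstein n k x = n%:R * (n%:R - 1) * x ^+ 2.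
Proof.
case: n => [|n]; first by rewrite big_ord_recl big_ord0 !mul0r addr0.
rewrite big_ord_recl !mul0r add0r.
under eq_bigr => k _.
  have -> : (lift ord0 k)%:R * ((lift ord0 k)%:R - 1) * bernstein n.+1 (lift ord0 k) x =
     (n.+1%:R * x) * (k%:R * bernstein n k x).
    rewrite lift0; transitivity ((k.+1%:R - 1) * (k.+1%:R * bernstein n.+1 k.+1 x)); first by ring.
    by rewrite bernstein_recl; ring.
  over.
by rewrite -mulr_sumr bernstein_mean; ring.
Qed.

Lemma bernstein_variance n x : (0 < n)%N ->
  \sum_(k < n.+1) (k%:R / n%:R - x) ^+ 2 * bernstein n k x = x * (1 - x) / n%:R.
Proof.
move=> n0; have nR : n%:R != 0 :> R by rewrite pnatr_eq0 -lt0n.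
transitivity (\sum_(k < n.+1) (n%:R ^- 2 * ((k%:R * (k%:R - 1)) * bernstein n k x) +
  (n%:R ^- 2 - 2 * x / n%:R) * (k%:R * bernstein n k x) + x ^+ 2 * bernstein n k x)).
  by apply: eq_bigr => k _; field.
rewrite !big_split/= -!mulr_sumr bernstein_sum bernstein_mean bernstein_second.
by field.
Qed.

(** A modulus of the form [e + C * (y - x) ^+ 2] can be averaged directly: the weights sum to 1 and
    the square becomes the variance, at most [1 / n]. This avoids splitting the sum into near and
    far indices. *)
Lemma bernstein_approx (f : R -> R) (e C : R) n x : (0 < n)%N -> 0 <= x <= 1 -> 0 <= C ->
  (forall y, 0 <= y <= 1 -> `|f y - f x| <= e + C * (y - x) ^+ 2) ->
  `|\sum_(k < n.+1) f (k%:R / n%:R) * bernstein n k x - f x| <= e + C / n%:R.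
Proof.
move=> n0 x01 C0 H; have nR : 0 < n%:R :> R by rewrite ltr0n.
have -> : \sum_(k < n.+1) f (k%:R / n%:R) * bernstein n k x - f x =
    \sum_(k < n.+1) (f (k%:R / n%:R) - f x) * bernstein n k x.
  rewrite -[f x in LHS]mulr1 -(bernstein_sum n x) mulr_sumr -sumrB.
  by apply: eq_bigr => k _; rewrite mulrBl.
apply: (le_trans (ler_norm_sum _ _ _)).
apply: (@le_trans _ _ (\sum_(k < n.+1) (e * bernstein n k x +
    C * ((k%:R / n%:R - x) ^+ 2 * bernstein n k x)))).
  apply: ler_sum => k _; rewrite normrM (ger0_norm (bernstein_ge0 _ _ x01)) mulrA -mulrDl.
  rewrite ler_wpM2r ?bernstein_ge0// H// divr_ge0 ?(ltW nR)//= ler_pdivrMr// mul1r ler_nat.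
  by rewrite -ltnS.
rewrite big_split/= -!mulr_sumr bernstein_sum mulr1 lerD2l bernstein_variance//.
rewrite ler_wpM2l// ler_pdivrMr// mulVf ?gt_eqF//.
move: x01 => /andP[x0 x1]; rewrite mulr_ile1// ?subr_ge0// lerBlDr lerDl//.
Qed.

(* [Q] stands for the polynomial functions, of which only the closure properties matter. *)
Lemma weierstrass_lipschitz (f : R -> R) (L M e : R) (Q : set (R -> R)) :
  0 < M -> 0 <= L -> 0 < e ->
  (forall s t, `|s| <= M -> `|t| <= M -> `|f s - f t| <= L * `|s - t|) ->
  (forall c, Q (cst c)) -> Q id ->
  (forall g h, Q g -> Q h -> Q (fun t => g t + h t)) ->
  (forall g h, Q g -> Q h -> Q (fun t => g t * h t)) ->
  exists2 g, Q g & forall t, `|t| <= M -> `|f t - g t| <= e.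
Proof.
move=> M0 L0 e0 fL Qc Qid QD QM.
have QX g n : Q g -> Q (fun t => g t ^+ n).
  move=> Qg; elim: n => [|n IH]; first exact: (Qc 1).
  by under eq_fun do rewrite exprS; exact: QM.
have QS (I : Type) (r : seq I) (g : I -> R -> R) : (forall i, Q (g i)) ->
    Q (fun t => \sum_(i <- r) g i t).
  move=> Qg; elim: r => [|i r IH]; first by under eq_fun do rewrite big_nil; exact: (Qc 0).
  by under eq_fun do rewrite big_cons; exact: QD.
pose sc x := 2 * M * x - M.
pose us t := (t + M) / (2 * M).
have M2 : 0 < 2 * M by rewrite mulr_gt0.
have usK t : sc (us t) = t by rewrite /sc /us; field; rewrite gt_eqF.
have us01 t : `|t| <= M -> 0 <= us t <= 1.
  rewrite ler_norml => /andP[t1 t2].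
  by rewrite divr_ge0 ?(ltW M2)//=; [rewrite ler_pdivrMr//; lra|lra].
have scM x : 0 <= x <= 1 -> `|sc x| <= M.
  by move=> /andP[x0 x1]; rewrite ler_norml /sc; apply/andP; split; nra.
pose K := L * (2 * M).
(* With this [C], [K * r <= e / 2 + C * r ^+ 2] by completing the square, which turns the Lipschitz
   bound into the modulus required by [bernstein_approx]. *)
pose C := K ^+ 2 / e.
have K0 : 0 <= K by rewrite mulr_ge0// ltW.
have C0 : 0 <= C by rewrite divr_ge0 ?sqr_ge0// ltW.
have [n n0 Cn] : exists2 n, (0 < n)%N & C / n%:R <= e / 2.
  exists (Num.trunc (C / (e / 2))).+1 => //.
  rewrite ler_pdivrMr// mulrC -ler_pdivrMr ?divr_gt0//.
  by apply/ltW/truncnS_gt; rewrite divr_ge0// divr_ge0// ltW.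
exists (fun t => \sum_(k < n.+1) f (sc (k%:R / n%:R)) * bernstein n k (us t)).
  apply: QS => k; apply: (QM); first exact: Qc.
  under eq_fun do rewrite /bernstein -mulr_natr.
  apply: (QM); last exact: Qc.
  have Qus : Q us by apply: (QM); [apply: (QD) => //; exact: Qc|exact: Qc].
  apply: (QM); first exact: QX.
  apply: QX; under eq_fun do rewrite -mulN1r.
  by apply: (QD); [exact: Qc|apply: (QM) => //; exact: Qc].
move=> t tM; rewrite distrC -{2}(usK t).
have -> : e = e / 2 + e / 2 by rewrite -splitr.
apply: (le_trans (@bernstein_approx (f \o sc) (e / 2) C n (us t) n0 (us01 _ tM) C0 _)).
  move=> y y01 /=; apply: (le_trans (fL _ _ (scM _ y01) (scM _ (us01 _ tM)))).
  have -> : sc y - sc (us t) = 2 * M * (y - us t) by rewrite /sc; ring.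
  rewrite normrM gtr0_norm// mulrA -/K.
  set d := y - us t; rewrite -(real_normK (num_real d)).
  have := normr_ge0 d; move: `|d| => r r0.
  rewrite /C -(ler_pM2r e0) mulrDl.
  have -> : K ^+ 2 / e * r ^+ 2 * e = (K * r) ^+ 2 by field; rewrite gt_eqF.
  have := sqr_ge0 (K * r - e / 2); have := sqr_ge0 e.
  nra.
by rewrite lerD2l.
Qed.

End Weierstrass.

(** * Characters of the algebra *)

Section ComplexAbs.
Context {R : realType}.
Local Notation C := R[i].
Implicit Types z w : C.

Lemma cabsE z : cabs z = Normc.normc z. Proof. by case: z. Qed.

Lemma cabsM z w : cabs (z * w) = cabs z * cabs w.
Proof. by rewrite !cabsE Normc.normcM. Qed.

Lemma cabsV z : cabs z^-1 = (cabs z)^-1.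
Proof. by rewrite !cabsE Normc.normcV. Qed.

Lemma cabs0_eq0 z : cabs z = 0 -> z = 0.
Proof. by rewrite cabsE; exact: Normc.eq0_normc. Qed.

Lemma cabs_ge0 z : 0 <= cabs z. Proof. exact: sqrtr_ge0. Qed.

Lemma cabsX z n : cabs (z ^+ n) = cabs z ^+ n.
Proof.
elim: n => [|n IH]; last by rewrite !exprS cabsM IH.
by rewrite /cabs /= expr0n addr0 expr1n sqrtr1.
Qed.

Lemma ler_cabsD z w : cabs (z + w) <= cabs z + cabs w.
Proof. by rewrite !cabsE; exact: le_normcD. Qed.

Lemma cabsN z : cabs (- z) = cabs z.
Proof. by rewrite !cabsE normcN. Qed.

Lemma cabs_real (r : R) : cabs (cofR r) = `|r|.
Proof. by rewrite /cabs /= expr0n addr0 sqrtr_sqr. Qed.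

Lemma cabs_sqr z : cabs z ^+ 2 = complex.Re z ^+ 2 + complex.Im z ^+ 2.
Proof. by rewrite sqr_sqrtr// addr_ge0 ?sqr_ge0. Qed.

Lemma normr_Re z : `|complex.Re z| <= cabs z.
Proof. by rewrite -sqrtr_sqr ler_sqrt ?addr_ge0 ?sqr_ge0// lerDl sqr_ge0. Qed.

Lemma normr_Im z : `|complex.Im z| <= cabs z.
Proof. by rewrite -sqrtr_sqr ler_sqrt ?addr_ge0 ?sqr_ge0// lerDr sqr_ge0. Qed.

Lemma cabs_ReIm z : cabs z <= `|complex.Re z| + `|complex.Im z|.
Proof.
rewrite -ler_sqr ?nnegrE ?cabs_ge0 ?addr_ge0// cabs_sqr sqrrD !real_normK ?num_real//.
by rewrite -addrA lerD2l lerDr mulrn_wge0// mulr_ge0.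
Qed.

Lemma cofRD (r s : R) : cofR (r + s) = cofR r + cofR s.
Proof. by apply/eqP; rewrite eq_complex /= addr0 !eqxx. Qed.

Lemma cofRM (r s : R) : cofR (r * s) = cofR r * cofR s.
Proof. by apply/eqP; rewrite eq_complex /= !mulr0 !mul0r subr0 addr0 !eqxx. Qed.

End ComplexAbs.

Section ComplexContinuous.
Context {R : realType} {T : topologicalType}.
Local Notation C := R[i].
Implicit Types f g : T -> C.

Lemma continuousM_real (f g : T -> R) : continuous f -> continuous g -> continuous (fun x => f x * g x).
Proof. by move=> cf cg x; apply: continuousM; [exact: cf|exact: cg]. Qed.

Lemma continuousD_real (f g : T -> R) : continuous f -> continuous g -> continuous (fun x => f x + g x).
Proof. by move=> cf cg x; apply: continuousD; [exact: cf|exact: cg]. Qed.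

Lemma continuousN_real (f : T -> R) : continuous f -> continuous (fun x => - f x).
Proof. by move=> cf x; apply: continuousN; exact: cf. Qed.

Lemma ccontinuousM f g : ccontinuous f -> ccontinuous g -> ccontinuous (fun x => f x * g x).
Proof.
move=> [f1 f2] [g1 g2].
have E x : f x * g x = Complex (complex.Re (f x) * complex.Re (g x) - complex.Im (f x) * complex.Im (g x))
  (complex.Re (f x) * complex.Im (g x) + complex.Im (f x) * complex.Re (g x)).
  by case: (f x) => a b; case: (g x).
split; under eq_fun do rewrite E /=.
  by apply: continuousD_real; [|apply: continuousN_real]; exact: continuousM_real.
by apply: continuousD_real; exact: continuousM_real.
Qed.

Lemma ccontinuousB f g : ccontinuous f -> ccontinuous g -> ccontinuous (fun x => f x - g x).
Proof.
move=> [f1 f2] [g1 g2].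
split; under eq_fun do rewrite raddfB /=.
  by apply: continuousD_real => //; exact: continuousN_real.
by apply: continuousD_real => //; exact: continuousN_real.
Qed.

Lemma ccontinuous_cst (c : C) : ccontinuous (fun _ : T => c).
Proof. by split=> x; exact: cst_continuous. Qed.

Lemma ccontinuousV f : (forall x, f x != 0) -> ccontinuous f -> ccontinuous (fun x => (f x)^-1).
Proof.
move=> f0 [f1 f2].
pose N x := complex.Re (f x) ^+ 2 + complex.Im (f x) ^+ 2.
have cN : continuous N.
  rewrite /N; under eq_fun do rewrite !expr2.
  by apply: continuousD_real; exact: continuousM_real.
have N0 x : N x != 0.
  rewrite /N -cabs_sqr expf_eq0/=; apply: contra (f0 x) => /eqP/cabs0_eq0 ->.
  exact: eqxx.
have cV : continuous (fun x => (N x)^-1).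
  by move=> x; apply: continuousV; [exact: N0|exact: cN].
have E x : (f x)^-1 = Complex (complex.Re (f x) * (N x)^-1) (- (complex.Im (f x) * (N x)^-1)).
  by rewrite /N; case: (f x).
split; under eq_fun do rewrite E /=; first exact: continuousM_real.
by apply: continuousN_real; exact: continuousM_real.
Qed.

End ComplexContinuous.

Section Spectrum.
Context {R : realType} {X : pseudoPMetricType R}.
Local Notation C := R[i].
Implicit Types (u : X -> C) (v : X -> R) (s : (X -> C) -> C).

Lemma supnorm_ub u M : (forall x, cabs (u x) <= M) -> forall x, cabs (u x) <= supnorm u.
Proof.
move=> uM x; apply: sup_ubound; last by exists x.
by exists M => _ [y _ <-].
Qed.

Lemma supnorm_le u M : (forall x, cabs (u x) <= M) -> supnorm u <= M.
Proof.
move=> uM; apply: ge_sup; first by exists (cabs (u point)), point.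
by move=> _ [y _ <-].
Qed.

Definition rc v : X -> C := fun x => cofR (v x).

Variable A : set (X -> C).
Hypotheses (A_bounded_cont : forall u, A u -> bounded_cont u) (A_cst : forall c : C, A (fun=> c))
  (A_D : forall u w, A u -> A w -> A (fun x => u x + w x))
  (A_Z : forall (c : C) u, A u -> A (fun x => c * u x))
  (A_M : forall u w, A u -> A w -> A (fun x => u x * w x))
  (A_conj : forall u, A u -> A (fun x => (u x)^*%C))
  (A_closed : forall u, bounded_cont u ->
    (forall eta : R, 0 < eta -> exists w, A w /\ supnorm (fun x => u x - w x) < eta) -> A u).

(* The inverse of [1 - u] exists in [A] when [u] has norm [< 1] (Neumann series), so
   no character takes the value [1] at [u]. *)
Lemma neumann u r : A u -> r < 1 -> (forall x, cabs (u x) <= r) ->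
  A (fun x => u x / (1 - u x)).
Proof.
move=> Au r1 ur.
have r0 : 0 <= r by exact: le_trans (cabs_ge0 _) (ur point).
have r10 : 0 < 1 - r by rewrite subr_gt0.
have lb x : 1 - r <= cabs (1 - u x).
  rewrite lerBlDr; have := ler_cabsD (1 - u x) (u x); rewrite subrK => H.
  have <- : cabs (1 : C) = 1 by rewrite (cabs_real 1) normr1.
  by rewrite (le_trans H)// lerD2l.
have ne0 x : 1 - u x != 0.
  apply/eqP => e; have := lb x; rewrite e /cabs /= expr0n addr0 sqrtr0 => /le_lt_trans/(_ _).
  by move=> H; have := lt_le_trans r10 (lb x); rewrite e /cabs /= expr0n addr0 sqrtr0 ltxx.
pose P n x := \sum_(k < n) u x ^+ k.+1.
have AX n : A (fun x => u x ^+ n.+1).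
  elim: n => [|n IH]; first by under eq_fun do rewrite expr1.
  by under eq_fun do rewrite exprS; exact: A_M.
have AP n : A (P n).
  elim: n => [|n IH]; first by rewrite /P; under eq_fun do rewrite big_ord0; exact: A_cst.
  by rewrite /P; under eq_fun do rewrite big_ord_recr /=; apply: A_D; [exact: IH|exact: AX].
have PE n x : u x / (1 - u x) - P n x = u x ^+ n.+1 / (1 - u x).
  elim: n => [|n IH]; first by rewrite /P big_ord0 subr0 expr1.
  rewrite /P big_ord_recr /= opprD addrA IH [in RHS]exprS.
  by field; exact: ne0.
apply: A_closed.
  have [[cu1 cu2] _] := A_bounded_cont Au; split.
    apply: ccontinuousM => //; apply: ccontinuousV => //.
    by apply: ccontinuousB => //; exact: ccontinuous_cst.
  exists (r / (1 - r)) => x; rewrite cabsM cabsV ler_pM ?cabs_ge0 ?invr_ge0 ?cabs_ge0//.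
  by rewrite lef_pV2 ?posrE// (lt_le_trans r10).
move=> eta eta0.
have [n Hn] : exists n, r ^+ n.+1 / (1 - r) < eta.
  have /cvgrPdist_lt/(_ (eta * (1 - r))) : (fun n => r ^+ n.+1) @ \oo --> 0.
    by have := cvg_expr (_ : `|r| < 1); rewrite ger0_norm// => /(_ r1); rewrite -(cvg_shiftS (GRing.exp r)).
  rewrite mulr_gt0// => /(_ isT)[n _ /(_ n (leqnn _))]; rewrite /= sub0r normrN => Hn.
  by exists n; rewrite ltr_pdivrMr// (le_lt_trans _ Hn)// ler_norm.
exists (P n); split; first exact: AP.
apply: le_lt_trans Hn; apply: supnorm_le => x.
rewrite PE cabsM cabsV cabsX ler_pM ?exprn_ge0 ?invr_ge0 ?cabs_ge0//.
  by rewrite lerXn2r ?nnegrE ?cabs_ge0.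
by rewrite lef_pV2 ?posrE// (lt_le_trans r10).
Qed.

(** If [M < |s u|], then [w := u / s u] has norm below 1 and [s w = 1]. The element
    [g := w / (1 - w)] of [A] satisfies [w + w * g = g], and applying [s] gives [1 + s g = s g]. *)
Lemma spectrum_le s u M : spectrum A s -> A u -> (forall x, cabs (u x) <= M) -> cabs (s u) <= M.
Proof.
move=> [sD sZ sM _ _] Au uM; rewrite leNgt; apply/negP => Ms.
have M0 : 0 <= M by exact: le_trans (cabs_ge0 _) (uM point).
have c0 : 0 < cabs (s u) by exact: le_lt_trans Ms.
have su0 : s u != 0 by apply/eqP => e; move: c0; rewrite e (cabs_real 0) normr0 ltxx.
pose w x := (s u)^-1 * u x.
have Aw : A w by exact: A_Z.
have sw : s w = 1 by rewrite sZ// mulVf.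
pose r := M / cabs (s u).
have r1 : r < 1 by rewrite ltr_pdivrMr// mul1r.
have wr x : cabs (w x) <= r.
  by rewrite cabsM cabsV mulrC ler_wpM2r// invr_ge0 ltW.
have Ag := neumann Aw r1 wr.
have := sD w (fun x => w x * (w x / (1 - w x))) Aw (A_M Aw Ag).
have := sM w _ Aw Ag; rewrite sw mul1r => ->.
have -> : (fun x => w x + w x * (w x / (1 - w x))) = (fun x => w x / (1 - w x)).
  apply/funext => x.
  have ne0 : 1 - w x != 0.
    rewrite subr_eq0; apply/eqP => e; have := wr x; rewrite -e (cabs_real 1) normr1.
    by rewrite leNgt r1.
  by move: (w x) ne0 => y ne0; field.
by move/eqP; rewrite -subr_eq0 opprD addrCA subrr addr0 oppr_eq0 oner_eq0.
Qed.

Lemma spectrum1 s : spectrum A s -> s (fun=> 1) = 1.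
Proof.
move=> [_ _ sM [u [Au su]] _]; have := sM _ _ Au (A_cst 1).
under eq_fun do rewrite mulr1.
by move=> /esym; rewrite -[RHS]mulr1 => /(mulfI su).
Qed.

Lemma spectrum_cst s c : spectrum A s -> s (fun=> c) = c.
Proof.
move=> ss; have [_ sZ _ _ _] := ss; have := sZ c _ (A_cst 1).
by rewrite spectrum1//; under eq_fun do rewrite mulr1; rewrite mulr1.
Qed.

(* Evaluating the norm inequality at [v + t i] for all real [t] forces the imaginary
   part of [s v] to vanish. *)
Lemma spectrum_real s v : spectrum A s -> A (rc v) -> complex.Im (s (rc v)) = 0.
Proof.
move=> ss Av; have [sD sZ sM _ _] := ss.
have [_ [M0 vM0]] := A_bounded_cont Av.
pose M : R := `|M0|; have vM x : `|v x| <= M.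
  by rewrite -cabs_real (le_trans (vM0 x))// ler_norm.
set z := s (rc v); apply/eqP/negPn/negP => b0.
(* This [t] makes [2 * b * t = M ^+ 2 + 1], so that [(b + t) ^+ 2] exceeds [M ^+ 2 + t ^+ 2]. *)
pose b := complex.Im z; pose t := (M ^+ 2 + 1) / (2 * b).
have H : cabs (s (fun x => rc v x + Complex 0 t)) <= Num.sqrt (M ^+ 2 + t ^+ 2).
  apply: spectrum_le => //; first by apply: A_D => //; exact: A_cst.
  move=> x; rewrite /cabs /= addr0 add0r ler_sqrt ?addr_ge0 ?sqr_ge0// lerD2r.
  by rewrite -(real_normK (num_real (v x))) ler_sqr ?nnegrE ?normr_ge0.
move: H; rewrite (sD _ _ Av (A_cst (Complex 0 t))) spectrum_cst// -/z /cabs ler_sqrt ?addr_ge0 ?sqr_ge0//.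
case: (z) b0 @b @t => a b /= b0; set t := _ / _; rewrite addr0.
have bt : 2 * b * t = M ^+ 2 + 1 by rewrite /t mulrC divfK// mulf_neq0// pnatr_eq0.
have := sqr_ge0 a; have := sqr_ge0 b; rewrite sqrrD; move: bt.
have -> : b * t *+ 2 = 2 * b * t by rewrite -mulr_natl mulrA.
move=> ->; lra.
Qed.

Definition AR : set (X -> R) := [set v | A (rc v)].

(* Set to [0] outside the spectrum, so that integrals over the spectrum can be taken over the
   whole ambient type. *)
Definition gelfand v : ((X -> C) -> C) -> R := (fun s => complex.Re (s (rc v))) \_ (spectrum A).

Lemma gelfandE v s : spectrum A s -> AR v -> s (rc v) = cofR (gelfand v s).
Proof.
move=> ss Av; rewrite /gelfand patchE mem_set//.
by apply/eqP; rewrite eq_complex /= eqxx spectrum_real// eqxx.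
Qed.

Lemma gelfand_out v s : ~ spectrum A s -> gelfand v s = 0.
Proof. by move=> ns; rewrite /gelfand patchE memNset. Qed.

Lemma rcD v w : rc (fun x => v x + w x) = fun x => rc v x + rc w x.
Proof. by apply/funext => x; exact: cofRD. Qed.

Lemma rcM v w : rc (fun x => v x * w x) = fun x => rc v x * rc w x.
Proof. by apply/funext => x; exact: cofRM. Qed.

Lemma AR_cst c : AR (fun=> c). Proof. exact: A_cst. Qed.

Lemma AR_D v w : AR v -> AR w -> AR (fun x => v x + w x).
Proof. by move=> Av Aw; rewrite /AR /= rcD; exact: A_D. Qed.

Lemma AR_M v w : AR v -> AR w -> AR (fun x => v x * w x).
Proof. by move=> Av Aw; rewrite /AR /= rcM; exact: A_M. Qed.

Lemma AR_Z c v : AR v -> AR (fun x => c * v x).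
Proof. by move=> Av; apply: AR_M => //; exact: AR_cst. Qed.

Lemma AR_continuous v : AR v -> continuous v.
Proof. by move=> /A_bounded_cont[[]]. Qed.

Lemma AR_bounded v : AR v -> exists M : R, forall x, `|v x| <= M.
Proof.
by move=> /A_bounded_cont[_ [M vM]]; exists M => x; rewrite -cabs_real; exact: vM.
Qed.

Lemma gelfandD v w s : AR v -> AR w ->
  gelfand (fun x => v x + w x) s = gelfand v s + gelfand w s.
Proof.
move=> Av Aw; have [ss|ns] := pselect (spectrum A s); last by rewrite !gelfand_out// addr0.
have [sD _ _ _ _] := ss.
by rewrite /gelfand !patchE mem_set// rcD sD// raddfD.
Qed.

Lemma gelfandM v w s : AR v -> AR w ->
  gelfand (fun x => v x * w x) s = gelfand v s * gelfand w s.
Proof.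
move=> Av Aw; have [ss|ns] := pselect (spectrum A s); last by rewrite !gelfand_out// mulr0.
have [_ _ sM _ _] := ss.
have := gelfandE ss (AR_M Av Aw); rewrite rcM sM// !gelfandE// -cofRM.
by move=> -[<-].
Qed.

Lemma gelfand_cst c s : spectrum A s -> gelfand (fun=> c) s = c.
Proof. by move=> ss; rewrite /gelfand patchE mem_set// (spectrum_cst (cofR c) ss). Qed.

Lemma gelfandZ c v s : AR v -> gelfand (fun x => c * v x) s = c * gelfand v s.
Proof.
move=> Av; have [ss|ns] := pselect (spectrum A s); last by rewrite !gelfand_out// mulr0.
by rewrite gelfandM ?gelfand_cst//; exact: AR_cst.
Qed.

Lemma gelfand_le v (M : R) s : AR v -> (forall x, `|v x| <= M) -> `|gelfand v s| <= M.
Proof.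
move=> Av vM; have [ss|ns] := pselect (spectrum A s); last first.
  by rewrite gelfand_out// normr0 (le_trans _ (vM point)).
rewrite -cabs_real -gelfandE//; apply: spectrum_le => // x.
by rewrite cabs_real.
Qed.

Lemma AR_Re u : A u -> AR (fun x => complex.Re (u x)).
Proof.
move=> Au; rewrite /AR /=.
rewrite (_ : rc _ = fun x => Complex 2^-1 0 * (u x + (u x)^*%C)).
  by apply: A_Z; apply: A_D => //; exact: A_conj.
apply/funext => x; rewrite /rc /cofR; case: (u x) => a b /=.
by apply/eqP; rewrite eq_complex /=; apply/andP; split; apply/eqP; field.
Qed.

Lemma AR_Im u : A u -> AR (fun x => complex.Im (u x)).
Proof.
move=> Au; have := AR_Re (A_Z (Complex 0 (-1)) Au).
rewrite /AR /=; congr A; apply/funext => x; rewrite /rc; case: (u x) => a b /=.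
by congr cofR; ring.
Qed.

Lemma spectrum_ReIm s u : spectrum A s -> A u ->
  s u = Complex (gelfand (fun x => complex.Re (u x)) s) (gelfand (fun x => complex.Im (u x)) s).
Proof.
move=> ss Au; have [sD sZ _ _ _] := ss.
have Ar := AR_Re Au; have Ai := AR_Im Au.
have {1}-> : u = fun x => rc (fun x => complex.Re (u x)) x + 'i%C * rc (fun x => complex.Im (u x)) x.
  apply/funext => x; rewrite /rc /cofR; case: (u x) => a b /=.
  by apply/eqP; rewrite eq_complex /=; apply/andP; split; apply/eqP; ring.
rewrite sD ?sZ//; last exact: A_Z.
rewrite !gelfandE//.
by apply/eqP; rewrite eq_complex /=; apply/andP; split; apply/eqP; ring.
Qed.

End Spectrum.

(** * Borel sets and mean values *)

Lemma measurable_fun_gt {d : measure_display} {T : measurableType d} {R : realType} (D : set T) (f : T -> R) :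
  (forall a, measurable (D `&` [set x | a < f x])) -> measurable_fun D f.
Proof.
move=> H; apply: (measurability _ (RGenOInfty.measurableE R)).
move=> _ [_ [a ->] <-]; rewrite (_ : _ @^-1` _ = [set x | a < f x])//.
by apply/seteqP; split => x /=; rewrite in_itv/= andbT.
Qed.

Section Borel.
Context {R : realType} {X : pseudoPMetricType R}.

Lemma open_borel (U : set X) : open U -> measurable (U : set (borel X)).
Proof. exact: sub_sigma_algebra. Qed.

Lemma compact_borel (K : set X) : hausdorff_space X -> compact K -> measurable (K : set (borel X)).
Proof.
move=> hX cK; rewrite -(setCK K); apply: measurableC; apply: open_borel.
by apply: closed_openC; exact: compact_closed.
Qed.

Lemma continuous_borel (v : X -> R) : continuous v -> measurable_fun (setT : set (borel X)) v.
Proof.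
move=> cv; apply: measurable_fun_gt => a; rewrite setTI; apply: open_borel.
rewrite (_ : [set x | _] = v @^-1` [set r | a < r])//.
by apply: open_comp => [x _|]; [exact: cv|exact: open_gt].
Qed.

Lemma continuous_borel_map (h : X -> X) : continuous h ->
  measurable_fun (setT : set (borel X)) (h : borel X -> borel X).
Proof.
move=> ch; apply: (@measurability _ _ (borel X) (borel X) setT h (@open X)) => // _ [U oU <-].
by rewrite setTI; apply: open_borel; apply: open_comp => // x _; exact: ch.
Qed.

(* Open balls with radius [1 / (m + 1)] around finitely many points of each compact set
   of an exhaustion form a countable base. *)
Lemma sigma_compact_base (K : nat -> set X) : (forall n, compact (K n)) -> \bigcup_n K n = setT ->
  exists b : nat -> set X, (forall i, open (b i)) /\
    forall (U : set X) x, open U -> U x -> exists i, b i x /\ b i `<=` U.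
Proof.
move=> cK KT.
have npos m : (0 : R) < m.+1%:R^-1 by [].
pose f m (z : X) : set X := (ball z (PosNum (npos m))%:num)^°.
have fc n m : finite_subset_cover [set: X] (f m) (K n).
  move: (cK n); rewrite compact_cover; apply.
  - by move=> z _; exact: open_interior.
  - by move=> z _; exists z => //; rewrite /f /interior; exact: nbhsx_ballx.
have fs n m : exists s : seq X, K n `<=` cover [set` s] (f m).
  by have [D _ KD] := fc n m; exists (finmap.enum_fset D).
pose D n m := projT1 (cid (fs n m)).
have DP n m : K n `<=` cover [set` D n m] (f m) by rewrite /D; case: cid.
pose c (k : nat * nat * nat) := f k.1.2 (nth point (D k.1.1 k.1.2) k.2).
pose b i := if unpickle i is Some k then c k else set0.
exists b; split.
  by move=> i; rewrite /b; case: unpickle => [k|]; [exact: open_interior|exact: open0].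
move=> U x oU Ux.
have /nbhs_ballP[_/posnumP[e] eU] : nbhs x U by exact: open_nbhs_nbhs.
have [//|m] := @ltr_add_invr R 0 (e%:num / 2) _; rewrite add0r => me.
have [n _ Knx] : (\bigcup_n K n) x by rewrite KT.
have [z zD fx] := DP n m x Knx.
exists (pickle (n, m, index z (D n m))); rewrite /b pickleK /c /= nth_index//.
split => // y fy; apply: eU.
rewrite [e%:num]splitr; apply: (@ball_triangle _ _ z).
  by apply: (le_ball (ltW me)); apply/ball_sym; exact: interior_subset fx.
by apply: (le_ball (ltW me)); exact: interior_subset fy.
Qed.

(** Outer regularity encloses [B] in an open [U] of nearly the same measure, and finite unions of
    basic sets inside [U] increase to [U]. The [V j] are all finite unions of basic sets, those of
    infinite measure being replaced by the empty set. *)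
Lemma radon_separable (lam : {measure set (borel X) -> \bar R}) (b : nat -> set X) :
  radon lam -> (forall i, open (b i)) ->
  (forall (U : set X) x, open U -> U x -> exists i, b i x /\ b i `<=` U) ->
  exists V : nat -> set (borel X), [/\ forall j, measurable (V j), forall j, (lam (V j) < +oo)%E &
    forall (B : set (borel X)) (e : R), measurable B -> (lam B < +oo)%E -> 0 < e ->
     exists j, (lam ((B `\` V j) `|` (V j `\` B)) <= e%:E)%E].
Proof.
move=> [_ outer _] ob bP.
pose W (s : seq nat) : set (borel X) := \bigcup_(i in [set` s]) b i.
have oW s : open (W s : set X) by apply: bigcup_open => i _; exact: ob.
pose V j := if unpickle j is Some s then (if (lam (W s) < +oo)%E then W s else set0) else set0.
exists V; split.
- move=> j; rewrite /V; case: unpickle => [s|//]; case: ifP => // _; exact: open_borel.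
- move=> j; rewrite /V; case: unpickle => [s|]; last by rewrite measure0 ltry.
  by case: ifP => // _; rewrite measure0 ltry.
move=> B e mB lB e0.
have e20 : 0 < e / 2 by rewrite divr_gt0.
have fB : lam B \is a fin_num by rewrite ge0_fin_numE.
have [U [[oU BU] UB]] : exists U : set X, (open U /\ B `<=` U) /\ (lam U < lam B + (e / 2)%:E)%E.
  have : (lam B < lam B + (e / 2)%:E)%E by rewrite lteDl// lte_fin.
  rewrite {1}outer// => /ereal_inf_lt[_ [U [oU BU] <-] UB].
  by exists U.
have mU : measurable (U : set (borel X)) by exact: open_borel.
have lU : (lam U < +oo)%E by rewrite (lt_le_trans UB)// leey.
have fU : lam U \is a fin_num by rewrite ge0_fin_numE.
pose s n := [seq i <- iota 0 n | `[< b i `<=` U >]].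
have WU n : W (s n) `<=` U.
  by move=> x [i /=]; rewrite mem_filter => /andP[/asboolP bU _] /bU.
have nd : nondecreasing_seq (fun n => W (s n)).
  move=> m n mn; apply/subsetPset => x [i /=]; rewrite mem_filter mem_iota => /andP[bU im] bx.
  by exists i => //=; rewrite mem_filter bU mem_iota (leq_trans im).
have bigW : \bigcup_n W (s n) = U.
  apply/seteqP; split => [x [n _ /WU]//|x Ux].
  have [i [bx bU]] := bP U x oU Ux.
  exists i.+1 => //; exists i => //=; rewrite mem_filter mem_iota/= add0n ltnSn andbT.
  exact/asboolP.
have mW t : measurable (W t) by exact: open_borel.
have cW : lam \o (fun n => W (s n)) @ \oo --> lam U.
  rewrite -[X in _ --> lam X]bigW; apply: nondecreasing_cvg_mu => //.
  by rewrite bigW.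
have lW n : (lam (W (s n)) < +oo)%E by apply: le_lt_trans lU; rewrite le_measure ?inE.
have [n Hn] : exists n, (lam U - (e / 2)%:E < lam (W (s n)))%E.
  have lt : (lam U - (e / 2)%:E < lam U)%E.
    by rewrite lteBlDr// lteDl// lte_fin.
  have [N _ /(_ N (leqnn _)) HN] := cW _ (open_ereal_gt' lt).
  by exists N.
exists (pickle (s n)); rewrite /V pickleK lW.
have mUW : measurable ((U : set (borel X)) `\` W (s n)) by exact: measurableD.
have mUB : measurable ((U : set (borel X)) `\` B) by exact: measurableD.
apply: (@le_trans _ _ (lam ((U : set (borel X)) `\` W (s n)) + lam ((U : set (borel X)) `\` B))%E).
  apply: le_trans (measureU2 _ mUW mUB).
  apply: le_measure; rewrite ?inE.
  - by apply: measurableU; exact: measurableD.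
  - exact: measurableU.
  - by move=> x [[Bx Wx]|[Wx Bx]]; [left; split => //; exact: BU|right; split => //; exact: WU Wx].
rewrite (splitr e) EFinD leeD//.
  rewrite measureD// (setIidr (WU n)).
  have fW : lam (W (s n)) \is a fin_num by rewrite ge0_fin_numE.
  by move: Hn; rewrite lteBlDr// => Hn; rewrite leeBlDr// addeC ltW.
rewrite measureD// (setIidr BU).
by rewrite leeBlDr// addeC ltW.
Qed.

End Borel.

Lemma ler_norm_Rint {d : measure_display} {T : measurableType d} {R : realType}
  (nu : {measure set T -> \bar R}) (f g : T -> R) : rint nu f -> rint nu g ->
  (forall x, `|f x| <= g x) -> `|\int[nu]_x f x| <= \int[nu]_x g x.
Proof.
move=> rf rg fg; rewrite ler_norml; apply/andP; split; last first.
  by apply: le_Rint => // x; rewrite (le_trans (ler_norm _)).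
rewrite -mulN1r -RintZ//; apply: le_Rint => //; first exact: rintZ.
by move=> x; have := fg x; rewrite ler_norml mulN1r => /andP[].
Qed.

(** * Mean values of elements of the algebra and of their powers *)

Section Homogenization.
Context {R : realType} {X : pseudoPMetricType R}.
Local Notation C := R[i].
Variables (E : set R) (H : R -> X -> X) (lam : {measure set (borel X) -> \bar R}) (A : set (X -> C))
  (beta : {measure set (Delta_type A) -> \bar R}).
Hypotheses (hA : homog_algebra E H lam A) (hbeta : gelfand_measure E H lam A beta).

Let A_bc u : A u -> bounded_cont u. Proof. by have [[h _] _ _ _ _] := hA; exact: h. Qed.
Let A_cst c : A (fun=> c). Proof. by have [[_ h] _ _ _ _] := hA; exact: h. Qed.
Let A_D u w : A u -> A w -> A (fun x => u x + w x). Proof. by have [_ h _ _ _] := hA; exact: h. Qed.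
Let A_Z (c : C) u : A u -> A (fun x => c * u x). Proof. by have [_ _ h _ _] := hA; exact: h. Qed.
Let A_M u w : A u -> A w -> A (fun x => u x * w x). Proof. by have [_ _ _ h _] := hA; exact: h. Qed.
Let A_conj u : A u -> A (fun x => (u x)^*%C). Proof. by have [_ _ _ _ [h _ _ _]] := hA; exact: h. Qed.
Let A_closed u : bounded_cont u ->
  (forall eta : R, 0 < eta -> exists w, A w /\ supnorm (fun x => u x - w x) < eta) -> A u.
Proof. by have [_ _ _ _ [_ h _ _]] := hA; exact: h. Qed.

Lemma measurable_spectrum : measurable (spectrum A : set (Delta_type A)).
Proof.
apply: sub_sigma_algebra; split => // s0 ss0.
by exists 0%N, (fun _ _ => 0), 1; split => // s [].
Qed.

Lemma gelfand_measurable v : AR A v -> measurable_fun (setT : set (Delta_type A)) (gelfand A v).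
Proof.
move=> Av; apply/(measurable_restrictT _ measurable_spectrum).
apply: measurable_fun_gt => a; apply: sub_sigma_algebra; split; first by move=> s [].
move=> s0 [ss0 /= as0].
exists 1%N, (fun=> rc v), (complex.Re (s0 (rc v)) - a); split => //; first by rewrite subr_gt0.
move=> s [ss] /(_ ord0) H0; split => //=.
have := le_lt_trans (normr_Re _) H0; rewrite raddfB /= ltr_norml => /andP[+ _].
by rewrite opprB ltrBrDr subrK.
Qed.

(** The constant 1 has mean 1, and every character takes the value 1 there. *)
Lemma gelfand_measure1 : beta setT = 1%E.
Proof.
have [b0 bM] := hbeta.
have M1 : Pi_inf_mean E H lam (fun=> 1) 1.
  move=> f _ eta eta0; exists setT; split; first exact: filterT.
  move=> eps _ _; rewrite (_ : (fun x => 1 * f x) = f); last by apply/funext => x; rewrite mul1r.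
  by rewrite mul1r subrr (cabs_real 0) normr0.
have := bM _ (A_cst 1) _ M1; rewrite /cint => /(congr1 (@complex.Re R)) /=.
rewrite (@eq_Rintegral _ _ _ _ _ (cst 1)); last first.
  by move=> s; rewrite inE => ss; rewrite (spectrum1 A_cst ss).
rewrite (Rintegral_cst _ measurable_spectrum) mul1r => b1.
have bD : beta (spectrum A) = 1%E.
  by move: b1; case: (beta _) => [r| |] /= => [->|/esym/eqP|/esym/eqP]//; rewrite eq_sym oner_eq0.
rewrite -(setvU (spectrum A : set (Delta_type A))) measureU;
  [|exact: measurableC measurable_spectrum|exact: measurable_spectrum|by rewrite setICl].
by rewrite [X in (X + _)%E]b0 [X in (_ + X)%E]bD add0e.
Qed.

Let gelfand_fin : (beta setT < +oo)%E. Proof. by rewrite gelfand_measure1 ltry. Qed.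

Lemma AR_dense : exists D : nat -> X -> R, (forall k, AR A (D k)) /\
  forall v (e : R), AR A v -> 0 < e -> exists k, forall y, `|v y - D k y| <= e.
Proof.
have [_ _ _ _ [_ _ [D [AD Dd]] _]] := hA.
exists (fun k x => complex.Re (D k x)); split; first by move=> k; exact: (AR_Re A_D A_Z A_conj).
move=> v e Av e0; have [k Hk] := Dd _ Av _ e0; exists k => y.
have [_ [M1 vM]] := A_bc Av; have [_ [M2 DM]] := A_bc (AD k).
have bd x : cabs (rc v x - D k x) <= M1 + M2.
  by rewrite (le_trans (ler_cabsD _ _))// cabsN lerD.
have := le_lt_trans (supnorm_ub bd y) Hk => /ltW.
by apply: le_trans; have := normr_Re (rc v y - D k y); rewrite raddfB.
Qed.

Variables (e : R) (eps : nat -> R).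
Hypothesis heps : fundamental_seq E e eps.
Let h n := H (eps n).
Hypothesis ch : forall n, continuous (h n).

(** The weak-star convergence is tested on the indicator of [B], which is in [L^1] because [lam B]
    is finite. *)
Lemma mean_value v (B : set (borel X)) : AR A v -> measurable B -> (lam B < +oo)%E ->
  (fun n => \int[lam]_x (\1_B x * v (h n x))) @ \oo --> fine (lam B) * \int[beta]_s gelfand A v s.
Proof.
move=> Av mB lB; have [_ _ _ _ [_ _ _ Amean]] := hA.
have [ut Mut] := Amean _ Av; have [_ bM] := hbeta.
have Eut : complex.Re ut = \int[beta]_s gelfand A v s.
  by rewrite (bM _ Av _ Mut) /cint /= Rintegral_mkcond.
have int1 : \int[lam]_x \1_B x = fine (lam B) :> R.
  by rewrite /Rintegral integral_indic// setIT.
have L1 : cLp lam setT 1 (rc (\1_B : X -> R)).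
  split; first by split; [exact: measurable_indic|exact: measurable_cst].
  under eq_integral do rewrite cabs_real powRr1// ger0_norm//.
  by rewrite integral_indic// setIT.
apply/cvgrPdist_lt => eta eta0.
have [V [nV HV]] := Mut _ L1 _ eta0.
have [hE heps_cvg] := heps.
have : \forall n \near \oo, V (eps n)%:E by exact: heps_cvg nV.
apply: filterS => n Vn.
have := HV _ (proj1 (hE n)) Vn.
apply: le_lt_trans; rewrite distrC; apply: le_trans (normr_Re _).
rewrite raddfB /= /cint /=.
case: ut Eut {Mut HV} => a b /= ->.
rewrite le_eqVlt; apply/orP; left; apply/eqP; congr (`| _ - _ |).
  by apply: eq_Rintegral => x _; rewrite mulr0 subr0 mulrC.
rewrite int1 mulrC (_ : Rintegral _ _ (fun=> 0) = 0) ?mulr0 ?subr0//.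
by rewrite /Rintegral integral0.
Qed.

Lemma mean_value_pabs q v (B : set (borel X)) : 1 < q -> AR A v -> measurable B -> (lam B < +oo)%E ->
  (fun n => \int[lam]_x (\1_B x * pabs q (v (h n x)))) @ \oo -->
  fine (lam B) * \int[beta]_s pabs q (gelfand A v s).
Proof.
move=> q1 Av mB lB; have q0 : 0 < q by rewrite (lt_trans _ q1).
have [M1 vM1] := AR_bounded A_bc Av.
pose M := `|M1| + 1.
have M0 : 0 < M by rewrite ltr_wpDl.
have vM x : `|v x| <= M by rewrite (le_trans (vM1 x))// (le_trans (ler_norm _))// lerDl.
have gM s : `|gelfand A v s| <= M.
  exact: (gelfand_le A_bc A_cst A_D A_Z A_M A_closed).
(* [Q] collects the functions whose composition with [v] stays in the algebra and commutes with the
   transform. The second condition is restricted to the spectrum, since outside it [gelfand] is 0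
   while [g 0] need not be. *)
pose Q (g : R -> R) := AR A (fun x => g (v x)) /\
  forall s, spectrum A s -> gelfand A (fun x => g (v x)) s = g (gelfand A v s).
pose L := q * M `^ (q - 1).
have L0 : 0 <= L by rewrite mulr_ge0 ?powR_ge0// ltW.
have lip a b : `|a| <= M -> `|b| <= M -> `|pabs q a - pabs q b| <= L * `|a - b|.
  move=> aM bM; apply: (le_trans (pabs_lipschitz _ _ q1)); rewrite ler_wpM2r//.
  rewrite ler_wpM2l ?(ltW q0)// ge0_ler_powR ?nnegrE ?subr_ge0 ?(ltW q1) ?(ltW M0)//.
  by rewrite ge_max aM bM.
have Qc c : Q (cst c) by split; [exact: AR_cst|move=> s ss; exact: gelfand_cst].
have QD g1 g2 : Q g1 -> Q g2 -> Q (fun t => g1 t + g2 t).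
  move=> [A1 e1] [A2 e2]; split; first exact: AR_D.
  by move=> s ss; rewrite (gelfandD s A1 A2) e1// e2.
have QM g1 g2 : Q g1 -> Q g2 -> Q (fun t => g1 t * g2 t).
  move=> [A1 e1] [A2 e2]; split; first exact: AR_M.
  by move=> s ss; rewrite (gelfandM A_bc A_cst A_D A_Z A_M A_closed s A1 A2) e1// e2.
pose l := fine (lam B); have l0 : 0 <= l by rewrite fine_ge0.
apply/cvgrPdist_lt => eta eta0.
(* Replacing [pabs q] by [g] moves the integrals and their limit by at most [l * k <= eta / 3]; the
   last third is the mean value of [g] at [v]. *)
pose k := eta / 3 / (l + 1).
have k0 : 0 < k by rewrite divr_gt0 ?divr_gt0// ltr_wpDl.
have lk : l * k <= eta / 3.
  by rewrite /k mulrCA -[leRHS]mulr1 ler_pM2l ?divr_gt0// ler_pdivrMr ?ltr_wpDl// mul1r lerDl.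
have [g [Ag gS] gP] := weierstrass_lipschitz M0 L0 k0 lip Qc (conj Av (fun s _ => erefl)) QD QM.
have mg := gelfand_measurable Ag; have mv := gelfand_measurable Av.
have [N gN] := AR_bounded A_bc Ag.
have cv := continuous_borel (AR_continuous A_bc Av).
have cg := continuous_borel (AR_continuous A_bc Ag).
have mh n : measurable_fun (setT : set (borel X)) (h n : borel X -> borel X).
  exact: continuous_borel_map.
have gk s : `|pabs q (gelfand A v s) - gelfand A (fun x => g (v x)) s| <= k.
  have [ss|ns] := pselect (spectrum A s); first by rewrite (gS s ss); exact: gP.
  by rewrite !gelfand_out// pabs0 ?gt_eqF// subr0 normr0 ltW.
have pM t : `|t| <= M -> `|pabs q t| <= pabs q M.
  move=> tM; rewrite ger0_norm ?pabs_ge0//; apply: le_pabs; first exact: ltW.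
  by rewrite [leRHS]ger0_norm ?(ltW M0).
have rI : rint beta (fun s => pabs q (gelfand A v s)).
  apply: (bounded_rint gelfand_fin (M := pabs q M)); last by move=> s; exact: pM.
  exact: (measurable_pabs_comp _ mv).
have rI' : rint beta (gelfand A (fun x => g (v x))).
  apply: (bounded_rint gelfand_fin (M := N) mg) => s.
  exact: (gelfand_le A_bc A_cst A_D A_Z A_M A_closed).
have rk : rint beta (cst k).
  by apply: (bounded_rint gelfand_fin (M := k)) => // s; rewrite ger0_norm ?(ltW k0).
have II' : `|\int[beta]_s pabs q (gelfand A v s) - \int[beta]_s gelfand A (fun x => g (v x)) s| <= k.
  rewrite -RintB//; apply: le_trans (ler_norm_Rint _ rk gk) _; first exact: rintB.
  by rewrite Rintegral_cst// gelfand_measure1 mulr1.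
have JJ' n : `|\int[lam]_x (\1_B x * pabs q (v (h n x))) - \int[lam]_x (\1_B x * g (v (h n x)))| <= l * k.
  have r1 : rint lam (fun x => \1_B x * pabs q (v (h n x))).
    apply: (rint_indicM (M := pabs q M)) => //; last by move=> x; exact: pM.
    have mvh : measurable_fun (setT : set (borel X)) (fun x : borel X => v (h n x)).
      exact: (measurableT_comp cv (mh n)).
    exact: (measurable_pabs_comp _ mvh).
  have r2 : rint lam (fun x => \1_B x * g (v (h n x))).
    by apply: (rint_indicM (M := N)) => //; apply: (measurableT_comp cg (mh n)).
  have r3 : rint lam (fun x => k * \1_B x) by apply: rintZ; exact: rint_indic.
  rewrite -RintB//; apply: le_trans (ler_norm_Rint _ r3 _) _; first exact: rintB.
    move=> x; rewrite -mulrBr normrM mulrC [`|\1_B x|]ger0_norm// ler_wpM2r//.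
    exact: gP.
  rewrite RintZ ?rint_indic// /Rintegral integral_indic// setIT mulrC//.
have := mean_value Ag mB lB => /cvgrPdist_lt /(_ (eta / 3)).
rewrite divr_gt0// => /(_ isT); apply: filterS => n Hn.
have := JJ' n; have : `|l * \int[beta]_s pabs q (gelfand A v s) - l * \int[beta]_s gelfand A (fun x => g (v x)) s| <= l * k.
  by rewrite -mulrBr normrM ger0_norm// ler_wpM2l.
move: Hn; rewrite -/l.
move: (l * \int[beta]_s pabs _ _) (l * \int[beta]_s gelfand _ _ _) (\int[lam]_x _) (\int[lam]_x _) lk.
move: (l * k) => c a b j i ck; rewrite !ltr_norml !ler_norml.
by move=> /andP[? ?] /andP[? ?] /andP[? ?]; apply/andP; split; lra.
Qed.

End Homogenization.

(** * The exhaustion of a homogenizer, and simple approximations *)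

Section Topology.
Context {R : realType} {X : pseudoPMetricType R}.
Variables (E : set R) (mul : R -> R -> R) (e : R) (inv : R -> R) (H : R -> X -> X) (w : X)
  (lam : {measure set (borel X) -> \bar R}) (eps : nat -> R).
Hypotheses (RE : R_group E mul e inv) (hom : homogenizer E mul e inv H w lam)
  (heps : fundamental_seq E e eps).

Lemma action_continuous a : E a -> continuous (H a).
Proof.
move=> Ea x; have [_ _ cH _ _] := hom.
have /subspace_continuousP/(_ (a, x)) := cH; rewrite /= => /(_ (conj Ea I)) cx.
have pc : (fun y : X => (a, y)) @ x --> within (E `*` [set: X]) (nbhs (a, x)).
  move=> /= U; rewrite nbhs_simpl /within /= => -[[V W] /= [Va Wx] VWU].
  rewrite nbhs_simpl; apply: filterS Wx => y Wy.
  by apply: (VWU (a, y)); split => //=; exact: nbhs_singleton.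
exact: (cvg_comp _ _ pc cx).
Qed.

(* Translating [1 < 2] by [a / 2] gives an element below [a]. *)
Lemma group_no_min a : E a -> exists2 z, E z & z < a.
Proof.
move=> Ea; have [nat_E [Ee Emul Einv [mulA mulC mul1 mulV]] ord _ _] := RE.
have E1 : E 1 by exact: (nat_E 0%N).
have E2 : E 2 by exact: (nat_E 1%N).
pose c := mul a (inv 2); have Ec : E c by apply: Emul => //; exact: Einv.
have c2 : mul 2 c = a.
  by rewrite mulC// /c -mulA//; [rewrite mulV// mulC// mul1|exact: Einv].
exists (mul 1 c); first exact: Emul.
rewrite lt_neqAle; apply/andP; split; last by rewrite -c2 ord// ler1n.
apply/eqP; rewrite -c2 => /(congr1 (fun z => mul z (inv c))).
have Ic := Einv _ Ec; have cI : mul c (inv c) = e by rewrite mulC// mulV.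
rewrite -(mulA 1 c)// -(mulA 2 c)// cI (mulC 1 e)// (mulC 2 e)// !mul1// => /eqP.
by rewrite lt_eqF// ltr1n.
Qed.

(** As [E] has no least element, [theta E] lies strictly below [a], and the sequence eventually
    passes below [a]. *)
Lemma fundamental_seq_le a : E a -> \forall n \near \oo, eps n <= a.
Proof.
move=> Ea; have [z Ez za] := group_no_min Ea; have [_ cv] := heps.
have ta : (theta E < a%:E)%E.
  by apply: (@le_lt_trans _ _ z%:E); [apply: ereal_inf_lbound; exists z|rewrite lte_fin].
have : \forall n \near \oo, ((eps n)%:E < a%:E)%E by exact: cv (open_ereal_lt' ta).
by apply: filterS => n; rewrite lte_fin => /ltW.
Qed.

(** By absorption, [H (inv (eps n))] sends [x] into the compact neighbourhood [K] of the center once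
    [eps n] is small; [H (eps n)] brings it back. *)
Lemma homogenizer_exhaustion : exists K : nat -> set X,
  (forall n, compact (K n)) /\ \bigcup_n K n = setT.
Proof.
have [nat_E [Ee Emul Einv [mulA mulC mul1 mulV]] ord _ _] := RE.
have [[lc _] [_ Hm H1] _ ctr _] := hom; have [epsE _] := heps.
have [K [wK cK]] := lc w.
exists (fun n => H (eps n) @` K); split.
  move=> n; apply: continuous_compact => //; apply: continuous_subspaceT.
  by apply: action_continuous; exact: (proj1 (epsE n)).
apply/seteqP; split => // x _.
have [U [Ux [a [Ea aP]]]] := ctr _ wK x.
have [n _ /(_ n (leqnn _)) na] := fundamental_seq_le Ea.
have En := proj1 (epsE n).
exists n => //; exists (H (inv (eps n)) x).
  by apply: (aP _ En na); exists x => //; exact: nbhs_singleton.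
have := Hm _ _ En (Einv _ En); rewrite mulC// ?mulV//; last exact: Einv.
by rewrite H1 => /(congr1 (fun f => f x)).
Qed.

Lemma homogenizer_sigma_finite : hausdorff_space X -> sigma_finite setT lam.
Proof.
move=> hX; have [K [cK KT]] := homogenizer_exhaustion.
have [_ _ _ _ [[lK _ _] _ _ _]] := hom.
by exists K => // n; split; [exact: compact_borel|exact: lK].
Qed.

End Topology.

(** A nonnegative integral is a supremum over the simple functions below, so comparison holds for
    arbitrary functions, such as the partial integrals in [iterated_integral_fin]. *)
Lemma ge0_le_integralT {d : measure_display} {T : measurableType d} {R : realType}
  (mu : {measure set T -> \bar R}) (f g : T -> \bar R) :
  (forall x, 0 <= f x)%E -> (forall x, f x <= g x)%E -> (\int[mu]_x f x <= \int[mu]_x g x)%E.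
Proof.
move=> f0 fg; rewrite !ge0_integralTE//; last by move=> x; exact: le_trans (fg x).
by apply: le_ereal_sup => _ [h hf <-]; exists h => // x; exact: le_trans (fg x).
Qed.

Lemma rint_superlevel_fin {d : measure_display} {T : measurableType d} {R : realType}
  (nu : {measure set T -> \bar R}) (f : T -> R) (B : set T) (c : R) : rint nu f ->
  measurable B -> 0 < c -> (forall x, 0 <= f x) -> (forall x, B x -> c <= f x) -> (nu B < +oo)%E.
Proof.
move=> rf mB c0 f0 Bf.
have : (\int[nu]_x (c * \1_B x)%:E <= \int[nu]_x (f x)%:E)%E.
  apply: ge0_le_integralT => x; first by rewrite lee_fin mulr_ge0// ltW.
  rewrite lee_fin indicE; have [|_] := boolP (x \in B); last by rewrite mulr0.
  by rewrite inE mulr1; exact: Bf.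
rewrite Rint_EFin// => /le_lt_trans/(_ (ltry _)).
under eq_integral do rewrite EFinM.
rewrite ge0_integralZl//=; [|by apply/measurable_EFinP; exact: measurable_indic|exact: ltW].
by rewrite integral_indic// setIT; case: (nu B) => [r| |]//; rewrite ?ltry ?ltNyr// gt0_muley ?lte_fin.
Qed.

Section FinitelyValued.
Context {d : measure_display} {X : measurableType d} {R : realType}.

(** The values lie in a bare type: with finite range, measurable fibers make the composition with
    any real function measurable. *)
Definition finitely_valued {T : Type} (g : X -> T) :=
  finite_set (range g) /\ forall v, measurable (g @^-1` [set v]).

Lemma finitely_valued_measurable (T : Type) (g : X -> T) (F : T -> R) : finitely_valued g ->
  measurable_fun setT (fun x => F (g x)).
Proof.
move=> [fg mg]; apply: measurable_fun_gt => a; rewrite setTI.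
rewrite (_ : [set x | _] = \bigcup_(v in range g `&` [set v | a < F v]) (g @^-1` [set v])).
  by apply: fin_bigcup_measurable => //; exact: sub_finite_set fg.
apply/seteqP; split => [x /= ax|x [v [_ /= av] ->]//].
by exists (g x) => //; split => //; exists x.
Qed.

Lemma finitely_valued_pair (T U : Type) (g : X -> T) (h : X -> U) : finitely_valued g ->
  finitely_valued h -> finitely_valued (fun x => (g x, h x)).
Proof.
move=> [fg mg] [fh mh]; split.
  by apply: sub_finite_set (finite_setX fg fh) => _ [x _ <-]; split; exists x.
move=> [v w]; rewrite (_ : _ @^-1` _ = g @^-1` [set v] `&` h @^-1` [set w]).
  exact: measurableI.
by apply/seteqP; split => x /= => [[<- <-]|[-> ->]].
Qed.

End FinitelyValued.

(** * Approximation of Bochner integrable maps by simple ones *)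

Section Approximation.
Context {R : realType} {X : pseudoPMetricType R}.
Local Notation C := R[i].
Variables (lam : {sigma_finite_measure set (borel X) -> \bar R}) (A : set (X -> C)).
Hypotheses (A_bounded : forall u, A u -> exists M, forall x, cabs (u x) <= M).

Lemma supnorm_ge0 u : A u -> 0 <= supnorm u.
Proof.
by move=> Au; have [M uM] := A_bounded Au; rewrite (le_trans _ (supnorm_ub uM point))// cabs_ge0.
Qed.

Lemma supnormBC (u w : X -> C) : supnorm (fun x => u x - w x) = supnorm (fun x => w x - u x).
Proof. by rewrite /supnorm; under eq_fun do rewrite -cabsN opprB. Qed.

Lemma supnorm_leD u w : A u -> A w -> supnorm u <= supnorm (fun x => u x - w x) + supnorm w.
Proof.
move=> Au Aw; have [M uM] := A_bounded Au; have [N wN] := A_bounded Aw.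
apply: supnorm_le => x; rewrite -[u x](subrK (w x)) (le_trans (ler_cabsD _ _))// lerD//.
  apply: (@supnorm_ub _ _ (fun x => u x - w x) (M + N)) => y.
  by rewrite (le_trans (ler_cabsD _ _))// cabsN lerD.
exact: (supnorm_ub wN).
Qed.

Lemma supnorm_leB u w : A u -> A w -> supnorm (fun x => u x - w x) <= supnorm u + supnorm w.
Proof.
move=> Au Aw; have [M uM] := A_bounded Au; have [N wN] := A_bounded Aw.
apply: supnorm_le => x; rewrite (le_trans (ler_cabsD _ _))// cabsN lerD//.
  exact: (supnorm_ub uM).
exact: (supnorm_ub wN).
Qed.

Lemma supnorm_triangle u v w : A u -> A v -> A w ->
  supnorm (fun x => u x - w x) <= supnorm (fun x => u x - v x) + supnorm (fun x => v x - w x).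
Proof.
move=> Au Av Aw; have [M uM] := A_bounded Au; have [N wN] := A_bounded Aw.
have [P vP] := A_bounded Av.
apply: supnorm_le => x; rewrite -[u x](subrK (v x)) -addrA (le_trans (ler_cabsD _ _))// lerD//.
  apply: (@supnorm_ub _ _ (fun x => u x - v x) (M + P)) => y.
  by rewrite (le_trans (ler_cabsD _ _))// cabsN lerD.
apply: (@supnorm_ub _ _ (fun x => v x - w x) (P + N)) => y.
by rewrite (le_trans (ler_cabsD _ _))// cabsN lerD.
Qed.

(** [f] will be the real or the imaginary part, so that one argument serves both. *)
Variables (Om : set X) (q : R) (psi : X -> X -> C) (f : C -> R).
Hypotheses (mOm : measurable (Om : set (borel X))) (q0 : 0 < q) (psiL : LpA lam Om A q psi).
Hypotheses (f0 : f 0 = 0) (fB : forall z w, f (z - w) = f z - f w) (f_le : forall z, `|f z| <= cabs z).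
Hypotheses (AR0 : AR A (fun=> 0)) (Af : forall u, A u -> AR A (fun x => f (u x))).

Definition extend_zero (x y : X) : C := if x \in Om then psi x y else 0.

Lemma extend_zero_AR x : AR A (fun y => f (extend_zero x y)).
Proof.
rewrite /extend_zero; have [|_] := boolP (x \in Om); last by rewrite f0.
by rewrite inE => xO; apply: Af; have [h _ _] := psiL; exact: h.
Qed.

(* The given simple maps [sn m] are replaced by [0] where their norm exceeds twice the one of
   [psi x]; this makes the fibers of nonzero values of finite measure, and [3 |psi x|] a
   dominating function for the error [G m]. *)
Lemma LpA_simple_approx : simple_approx lam q (AR A) (fun x y => f (extend_zero x y)).
Proof.
have [Apsi [sn [fin_sn Asn meas_sn sn_cvg]] psi_fin] := psiL.
have fv n : finitely_valued (sn n : borel X -> X -> C) by split.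
pose D m x := supnorm (fun y => sn m x y - psi x y).
pose g0 := (fun x => supnorm (psi x)) \_ Om.
have D0 m x : Om x -> 0 <= D m x.
  move=> Ox; have [M uM] := A_bounded (Asn m x); have [N wN] := A_bounded (Apsi _ Ox).
  rewrite (le_trans (cabs_ge0 (sn m x point - psi x point)))//.
  apply: (@supnorm_ub _ _ (fun y => sn m x y - psi x y) (M + N)) => y.
  by rewrite (le_trans (ler_cabsD _ _))// cabsN lerD.
have Dcvg x : Om x -> (fun m => D m x) @ \oo --> 0 by exact: sn_cvg.
(* Measurability is given only for the fibers of the [sn n]. The norm of [psi] and the errors [D m]
   inherit it on [Om] as limits, at distance at most [D n] from the [n]-th term. *)
have cvg_Om (F : nat -> X -> R) (l : X -> R) :
    (forall n, measurable_fun (setT : set (borel X)) (F n : borel X -> R)) ->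
    (forall n x, Om x -> `|l x - F n x| <= D n x) ->
    measurable_fun (setT : set (borel X)) (l \_ Om : borel X -> R).
  move=> mF Fl; apply/(measurable_restrictT _ mOm).
  apply: (@measurable_fun_cvg _ (borel X) _ Om F).
    by move=> n; exact: measurable_funS (mF n).
  move=> x Ox; apply/cvgrPdist_le => e e0; have /cvgrPdist_le/(_ _ e0) := Dcvg x Ox.
  apply: filterS => n; rewrite sub0r normrN => Dn.
  by rewrite (le_trans (Fl n x Ox))// (le_trans (ler_norm _)).
have mg0 : measurable_fun (setT : set (borel X)) (g0 : borel X -> R).
  apply: (cvg_Om (fun n x => supnorm (sn n x))).
    move=> n; exact: (finitely_valued_measurable (@supnorm R X) (fv n)).
  move=> n x Ox; have An := Asn n x; have Ap := Apsi _ Ox.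
  have := supnorm_leD An Ap; have := supnorm_leD Ap An; rewrite supnormBC -/(D n x) ler_norml.
  by move: (supnorm (psi x)) (supnorm (sn n x)) (D n x) => a b c ? ?; apply/andP; split; lra.
have mD m : measurable_fun (setT : set (borel X)) (D m \_ Om : borel X -> R).
  apply: (cvg_Om (fun n x => supnorm (fun y => sn m x y - sn n x y))).
    move=> n; have fvp := finitely_valued_pair (fv m) (fv n).
    exact: (finitely_valued_measurable (fun uw => supnorm (fun y => uw.1 y - uw.2 y)) fvp).
  move=> n x Ox; have An := Asn n x; have Am := Asn m x; have Ap := Apsi _ Ox.
  have := supnorm_triangle Am An Ap; have := supnorm_triangle Am Ap An.
  rewrite [supnorm (fun y => psi x y - sn n x y)]supnormBC -/(D n x) -/(D m x) ler_norml.
  by move: (D m x) (D n x) (supnorm _) => a b c ? ?; apply/andP; split; lra.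
have g00 x : 0 <= g0 x.
  by rewrite /g0 patchE; case: ifPn => // /set_mem Ox; exact/supnorm_ge0/Apsi.
have g0I : rint lam (fun x => pabs q (g0 x)).
  apply/integrableP; split; first by apply/measurable_EFinP; exact: (measurable_pabs_comp _ mg0).
  apply: le_lt_trans psi_fin; rewrite [leRHS]integral_mkcond; apply: ge0_le_integralT => //.
  move=> x; rewrite /= /g0 !patchE; case: ifPn => [/set_mem Ox|_].
    by rewrite lee_fin /pabs !ger0_norm ?powR_ge0// supnorm_ge0//; exact: Apsi.
  by rewrite lee_fin pabs0 ?gt_eqF// normr0.
have g0L : Lpow lam q g0 by split.
pose Bm m : set (borel X) := [set x | Om x /\ supnorm (sn m x) <= 2 * g0 x].
have mB m : measurable (Bm m).
  have mF : measurable_fun (setT : set (borel X)) (fun x : borel X => supnorm (sn m x) - 2 * g0 x).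
    apply: measurable_funB; last exact: measurable_funM.
    exact: (finitely_valued_measurable (@supnorm R X) (fv m)).
  rewrite (_ : Bm m = Om `&` (setT `&` (fun x : borel X => supnorm (sn m x) - 2 * g0 x) @^-1` `]-oo, 0])).
    by apply: measurableI => //; exact: mF.
  rewrite setTI; apply/seteqP; split => x /=; rewrite in_itv/= subr_le0//.
pose G m x := if x \in Bm m then D m x else g0 x.
have G0 m x : 0 <= G m x.
  by rewrite /G; case: ifPn => [/set_mem[Ox _]|//]; exact: D0.
have GE m : G m = fun x => \1_(Bm m) x * (D m \_ Om) x + (1 - \1_(Bm m) x) * g0 x.
  apply/funext => x; rewrite /G indicE; case: ifPn => [/set_mem[Ox _]|_].
    by rewrite patchE mem_set// subrr mul0r addr0 mul1r.
  by rewrite mul0r add0r subr0 mul1r.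
have mG m : measurable_fun (setT : set (borel X)) (G m : borel X -> R).
  have mi : measurable_fun (setT : set (borel X)) (\1_(Bm m) : borel X -> R) by exact: measurable_indic.
  rewrite GE; apply: measurable_funD; apply: measurable_funM => //.
  exact: measurable_funB.
have g0E x : Om x -> g0 x = supnorm (psi x) by move=> Ox; rewrite /g0 patchE mem_set.
have Gg m x : G m x <= 3 * g0 x.
  rewrite /G; case: ifPn => [/set_mem[Ox]|_]; last by have := g00 x; lra.
  have := supnorm_leB (Asn m x) (Apsi _ Ox); rewrite g0E// -/(D m x).
  by move: (D m x) (supnorm _) (supnorm _) => a b c; lra.
have GD m x : Om x -> G m x <= D m x.
  move=> Ox; rewrite /G; case: ifPn => // /negP; rewrite inE => nB.
  have : ~~ (supnorm (sn m x) <= 2 * g0 x) by apply/negP => h; apply: nB; split.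
  rewrite -ltNge g0E//; have := supnorm_leD (Asn m x) (Apsi _ Ox); rewrite -/(D m x).
  by move: (D m x) (supnorm _) (supnorm _) => a b c; lra.
have g0out x : ~ Om x -> g0 x = 0 by move=> nO; rewrite /g0 patchE memNset.
have Gcvg x : (fun m => G m x) @ \oo --> 0.
  have [Ox|nO] := pselect (Om x).
    apply: (squeeze_cvgr _ (cvg_cst 0) (Dcvg x Ox)); apply: nearW => m.
    by rewrite G0 GD.
  rewrite (_ : (fun m => _) = fun=> 0); first exact: cvg_cst.
  apply/funext => m; apply/eqP; rewrite eq_le G0 andbT.
  by have := Gg m x; rewrite g0out// mulr0.
have GL m : Lpow lam q (G m).
  apply: (@le_Lpow _ _ _ _ q (G m) (fun x => 3 * g0 x)) => //; [exact: ltW| |exact: LpowZ].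
  by move=> x; rewrite ger0_norm.
pose psim m x y := if x \in Bm m then f (sn m x y) else 0.
exists psim, G; split => //.
- move=> m; have [s sE] := (@finite_seqP _ _).1 (fin_sn m).
  have sP x : sn m x \in s by have : range (sn m) (sn m x) by [exists x]; rewrite sE.
  (* The index is a value of [sn m] with a flag telling whether it is kept. *)
  exists (seq_sub s * bool)%type, (fun x => (SeqSub (sP x), x \in Bm m)),
    (fun jb y => if jb.2 then f (ssval jb.1 y) else 0).
  have fib j b : (fun x => (SeqSub (sP x), x \in Bm m)) @^-1` [set (j, b)] =
      sn m @^-1` [set ssval j] `&` (if b then Bm m else ~` Bm m).
    apply/seteqP; split => x /=.
      move=> [<- <-]; split => //; have [/set_mem//|] := boolP (x \in Bm m).
      by move=> /negP; rewrite inE.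
    move=> [jE bE]; congr pair; first exact: val_inj.
    by case: b bE => ?; [exact: mem_set|exact: memNset].
  split => //.
  + move=> [j []] //=; apply: Af.
    have : range (sn m) (ssval j) by rewrite sE; exact: ssvalP.
    by move=> [x _ <-].
  + move=> [j b]; rewrite fib; apply: measurableI => //; case: b => //; exact: measurableC.
  + move=> [j []]; last by right.
    have Aj : A (ssval j).
      have : range (sn m) (ssval j) by rewrite sE; exact: ssvalP.
      by move=> [x _ <-].
    have [j0|jN] := ltP 0 (supnorm (ssval j)); last first.
      right; apply/funext => y /=; apply/eqP; rewrite -normr_le0.
      have [M jM] := A_bounded Aj.
      by rewrite (le_trans (f_le _))// (le_trans (supnorm_ub jM _)).
    (* A kept nonzero value forces [g0] to be at least half its norm on the fiber, where Chebyshev's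
       inequality applies. *)
    left; rewrite fib; apply: (rint_superlevel_fin (c := pabs q (supnorm (ssval j) / 2)) g0I).
    * by apply: measurableI.
    * by rewrite lt_neqAle pabs_ge0 andbT eq_sym pabs_eq0// gt_eqF// divr_gt0.
    * by move=> x; exact: pabs_ge0.
    * move=> x [/= <- [_ h]]; apply: le_pabs; first exact: ltW.
      rewrite !ger0_norm//; first by rewrite ler_pdivrMr// mulrC.
      by rewrite divr_ge0// supnorm_ge0.
- move=> m x y; rewrite /psim /G /extend_zero; have [/set_mem[Ox _]|_] := boolP (x \in Bm m).
    rewrite mem_set// -fB (le_trans (f_le _))// -cabsN opprB.
    have [M uM] := A_bounded (Asn m x); have [N wN] := A_bounded (Apsi _ Ox).
    apply: (@supnorm_ub _ _ (fun y => sn m x y - psi x y) (M + N)) => z.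
    by rewrite (le_trans (ler_cabsD _ _))// cabsN lerD.
  rewrite subr0; have [/set_mem Ox|_] := boolP (x \in Om); last by rewrite f0 normr0.
  have [N wN] := A_bounded (Apsi _ Ox).
  by rewrite (le_trans (f_le _))// g0E// (supnorm_ub wN).
have [|||||_ cvgI] := @Rint_dominated _ _ _ lam (fun m x => pabs q (G m x)) (fun=> 0)
    (fun x => pabs q (3 * g0 x)).
- by move=> m; exact: (measurable_pabs_comp _ (mG m)).
- exact: measurable_cst.
- apply: aeW => x; have := cvg_comp _ _ (Gcvg x) (@continuous_pabs R q q0 0).
  by rewrite pabs0.
- by have [] := LpowZ 3 g0L.
- apply: aeW => x m; rewrite ger0_norm ?pabs_ge0//; apply: le_pabs; first exact: ltW.
  by rewrite !ger0_norm// mulr_ge0.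
by rewrite (_ : 0 = \int[lam]_x 0)// /Rintegral integral0.
Qed.

End Approximation.

(** * Complex-valued sequences *)

Lemma Lpow_restrict {d : measure_display} {T : measurableType d} {R : realType}
  (nu : {measure set T -> \bar R}) (D : set T) (p c : R) (f F : T -> R) : 0 < p -> measurable D ->
  measurable_fun D f -> (forall x, `|f x| <= F x) ->
  (\int[nu]_(x in D) (F x `^ p)%:E <= c%:E)%E ->
  Lpow nu p (f \_ D) /\ \int[nu]_x pabs p ((f \_ D) x) <= c.
Proof.
move=> p0 mD mf fF Fc.
have mfD : measurable_fun setT (f \_ D) by apply/(measurable_restrictT _ mD).
have le : (\int[nu]_x (pabs p ((f \_ D) x))%:E <= c%:E)%E.
  apply: le_trans Fc; rewrite [leRHS]integral_mkcond; apply: ge0_le_integralT => x.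
    by rewrite lee_fin pabs_ge0.
  rewrite !patchE; case: ifPn => _; last by rewrite pabs0.
  have F0 : 0 <= F x by rewrite (le_trans _ (fF x)).
  by rewrite lee_fin /pabs ge0_ler_powR ?nnegrE ?(ltW p0).
have rf : rint nu (fun x => pabs p ((f \_ D) x)).
  apply/integrableP; split; first by apply/measurable_EFinP; exact: (measurable_pabs_comp _ mfD).
  apply: le_lt_trans (ltry c); apply: le_trans le; apply: ge0_le_integralT => x //=.
  by rewrite lee_fin ger0_norm ?pabs_ge0.
by split; [split|rewrite -lee_fin -Rint_EFin].
Qed.

Section IteratedIntegral.
Context {d1 d2 : measure_display} {X : measurableType d1} {S : measurableType d2} {R : realType}.
Variables (lam : {sigma_finite_measure set X -> \bar R}) (beta : {sigma_finite_measure set S -> \bar R}).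
Notation mu := (lam \x beta)%E.
Variables (D1 : set X) (D2 : set S).

(** Passes from the whole ambient types, where the limits are computed, to the iterated integrals
    over [Om] and the spectrum. *)
Lemma Rint_prod_restrict (F : X -> S -> R) (G : X * S -> R) : rint mu G ->
  (forall x s, D1 x -> D2 s -> G (x, s) = F x s) ->
  (forall x s, ~ (D1 x /\ D2 s) -> G (x, s) = 0) ->
  \int[mu]_z G z = \int[lam]_(x in D1) \int[beta]_(s in D2) F x s.
Proof.
move=> rG GF G0; rewrite (Rint_prod rG) [RHS]Rintegral_mkcond; apply: eq_Rintegral => x _.
rewrite patchE; have [/set_mem xD|/negP] := boolP (x \in D1).
  rewrite [RHS]Rintegral_mkcond; apply: eq_Rintegral => s _; rewrite patchE.
  have [/set_mem sD|/negP] := boolP (s \in D2); first exact: GF.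
  by rewrite inE => sD; rewrite G0// => -[].
rewrite inE => xD; rewrite -[RHS](_ : \int[beta]_s 0 = 0); last by rewrite /Rintegral integral0.
by apply: eq_Rintegral => s _; rewrite G0// => -[].
Qed.

Lemma iterated_integral_fin (F : X -> S -> R) (K : X * S -> R) : rint mu K ->
  (forall x s, 0 <= F x s) -> (forall x s, F x s <= K (x, s)) ->
  (\int[lam]_(x in D1) \int[beta]_(s in D2) (F x s)%:E < +oo)%E.
Proof.
move=> rK F0 FK; have K0 z : 0 <= K z by case: z => x s; exact: le_trans (F0 x s) (FK x s).
apply: (@le_lt_trans _ _ (\int[mu]_z (K z)%:E)%E); last by rewrite Rint_EFin// ltry.
rewrite fubini_tonelli1//; last by apply/measurable_EFinP; exact: rint_measurable rK.
have in0 x : (0 <= \int[beta]_(s in D2) (F x s)%:E)%E.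
  by apply: integral_ge0 => s _; rewrite lee_fin.
rewrite integral_mkcond; apply: ge0_le_integralT => x.
  by rewrite patchE; case: ifPn.
rewrite /fubini_F patchE; case: ifPn => _; last by apply: integral_ge0 => s _; rewrite lee_fin.
rewrite [leLHS]integral_mkcond.
apply: (@ge0_le_integralT _ _ _ beta _ (fun s => (K (x, s))%:E)) => s.
  by rewrite patchE; case: ifPn; rewrite ?lee_fin.
by rewrite patchE; case: ifPn => _; rewrite lee_fin.
Qed.

End IteratedIntegral.

Section Assembly.
Context {R : realType} {X : pseudoPMetricType R}.
Local Notation C := R[i].
Variables (E : set R) (e : R) (H : R -> X -> X) (A : set (X -> C)) (Om : set X) (eps : nat -> R)
  (lam : {sigma_finite_measure set (borel X) -> \bar R})
  (beta : {sigma_finite_measure set (Delta_type A) -> \bar R}) (p : R).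
Hypotheses (hA : homog_algebra E H lam A) (hbeta : gelfand_measure E H lam A beta)
  (heps : fundamental_seq E e eps) (ch : forall n, continuous (H (eps n))) (oOm : open Om)
  (p1 : 1 < p).
Hypothesis base : exists V : nat -> set (borel X),
  [/\ forall j, measurable (V j), forall j, (lam (V j) < +oo)%E &
    forall (B : set (borel X)) (e : R), measurable B -> (lam B < +oo)%E -> 0 < e ->
     exists j, (lam ((B `\` V j) `|` (V j `\` B)) <= e%:E)%E].
Variables (u : nat -> X -> C) (c : R).
Hypotheses (uL : forall n, cLp lam Om p (u n))
  (uc : forall n, (\int[lam]_(x in Om) ((cabs (u n x)) `^ p)%:E <= c%:E)%E).

Notation mu := (lam \x beta)%E.
Let q := p / (p - 1).
Let h n := H (eps n).
Let hat : (borel X -> R) -> Delta_type A -> R := gelfand A.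

Let p0 : 0 < p. Proof. by rewrite (lt_trans _ p1). Qed.
Let q1 : 1 < q. Proof. by rewrite /q ltr_pdivlMr ?subr_gt0// mul1r gtrBl. Qed.
Let q0 : 0 < q. Proof. by rewrite (lt_trans _ q1). Qed.
Let pq : p^-1 + q^-1 = 1.
Proof. by rewrite /q invf_div -{1}[p^-1]mul1r -mulrDl addrC subrK divff// gt_eqF. Qed.

Let A_bc v : A v -> bounded_cont v. Proof. by have [[a _] _ _ _ _] := hA; exact: a. Qed.
Let A_cst z : A (fun=> z). Proof. by have [[_ a] _ _ _ _] := hA; exact: a. Qed.
Let A_D v w : A v -> A w -> A (fun x => v x + w x). Proof. by have [_ a _ _ _] := hA; exact: a. Qed.
Let A_Z (z : C) v : A v -> A (fun x => z * v x). Proof. by have [_ _ a _ _] := hA; exact: a. Qed.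
Let A_M v w : A v -> A w -> A (fun x => v x * w x). Proof. by have [_ _ _ a _] := hA; exact: a. Qed.
Let A_conj v : A v -> A (fun x => (v x)^*%C). Proof. by have [_ _ _ _ [a _ _ _]] := hA; exact: a. Qed.
Let A_closed v : bounded_cont v ->
  (forall eta : R, 0 < eta -> exists w, A w /\ supnorm (fun x => v x - w x) < eta) -> A v.
Proof. by have [_ _ _ _ [_ a _ _]] := hA; exact: a. Qed.
Let A_bounded v : A v -> exists M, forall x, cabs (v x) <= M.
Proof. by move=> /A_bc[]. Qed.

(* [k] is a subsequence extracted beforehand: it lets one treat the imaginary parts along the
   subsequence found for the real parts. *)
Lemma real_part_compactness (v : nat -> X -> R) (k : nat -> nat) : {homo k : m n / (m < n)%N} ->
  (forall n, Lpow lam p (v n)) -> (forall n, \int[lam]_x pabs p (v n x) <= c) ->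
  exists phi : nat -> nat, {homo phi : m n / (m < n)%N} /\
  exists u0 : borel X * Delta_type A -> R, Lpow mu p u0 /\
  forall psi, (forall x, AR A (psi x)) -> simple_approx lam q (AR A) psi ->
    [/\ forall n, Lpow lam q (fun x => psi x (h (k n) x)), Lpow mu q (hatx hat psi) &
    (fun n => pairing lam h v (k (phi n)) psi) @ \oo --> \int[mu]_z (u0 z * hatx hat psi z)].
Proof.
move=> kh vL vc; have [V [mV fV Vd]] := base; have [D [AD Dd]] := AR_dense hA.
have hm : forall (w : X -> R) (B : set (borel X)), AR A w -> measurable B -> (lam B < +oo)%E ->
    (fun n => \int[lam]_x (\1_B x * pabs q (w (h (k n) x)))) @ \oo -->
    fine (lam B) * \int[beta]_s pabs q (gelfand A w s).
  move=> w B Aw mB lB.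
  exact: (cvg_subseq kh (mean_value_pabs hA hbeta heps ch q1 Aw mB lB)).
have AR_m w : AR A w -> measurable_fun (setT : set (borel X)) w.
  by move=> Aw; apply: continuous_borel => x; exact: (AR_continuous A_bc Aw).
have g_le w M s : AR A w -> (forall x, `|w x| <= M) -> `|gelfand A w s| <= M.
  exact: (gelfand_le A_bc A_cst A_D A_Z A_M A_closed).
have g_m w : AR A w -> measurable_fun (setT : set (Delta_type A)) (gelfand A w).
  exact: (gelfand_measurable hA).
have h_m n : measurable_fun (setT : set (borel X)) (h (k n) : borel X -> borel X).
  apply: (@continuous_borel_map R X (h (k n))); exact: ch.
have [phi [phih [u0 [u0L Hu0]]]] := @real_sigma_compactness _ _ (borel X) (Delta_type A) R lam beta
  (gelfand_measure1 hA hbeta) p q p0 q1 pq (AR A) (gelfand A)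
  (AR_cst A_cst 0) (AR_D A_D) (AR_Z A_cst A_M) AR_m (fun w => @AR_bounded R X A A_bc w)
  (fun v w s => @gelfandD R X A v w s)
  (fun z w s => @gelfandZ R X A A_bc A_cst A_D A_Z A_M A_closed z w s) g_m g_le
  (fun n => h (k n)) h_m hm (fun n => v (k n)) c
  (fun n => vL (k n)) (fun n => vc (k n)) D V AD Dd mV fV Vd.
exists phi; split => //; exists u0; split => // psi Ap sap.
by have [[_ ? ?] cv] := Hu0 _ Ap sap; split.
Qed.


Lemma hatx_extend_zero (f : C -> R) psi x s : f 0 = 0 -> ~ (Om x /\ spectrum A s) ->
  hatx hat (fun x y => f (extend_zero Om psi x y)) (x, s) = 0.
Proof.
move=> f0 nxs; rewrite /hatx /hat /=; have [ss|ns] := pselect (spectrum A s); last exact: gelfand_out.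
rewrite (_ : (fun y => _) = fun=> 0); first exact: (gelfand_cst A_cst).
by apply/funext => y; rewrite /extend_zero memNset// => Ox; exact: nxs.
Qed.

Theorem sigma_compactness : exists phi : nat -> nat, {homo phi : m n / (m < n)%N >-> (m < n)%N} /\
  exists u0 : X -> ((X -> C) -> C) -> C, Lp_prod lam Om A beta p u0 /\
    forall psi : X -> X -> C, LpA lam Om A q psi ->
      ccvg (fun n => cint lam Om (fun x => u (phi n) x * psi x (H (eps (phi n)) x)))
           (cint lam Om (fun x => cint beta (spectrum A) (fun s => u0 x s * s (psi x)))).
Proof.
have mOm := open_borel oOm.
pose ur n : borel X -> R := (fun x => complex.Re (u n x)) \_ Om.
pose ui n : borel X -> R := (fun x => complex.Im (u n x)) \_ Om.
have rP n := Lpow_restrict p0 mOm (uL n).1.1 (fun x => normr_Re (u n x)) (uc n).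
have iP n := Lpow_restrict p0 mOm (uL n).1.2 (fun x => normr_Im (u n x)) (uc n).
have [phi1 [phi1h [a [aL Ha]]]] := @real_part_compactness ur id (fun _ _ mn => mn)
  (fun n => (rP n).1) (fun n => (rP n).2).
have [phi2 [phi2h [b [bL Hb]]]] := @real_part_compactness ui phi1 phi1h
  (fun n => (iP n).1) (fun n => (iP n).2).
exists (fun n => phi1 (phi2 n)); split; first by move=> m n mn; apply/phi1h/phi2h.
exists (fun x s => Complex (a (x, s)) (b (x, s))); split.
  have [[ma ia] [mb ib]] := (aL, bL).
  have mOS (g : borel X * Delta_type A -> R) : measurable_fun setT g ->
      measurable_fun ((Om : set (borel X)) `*` (spectrum A : set (Delta_type A))) (fun z => g (z.1, z.2)).
    move=> mg; rewrite (_ : (fun z => _) = g); last by apply/funext => -[].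
    exact: measurable_funS mg.
  split; first by split; exact: mOS.
  have rK : rint mu (fun z => 2 `^ p * (pabs p (a z) + pabs p (b z))) by apply: rintZ; exact: rintD.
  apply: (iterated_integral_fin (F := fun x s => cabs (Complex (a (x, s)) (b (x, s))) `^ p) _ _ rK).
    by move=> x s; exact: powR_ge0.
  move=> x s; have := cabs_ReIm (Complex (a (x, s)) (b (x, s))) => /= cab.
  have := pabsD `|a (x, s)| `|b (x, s)| (ltW p0).
  rewrite /pabs !normr_id => ab; apply: le_trans ab.
  rewrite ge0_ler_powR ?nnegrE ?(ltW p0) ?cabs_ge0//.
  by rewrite (le_trans cab)// ler_norm.
move=> psi psiL.
pose psir x y := complex.Re (extend_zero Om psi x y).
pose psii x y := complex.Im (extend_zero Om psi x y).
have Ar x : AR A (psir x).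
  by apply: (extend_zero_AR psiL (f := @complex.Re R) erefl (AR_cst A_cst 0)) => v; exact: AR_Re.
have Ai x : AR A (psii x).
  by apply: (extend_zero_AR psiL (f := @complex.Im R) erefl (AR_cst A_cst 0)) => v; exact: AR_Im.
have sr : simple_approx lam q (AR A) psir.
  apply: (LpA_simple_approx A_bounded mOm q0 psiL (f := @complex.Re R)) => //.
  - by move=> v w; rewrite raddfB.
  - exact: normr_Re.
  - exact: (AR_cst A_cst).
  - by move=> v; exact: AR_Re.
have si : simple_approx lam q (AR A) psii.
  apply: (LpA_simple_approx A_bounded mOm q0 psiL (f := @complex.Im R)) => //.
  - by move=> v w; rewrite raddfB.
  - exact: normr_Im.
  - exact: (AR_cst A_cst).
  - by move=> v; exact: AR_Im.
(* The convergence of the real parts along [phi1] persists along the finer subsequence; all four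
   pairings of parts are needed for the complex product. *)
have [rL hrL /(cvg_subseq phi2h) car] := Ha _ Ar sr.
have [iL hiL /(cvg_subseq phi2h) cai] := Ha _ Ai si.
have [_ _ cbr] := Hb _ Ar sr; have [_ _ cbi] := Hb _ Ai si.
have rp := rint_pair p0 q0 pq.
have ReE n : \int[lam]_(x in Om) complex.Re (u n x * psi x (h n x)) =
    pairing lam h ur n psir - pairing lam h ui n psii.
  rewrite /pairing -RintB; [|exact: rp (rP n).1 (rL n)|exact: rp (iP n).1 (iL n)].
  rewrite Rintegral_mkcond; apply: eq_Rintegral => x _.
  rewrite /ur /ui /psir /psii /extend_zero !patchE; case: (x \in Om); last by rewrite !mul0r subr0.
  by case: (u n x) (psi x _) => ? ? [].
have ImE n : \int[lam]_(x in Om) complex.Im (u n x * psi x (h n x)) =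
    pairing lam h ur n psii + pairing lam h ui n psir.
  rewrite /pairing -RintD; [|exact: rp (rP n).1 (iL n)|exact: rp (iP n).1 (rL n)].
  rewrite Rintegral_mkcond; apply: eq_Rintegral => x _.
  rewrite /ur /ui /psir /psii /extend_zero !patchE; case: (x \in Om); last by rewrite !mul0r addr0.
  by case: (u n x) (psi x _) => ? ? [].
have sE x s : Om x -> spectrum A s ->
    s (psi x) = Complex (hatx hat psir (x, s)) (hatx hat psii (x, s)).
  move=> Ox ss; have [Apsi _ _] := psiL.
  rewrite (spectrum_ReIm A_bc A_cst A_D A_Z A_M A_conj A_closed ss (Apsi _ Ox)).
  by rewrite /hatx /psir /psii /extend_zero /= mem_set.
have r0 x s : ~ (Om x /\ spectrum A s) -> hatx hat psir (x, s) = 0 by exact: hatx_extend_zero.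
have i0 x s : ~ (Om x /\ spectrum A s) -> hatx hat psii (x, s) = 0 by exact: hatx_extend_zero.
split => /=.
  rewrite -(@Rint_prod_restrict _ _ _ _ _ lam beta Om (spectrum A) _
    (fun z => a z * hatx hat psir z - b z * hatx hat psii z)).
  - rewrite RintB; [|exact: rp aL hrL|exact: rp bL hiL].
    under eq_fun do rewrite ReE; exact: cvgB.
  - by apply: rintB; [exact: rp aL hrL|exact: rp bL hiL].
  - by move=> x s Ox ss; rewrite sE.
  - by move=> x s nxs; rewrite r0// i0// !mulr0 subr0.
rewrite -(@Rint_prod_restrict _ _ _ _ _ lam beta Om (spectrum A) _
  (fun z => a z * hatx hat psii z + b z * hatx hat psir z)).
- rewrite RintD; [|exact: rp aL hiL|exact: rp bL hrL].
  under eq_fun do rewrite ImE; exact: cvgD.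
- by apply: rintD; [exact: rp aL hiL|exact: rp bL hrL].
- by move=> x s Ox ss; rewrite sE.
- by move=> x s nxs; rewrite r0// i0// !mulr0 addr0.
Qed.

End Assembly.

(** The structure is rebuilt over the same set function, which makes the equality definitional and
    lets it replace the given measure by substitution. *)
Lemma sigma_finite_measureP {d : measure_display} {T : measurableType d} {R : realType}
  (nu : {measure set T -> \bar R}) : sigma_finite setT nu ->
  exists nu' : {sigma_finite_measure set T -> \bar R}, (nu' : {measure set T -> \bar R}) = nu.
Proof.
case: nu => m cm sf; pose M := Measure_isSigmaFinite.Build d T R (Measure.Pack cm) sf.
pose nu' : {sigma_finite_measure set T -> \bar R} := HB.pack (Measure.sort (Measure.Pack cm)) M.
exists nu'; reflexivity.
Qed.

Unset Implicit Arguments.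
Set Strict Implicit.
Set Printing Implicit Defensive.

Theorem theorem6p1 (R : realType)
  (E : set R) (mul : R -> R -> R) (e : R) (inv : R -> R)
  (X : pseudoPMetricType R) (H : R -> X -> X) (w : X)
  (lam : {measure set (borel X) -> \bar R})
  (Om : set X) (A : set (X -> R[i]))
  (beta : {measure set (Delta_type A) -> \bar R})
  (p : R) (eps : nat -> R) (u : nat -> X -> R[i]) :
  R_group E mul e inv ->
  homogenizer E mul e inv H w lam ->
  hausdorff_space X ->
  open Om -> Om !=set0 ->
  homog_algebra E H lam A ->
  gelfand_measure E H lam A beta ->
  1 < p ->
  fundamental_seq E e eps ->
  (exists c : R, forall n, cLp lam Om p (u n) /\
     (\int[lam]_(x in Om) ((cabs (u n x)) `^ p)%:E <= c%:E)%E) ->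
  exists phi : nat -> nat, {homo phi : m n / (m < n)%N >-> (m < n)%N} /\
  exists u0 : X -> ((X -> R[i]) -> R[i]) -> R[i], Lp_prod lam Om A beta p u0 /\
    forall psi : X -> X -> R[i], LpA lam Om A (p / (p - 1)) psi ->
      ccvg (fun n => cint lam Om (fun x => u (phi n) x * psi x (H (eps (phi n)) x)))
           (cint lam Om (fun x => cint beta (spectrum A) (fun s => u0 x s * s (psi x)))).

Proof.
move=> RE hom hX oOm _ hA hbeta p1 heps [c uc].
have [K [cK KT]] := homogenizer_exhaustion RE hom heps.
have [b [ob bP]] := sigma_compact_base cK KT.
have [_ _ _ _ [lam_radon _ _ _]] := hom.
have base := radon_separable lam_radon ob bP.
have ch n : continuous (H (eps n)).
  by apply: (action_continuous hom); have [epsE _] := heps; have [] := epsE n.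
have [lam' lamE] := sigma_finite_measureP (homogenizer_sigma_finite RE hom heps hX).
have [beta' betaE] : exists nu : {sigma_finite_measure set (Delta_type A) -> \bar R},
    (nu : {measure set (Delta_type A) -> \bar R}) = beta.
  apply: sigma_finite_measureP; exists (fun=> setT); first by rewrite bigcup_const.
  by move=> _; split => //; rewrite (gelfand_measure1 hA hbeta) ltry.
subst lam beta.
exact: (sigma_compactness hA hbeta heps ch oOm p1 base (fun n => (uc n).1) (fun n => (uc n).2)).
Qed.
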